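(* Let $n\ge1$, $p\in(1,\infty)$, $s\in(0,1)$ with $\frac{sp}{p-1}=1$. Assume that $k(z):=K(z)|z|^{n+ps}\in C^{0,\tilde\alpha}(\mathbb{R}^n)$ for some $\tilde\alpha>0$. (1) Let $u\in C(\bar B_2)\cap L^{p-1}_{sp}(\mathbb{R}^n)$ be a viscosity solution to $\mathscr{L}u=f$ in $B_2$, where $f$ satisfies $$W:=\sup_{t\in(0,1]}\omega_{B_2}(t)\,|\log t|^{\,n+1+2p(1-s)}<\infty,\qquad\omega_{B_2}(t)=\sup\{|f(x)-f(y)|:|x-y|\le t,\ x,y\in B_2\}.$$ Then $u\in C^{0,1}(B_1)$ and $$\|u\|_{C^{0,1}(B_1)}\le C_1\Bigl(\sup_{B_2}|u|+\mathrm{Tail}(u;0,2)+W^{\frac1{p-1}}\Bigr)$$ for some constant $C_1$ dependent only on $\lambda,\Lambda,n,p,s,\tilde\alpha$ and the $\tilde\alpha$-Hölder norm of $k$. (2) Furthermore, if $u\in C(\bar B_2)\cap L^{p-1}_{sp}(\mathbb{R}^n)$ is a viscosity solution to $-C\le\mathscr{L}u\le C$ in $B_2$ for some constant $C\ge 0$, then there exist $\theta>0$, dependent on $n,p,s$, and a constant $C_1$, dependent only on $\lambda,\Lambda,n,p,s,\tilde\alpha$ and the $\tilde\alpha$-Hölder norm of $k$, such that $$|u(x)-u(y)|\le C_1\Bigl(\sup_{B_2}|u|+\mathrm{Tail}(u;0,2)+C^{\frac1{p-1}}\Bigr)|x-y|\bigl(1+\bigl|\log|x-y|\bigr|^{\theta}\bigr)$$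 for all $x,y\in B_1$ (the right-hand side being read as $0$ when $x=y$).
   Context: $B_r(x_0)$ is the open ball of radius $r$ centred at $x_0$ and $B_r=B_r(0)$. $K:\mathbb{R}^n\setminus\{0\}\to(0,\infty)$ is a continuous function, symmetric ($K(z)=K(-z)$), with $\frac{\lambda}{|z|^{n+ps}}\le K(z)\le\frac{\Lambda}{|z|^{n+ps}}$ for $z\neq0$, where $0<\lambda\le\Lambda$. The operator is $\mathscr{L}u(x)=\mathrm{PV}\int_{\mathbb{R}^n}|u(x)-u(y)|^{p-2}(u(x)-u(y))K(x-y)\,dy$. The function $k$ is defined for $z\ne0$ and extended continuously to $0$. $L^{p-1}_{sp}(\mathbb{R}^n)=\{v\in L^{p-1}_{\rm loc}(\mathbb{R}^n):\int_{\mathbb{R}^n}\frac{|v(z)|^{p-1}}{(1+|z|)^{n+sp}}dz<\infty\}$ and $\mathrm{Tail}(v;x,r)=\bigl(r^{sp}\int_{|z-x|\ge r}\frac{|v(z)|^{p-1}}{|z-x|^{n+sp}}dz\bigr)^{\frac1{p-1}}$. $\|\cdot\|_{C^{0,1}(B_1)}$ is the sup norm plus the Lipschitz seminorm. Viscosity solutions. For an open set $D$ and $\eta\in C^2(D)$ let $N_\eta=\{x\in D:\nabla\eta(x)=0\}$, $d_\eta(x)=\mathrm{dist}(x,N_\eta)$, and let $C^2_\beta(D)$ be the set of $\eta\in C^2(D)$ with $\sup_{x\in D\setminus N_\eta}\bigl[\frac{\min\{d_\eta(x),1\}^{\beta-1}}{|\nabla\eta(x)|}+\frac{|D^2\eta(x)|}{d_\eta(x)^{\beta-2}}\bigr]<\infty$.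 A function $u:\mathbb{R}^n\to\mathbb{R}$ is a viscosity subsolution to $\mathscr{L}u=g$ in an open set $\Omega$ if: (i) $u$ is upper semicontinuous in $\bar\Omega$; (ii) whenever $\eta\in C^2(B_r(x_0))$ with $B_r(x_0)\subset\Omega$, $\eta(x_0)=u(x_0)$, $\eta\ge u$ in $B_r(x_0)$, and either (a) $p>\frac2{2-s}$ or $\nabla\eta(x_0)\neq0$, or (b) $1<p\le\frac{2}{2-s}$, $\nabla\eta(x_0)=0$, $x_0$ is an isolated critical point of $\eta$, and $\eta\in C^2_\beta(B_r(x_0))$ for some $\beta>\frac{sp}{p-1}$, then $\mathscr{L}\eta_r(x_0)\le g(x_0)$, where $\eta_r=\eta$ in $B_r(x_0)$ and $\eta_r=u$ otherwise; (iii) $u_+\in L^{p-1}_{sp}(\mathbb{R}^n)$. $u$ is a viscosity supersolution to $\mathscr{L}u=g$ if $-u$ is a viscosity subsolution to $\mathscr{L}v=-g$; a viscosity solution is both. Being a viscosity solution to $-C\le\mathscr{L}u\le C$ means being a viscosity subsolution to $\mathscr{L}u=C$ and a viscosity supersolution to $\mathscr{L}u=-C$. *)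

(* Defs.v *)
From HB Require Import structures.
From mathcomp Require Import all_boot all_order all_algebra.
From mathcomp Require Import all_classical all_reals all_analysis.
Set Implicit Arguments.
Unset Strict Implicit.
Unset Printing Implicit Defensive.
Import Order.TTheory GRing.Theory Num.Theory.
Import numFieldNormedType.Exports.
Local Open Scope classical_set_scope.
Local Open Scope ring_scope.

(* Lebesgue measure on R^n. The library has it on R only: we take the n-fold
   product on n-tuples, transport it to row vectors, and complete it, so that
   measurability of functions on R^n means Lebesgue measurability. *)

Section lebesgue_tuple.
Context {R : realType}.
Local Notation RB := (measurableTypeR R).

Definition cons_rt n (xt : (RB * n.-tuple RB)%type) : n.+1.-tuple RB :=
  [the n.+1.-tuple RB of xt.1 :: xt.2].

Lemma measurable_cons_rt n : measurable_fun setT (@cons_rt n).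
Proof. by apply: measurable_cons; [exact: measurable_fst|exact: measurable_snd]. Qed.

HB.instance Definition _ n :=
  isMeasurableFun.Build _ _ _ _ (@cons_rt n) (@measurable_cons_rt n).

Section step.
Variables (n : nat) (m : {sigma_finite_measure set (n.-tuple RB) -> \bar R}).

Definition lebesgue_cons : set (n.+1.-tuple RB) -> \bar R :=
  pushforward (@lebesgue_measure R \x m)%E (@cons_rt n).

Fact lebesgue_cons0 : lebesgue_cons set0 = 0%E.
Proof. exact: measure0. Qed.

Fact lebesgue_cons_ge0 A : (0 <= lebesgue_cons A)%E.
Proof. exact: measure_ge0. Qed.

Fact lebesgue_cons_sigma_additive : semi_sigma_additive lebesgue_cons.
Proof. exact: measure_semi_sigma_additive. Qed.

HB.instance Definition _ := isMeasure.Build _ _ _ lebesgue_cons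
  lebesgue_cons0 lebesgue_cons_ge0 lebesgue_cons_sigma_additive.

Fact lebesgue_cons_sigma_finite : sigma_finite setT lebesgue_cons.
Proof.
have /sigma_finiteP[F [TF ndF Foo]] := sigma_finiteT (@lebesgue_measure R).
have /sigma_finiteP[G [TG ndG Goo]] := sigma_finiteT m.
pose c (t : n.+1.-tuple RB) : RB * n.-tuple RB :=
  (tnth t ord0, [tuple of behead t]).
have mc : measurable_fun setT c.
  apply/measurable_fun_pairP; split; first exact: measurable_tnth.
  exact: measurable_behead.
have cK : cancel (@cons_rt n) c.
  move=> [x t]; rewrite /c /cons_rt /=; congr (_, _); exact/val_inj.
exists (fun k => c @^-1` (F k `*` G k)).
  rewrite -preimage_bigcup (_ : \bigcup_k _ = setT) ?preimage_setT//.
  apply/seteqP; split=> // -[x y] _.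
  have [i _ Fix] : (\bigcup_k F k) x by rewrite -TF.
  have [j _ Gjy] : (\bigcup_k G k) y by rewrite -TG.
  exists (maxn i j) => //; split.
  - by move: x Fix; exact/subsetPset/ndF/leq_maxl.
  - by move: y Gjy; exact/subsetPset/ndG/leq_maxr.
move=> k; have [mFk Fk] := Foo k; have [mGk Gk] := Goo k; split.
  by rewrite -[X in measurable X]setTI; apply: mc => //; exact: measurableX.
rewrite /lebesgue_cons /pushforward -comp_preimage.
rewrite (_ : c \o _ = id); last by apply/funext => xt; exact: cK.
by rewrite preimage_id product_measure1E// lte_mul_pinfty// ge0_fin_numE.
Qed.

HB.instance Definition _ := Measure_isSigmaFinite.Build _ _ _ lebesgue_cons
  lebesgue_cons_sigma_finite.

End step.

Fixpoint lebesgue_tuple n : {sigma_finite_measure set (n.-tuple RB) -> \bar R} :=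
  if n is n'.+1 then lebesgue_cons (lebesgue_tuple n')
  else \d_ ([tuple] : 0.-tuple RB).

End lebesgue_tuple.

Section lebesgue_rV.
Context {R : realType}.
Local Notation RB := (measurableTypeR R).

Definition tuple_of_rV n (v : 'rV[R]_n) : n.-tuple RB := [tuple v ord0 i | i < n].
Definition rV_of_tuple n (t : n.-tuple RB) : 'rV[R]_n := \row_i tnth t i.

Definition borel_rV n := g_sigma_algebra_preimageType (@tuple_of_rV n).

Lemma rV_of_tupleK n : cancel (@rV_of_tuple n) (@tuple_of_rV n).
Proof.
by move=> t; apply: eq_from_tnth => i; rewrite tnth_mktuple mxE.
Qed.

Lemma measurable_rV_of_tuple n :
  measurable_fun setT (@rV_of_tuple n : n.-tuple RB -> borel_rV n).
Proof.
move=> _ _ [B mB <-]; rewrite !setTI -comp_preimage.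
rewrite (_ : _ \o _ = id)//; apply/funext => t; exact: rV_of_tupleK.
Qed.

HB.instance Definition _ n := isMeasurableFun.Build _ _ _ _
  (@rV_of_tuple n : n.-tuple RB -> borel_rV n) (@measurable_rV_of_tuple n).

Definition lebesgue_borel n : set (borel_rV n) -> \bar R :=
  pushforward (@lebesgue_tuple R n) (@rV_of_tuple n : n.-tuple RB -> borel_rV n).

Fact lebesgue_borel0 n : @lebesgue_borel n set0 = 0%E.
Proof. exact: measure0. Qed.

Fact lebesgue_borel_ge0 n A : (0 <= @lebesgue_borel n A)%E.
Proof. exact: measure_ge0. Qed.

Fact lebesgue_borel_sigma_additive n : semi_sigma_additive (@lebesgue_borel n).
Proof. exact: measure_semi_sigma_additive. Qed.

HB.instance Definition _ n := isMeasure.Build _ _ _ (@lebesgue_borel n)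
  (@lebesgue_borel0 n) (@lebesgue_borel_ge0 n) (@lebesgue_borel_sigma_additive n).

Definition leb n := @completed_measure_extension _ _ _ (@lebesgue_borel n).
HB.instance Definition _ n := Measure.on (@leb n).

(* 'rV[R]_n equipped with the Lebesgue sigma-algebra *)
Definition lebesgue_rV n :=
  caratheodory_type (mu_ext (@lebesgue_borel n)).
HB.instance Definition _ n := Measurable.on (lebesgue_rV n).

End lebesgue_rV.

Arguments leb {R} n.
Arguments lebesgue_rV : clear implicits.

Section euclidean.
Context {R : realType}.

(* The library norm on matrices is the max norm. This one is the Euclidean norm
   on row vectors and the Frobenius norm on Hessians. *)
Definition enorm m n (A : 'M[R]_(m, n)) : R :=
  Num.sqrt (\sum_i \sum_j A i j ^+ 2).

Definition eball n (x : 'rV[R]_n) (r : R) : set 'rV[R]_n :=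
  [set y | enorm (y - x) < r].

End euclidean.

Section function_spaces.
Context {R : realType}.
Variable n : nat.
Implicit Types (u v f : 'rV[R]_n -> R) (D : set 'rV[R]_n).

Definition sup_norm D u : \bar R := ereal_sup [set `|u x|%:E | x in D].

Definition holder_seminorm D (alpha : R) u : \bar R :=
  ereal_sup [set (`|u xy.1 - u xy.2| / enorm (xy.1 - xy.2) `^ alpha)%:E
            | xy in [set xy | [/\ D xy.1, D xy.2 & xy.1 != xy.2]]].

(* C^{0,alpha}(D) norm; finite iff u is in C^{0,alpha}(D) *)
Definition holder_norm D (alpha : R) u : \bar R :=
  (sup_norm D u + holder_seminorm D alpha u)%E.

Definition modulus D f (t : R) : \bar R :=
  ereal_sup [set `|f xy.1 - f xy.2|%:E
            | xy in [set xy | [/\ D xy.1, D xy.2 & enorm (xy.1 - xy.2) <= t]]].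

(* L^q_loc(R^n) *)
Definition Lq_loc (q : R) v : Prop :=
  measurable_fun [set: lebesgue_rV R n] v /\
  forall A : set 'rV[R]_n, compact A ->
    (\int[leb n]_(z in A) (`|v z| `^ q)%:E < +oo)%E.

(* L^{p-1}_{sp}(R^n) *)
Definition Lsp (s p : R) v : Prop :=
  Lq_loc (p - 1) v /\
  (\int[leb n]_z (`|v z| `^ (p - 1) / (1 + enorm z) `^ (n%:R + s * p))%:E
     < +oo)%E.

Definition tail (s p : R) v (x : 'rV[R]_n) (r : R) : \bar R :=
  (((r `^ (s * p))%:E *
    \int[leb n]_(z in [set z | r <= enorm (z - x)]%R)
      (`|v z| `^ (p - 1) / enorm (z - x) `^ (n%:R + s * p))%:E)
   `^ (p - 1)^-1)%E.

Definition usc_on D u : Prop :=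
  forall x, D x -> forall a, u x < a -> \forall y \near within D (nbhs x), u y < a.

Definition grad u (x : 'rV[R]_n) : 'rV[R]_n := \row_i 'D_('e_i) u x.

Definition hess u (x : 'rV[R]_n) : 'M[R]_n :=
  \matrix_(i, j) 'D_('e_j) ('D_('e_i) u) x.

(* For open D. *)
Definition C2 D u : Prop :=
  forall x, D x ->
  [/\ {for x, continuous u},
      forall i, derivable u x 'e_i /\ {for x, continuous ('D_('e_i) u)} &
      forall i j, derivable ('D_('e_i) u) x 'e_j /\
        {for x, continuous ('D_('e_j) ('D_('e_i) u))}].

Definition crit D u : set 'rV[R]_n := [set x | D x /\ grad u x = 0].

(* The real infimum of the empty set is 0, so this is meaningful only when
   crit D u is nonempty, as in visc_subsol. *)
Definition crit_dist D u (x : 'rV[R]_n) : R :=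
  inf [set enorm (x - y) | y in crit D u].

Definition C2_beta (beta : R) D u : Prop :=
  C2 D u /\
  exists M : R, forall x, D x -> ~ crit D u x ->
    Num.min (crit_dist D u x) 1 `^ (beta - 1) / enorm (grad u x) +
    enorm (hess u x) / crit_dist D u x `^ (beta - 2) <= M.

End function_spaces.

Section operator.
Context {R : realType}.
Variable n : nat.
Implicit Types (K u g : 'rV[R]_n -> R) (D : set 'rV[R]_n).

Definition kernel_bounds (p s lam Lam : R) K : Prop :=
  [/\ forall z, z != 0 -> {for z, continuous K},
      forall z, z != 0 -> 0 < K z,
      forall z, z != 0 -> K (- z) = K z &
      forall z, z != 0 -> lam / enorm z `^ (n%:R + p * s) <= K z
                          /\ K z <= Lam / enorm z `^ (n%:R + p * s)].

(* k(z) = K(z) |z|^{n+ps} for z <> 0, extended continuously to 0 *)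
Definition normalized_kernel (p s : R) K k : Prop :=
  (forall z, z != 0 -> k z = K z * enorm z `^ (n%:R + p * s)) /\
  {for (0 : 'rV[R]_n), continuous k}.

Definition truncated_op (p : R) K u (x : 'rV[R]_n) (eps : R) : \bar R :=
  \int[leb n]_(y in ~` eball x eps)
    (`|u x - u y| `^ (p - 2) * (u x - u y) * K (x - y))%:E.

(* The principal value L u(x) exists in [-oo, +oo] and equals l. *)
Definition op_at (p : R) K u (x : 'rV[R]_n) (l : \bar R) : Prop :=
  truncated_op p K u x eps @[eps --> 0^'+] --> l.

(* patch u B eta is eta on B and u elsewhere; near x0^' is a punctured
   neighbourhood of x0. *)
Definition visc_subsol (p s : R) K g (Omega : set 'rV[R]_n) u : Prop :=
  [/\ usc_on (closure Omega) u,
      forall (eta : 'rV[R]_n -> R) (x0 : 'rV[R]_n) (r : R), 0 < r ->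
        eball x0 r `<=` Omega ->
        C2 (eball x0 r) eta ->
        eta x0 = u x0 ->
        (forall x, eball x0 r x -> u x <= eta x) ->
        (2 / (2 - s) < p \/ grad eta x0 != 0) \/
        [/\ p <= 2 / (2 - s), grad eta x0 = 0,
            \forall x \near x0^', grad eta x != 0 &
            exists2 beta, s * p / (p - 1) < beta &
                          C2_beta beta (eball x0 r) eta] ->
        exists2 l, op_at p K (patch u (eball x0 r) eta) x0 l &
                   (l <= (g x0)%:E)%E
    & Lsp s p (fun x => Num.max (u x) 0)].

Definition visc_supersol (p s : R) K g (Omega : set 'rV[R]_n) u : Prop :=
  visc_subsol p s K (fun x => - g x) Omega (fun x => - u x).

Definition visc_sol (p s : R) K g (Omega : set 'rV[R]_n) u : Prop :=
  visc_subsol p s K g Omega u /\ visc_supersol p s K g Omega u.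

End operator.

Definition log_modulus {R : realType} n (p s : R) (f : 'rV[R]_n -> R) : \bar R :=
  ereal_sup [set (modulus (eball 0 2) f t *
                  (`|ln t| `^ (n%:R + 1 + 2 * p * (1 - s)))%:E)%E
            | t in [set t | 0 < t <= 1]].

(* Main.v *)
Require Import Defs.
From mathcomp Require Import all_boot all_order all_algebra.
From mathcomp Require Import all_classical all_reals all_analysis.
From mathcomp Require Import measurable_realfun ring lra.
Set Implicit Arguments.
Unset Strict Implicit.
Unset Printing Implicit Defensive.
Import Order.TTheory GRing.Theory Num.Theory.
Import numFieldNormedType.Exports.
Local Open Scope classical_set_scope.
Local Open Scope ring_scope.

(** Write q = p - 1, so that s p = q and K(z) is comparable to |z|^(-n-q), and
    J(t) = |t|^(q-1) t, so that the operator is the integral of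
    J(u(x) - u(x+z)) K(z) dz. The proof is the doubling of variables of Ishii and
    Lions. By homogeneity u may be divided by the bracket on the right-hand side;
    then |u| <= 1 on B_2, the weighted integral of |u|^q is at most a constant,
    and the right-hand side of the equation is bounded.

    Suppose that u(x0) - u(y0) > L phi(|x0 - y0|) for phi(t) = t G(log(1/t)) with
    G growing slowly and phi concave near 0. Then
      u(x) - u(y) - L phi(|x - y|) - m |x - x0|^2
    has a positive maximum at some (x,y) with a = x - y small and nonzero. At x
    the function u is touched from above, and at y from below, by explicit
    paraboloids, because the norm lies below its tangent paraboloids. Since
    p > 2/(2-s) when s p = p - 1, paraboloids are admissible test functions even at
    critical points, so the viscosity conditions turn into inequalities for
    truncated integrals ([visc_subsol_parab]). Subtracting them bounds
      int_{|z| >= r} (J(A) - J(B)) K,  A(z) = u(x) - u(x+z),  B(z) = u(y) - u(y+z)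
    from above by f(x) - f(y) plus an error that is a power of |a|
    ([near_lower_bound], with r = |a|^2). From below ([contact_inequality]), with
    l = log(1/|a|), P = L phi'(|a|) and kap = min(1,q):
    - comparing the maximum with (x+z,y) and with (x,y+z) separately, strict
      concavity of phi gives a gain of order P^q l^(-n-2) on a small cube around
      a/4;
    - comparing it with (x+z,y+z) gives B - mu |z| <= A on the rest of a ball of
      radius 2 rho, where the loss is at most P^(q-kap) mu^kap log(1/r);
    - the rest of the integral is bounded, and if k is Hoelder continuous and u
      already has a modulus of continuity, it is a power of |a|.

    With G(l) = l^N, P is at least l^N, and for N kap > n + 3 the gain beats every
    error even though rho and mu are fixed. This is the log-Lipschitz estimate
    ([log_lipschitz_norm]), which contains the second claim. With G(l) = 1 - 1/l
    one uses that estimate twice: it makes |x - x0|, hence mu, a power of |a| when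
    rho is one, and it makes the far part a power of |a|. The only remaining
    error is f(x) - f(y), and since 2p(1-s) = 2 the hypothesis on f says that it is
    at most l^(-n-3), which the gain beats ([lipschitz_norm]). The bound on |f|
    that is needed to start comes from touching u by a fixed paraboloid
    ([rhs_bound]). *)

(** * Invariance of Lebesgue measure *)

Section tuple_invariance.
Context {R : realType}.
Local Notation RB := (measurableTypeR R).

Definition coordwise n (f : nat -> RB -> RB) (t : n.-tuple RB) : n.-tuple RB :=
  [tuple f i (tnth t i) | i < n].

Lemma measurable_coordwise n (f : nat -> RB -> RB) :
  (forall i, measurable_fun setT (f i)) ->
  measurable_fun setT (coordwise (n := n) f).
Proof.
move=> mf; apply/measurable_fun_tnthP => i.
rewrite (_ : _ \o _ = f i \o (fun t => tnth t i)); last first.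
  by apply/funext => t /=; rewrite tnth_mktuple.
by apply: measurableT_comp => //; exact: measurable_tnth.
Qed.

Lemma coordwise_cons n f (x : RB) (t : n.-tuple RB) :
  coordwise f (cons_rt (x, t)) = cons_rt (f 0%N x, coordwise (f \o S) t).
Proof.
apply: eq_from_tnth => i; rewrite tnth_mktuple.
case: (unliftP ord0 i) => [j ->|->] /=; last by rewrite !tnth0.
by rewrite !tnthS tnth_mktuple.
Qed.

Lemma lebesgue_tupleS n (A : set (n.+1.-tuple RB)) :
  lebesgue_tuple n.+1 A = (lebesgue_measure \x lebesgue_tuple n)%E
    (@cons_rt R n @^-1` A).
Proof. by []. Qed.

Lemma measurable_cons_rt_pre n (A : set (n.+1.-tuple RB)) :
  measurable A -> measurable (@cons_rt R n @^-1` A).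
Proof. by move=> mA; rewrite -[X in measurable X]setTI; apply: measurable_cons_rt. Qed.

(** Product measures are determined by their values on rectangles, so
    invariance passes from the factors to the n-fold product by induction. *)
Lemma lebesgue_tuple_coordwise n (f : nat -> RB -> RB) :
  (forall i, measurable_fun setT (f i)) ->
  (forall i A, measurable A -> lebesgue_measure (f i @^-1` A) = lebesgue_measure A) ->
  forall A, measurable A ->
    lebesgue_tuple n (coordwise f @^-1` A) = lebesgue_tuple n A.
Proof.
elim: n f => [|n IH] f mf lf A mA.
  congr (lebesgue_tuple 0 _); apply/seteqP; split=> t /=; rewrite (tuple0 t) (tuple0 (coordwise _ _))//.
rewrite !lebesgue_tupleS.
pose g (xt : RB * n.-tuple RB) : RB * n.-tuple RB :=
  (f 0%N xt.1, coordwise (f \o S) xt.2).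
have mg : measurable_fun setT g.
  apply/measurable_fun_pairP; split.
    by apply: (measurableT_comp (mf 0%N)); exact: measurable_fst.
  have mc : measurable_fun setT (coordwise (n := n) (f \o S)).
    by apply: measurable_coordwise => i; exact: mf.
  by apply: (measurableT_comp mc); exact: measurable_snd.
pose m1 : {measure set (RB * n.-tuple RB) -> \bar R} :=
  [the measure _ _ of pushforward (lebesgue_measure \x lebesgue_tuple n)%E g].
pose m' := m1 mg.
rewrite (_ : _ @^-1` (_ @^-1` A) = g @^-1` (@cons_rt R n @^-1` A)); last first.
  by apply/seteqP; split => -[x t] /=; rewrite coordwise_cons.
apply/esym.
change ((lebesgue_measure \x lebesgue_tuple n)%E (@cons_rt R n @^-1` A) =
  m' (@cons_rt R n @^-1` A)).
have mcA := measurable_cons_rt_pre mA.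
move: (@cons_rt R n @^-1` A) mcA => X mX.
refine (@product_measure_unique _ _ _ _ R lebesgue_measure (lebesgue_tuple n) m' _ X mX).
move=> B C mB mC.
rewrite /m' /m1 /= /pushforward (_ : _ @^-1` _ = (f 0%N @^-1` B) `*` (coordwise (f \o S) @^-1` C))//.
rewrite product_measure1E.
- congr (_ * _)%E; first exact: lf.
  by apply: IH => // i; [exact: mf|move=> D; exact: lf].
- by rewrite -[X in measurable X]setTI; apply: mf.
- rewrite -[X in measurable X]setTI; apply: measurable_coordwise => // i; exact: mf.
Qed.

Definition box n (B : nat -> set RB) : set (n.-tuple RB) :=
  [set t | forall i : 'I_n, B i (tnth t i)].

Lemma box_cons n B : @cons_rt R n @^-1` (@box n.+1 B) = B 0%N `*` @box n (B \o S).
Proof.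
apply/seteqP; split => -[x t] /=.
  move=> h; split; first by have := h ord0; rewrite tnth0.
  by move=> i; have := h (lift ord0 i); rewrite tnthS.
by move=> [hx ht] i; case: (unliftP ord0 i) => [j ->|->]; rewrite ?tnth0 ?tnthS//; exact: ht.
Qed.

Lemma measurable_box n B : (forall i, measurable (B i)) -> measurable (@box n B).
Proof.
move=> mB; rewrite (_ : box B = \bigcap_(i in [set: 'I_n]) ((fun t => tnth t i) @^-1` B i)).
  apply: fin_bigcap_measurable => [|i _]; first exact: finite_finset.
  rewrite -[X in measurable X]setTI; exact: measurable_tnth.
by apply/seteqP; split => t /= h i => [_|]; exact: h.
Qed.

Lemma lebesgue_tuple_box n (B : nat -> set RB) (v : R) :
  (forall i, measurable (B i)) -> (forall i, lebesgue_measure (B i) = v%:E) ->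
  lebesgue_tuple n (box B) = (v ^+ n)%:E.
Proof.
elim: n B => [|n IH] B mB lB.
  rewrite expr0 (_ : box B = setT) /= ?diracT//.
  by apply/seteqP; split=> // t _ [].
rewrite lebesgue_tupleS box_cons product_measure1E//; last first.
  by apply: measurable_box => i; exact: mB.
rewrite exprS EFinM; congr (_ * _)%E; first exact: lB.
by apply: IH => i; [exact: mB|exact: lB].
Qed.

End tuple_invariance.

Section rV_invariance.
Context {R : realType}.
Local Notation RB := (measurableTypeR R).

Lemma lebesgue_measure_translation (c : R) (A : set RB) : measurable A ->
  lebesgue_measure ((fun x : RB => x + c : RB) @^-1` A) = lebesgue_measure A.
Proof.
move=> mA.
have mf : measurable_fun [set: RB] (fun x : RB => x + c : RB).
  by apply: measurable_funD.
pose m1 := [the measure _ _ of pushforward (@lebesgue_measure R) (fun x : RB => x + c : RB)].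
pose m' := m1 mf.
apply/esym; change (lebesgue_measure A = m' A).
refine (@lebesgue_measure_unique R m' _ A mA) => X [[a b] _ <-].
rewrite /m' /m1 /= /pushforward.
rewrite (_ : _ @^-1` _ = [set` `]a - c, b - c]%R]); last first.
  by apply/seteqP; split => x /=; rewrite !in_itv /= => /andP[h1 h2]; apply/andP; split; lra.
rewrite !lebesgue_measure_itv /= !lte_fin ltrD2r -!EFinD.
by case: ifP => // _; congr EFin; ring.
Qed.

Lemma lebesgue_measure_isometry (s c : R) (A : set RB) : s ^+ 2 = 1 -> measurable A ->
  lebesgue_measure ((fun x : RB => s * x + c : RB) @^-1` A) = lebesgue_measure A.
Proof.
move=> /eqP; rewrite sqrf_eq1 => /orP[/eqP ->|/eqP ->] mA.
  rewrite -[RHS](lebesgue_measure_translation c)//.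
  by under [in LHS]eq_fun do rewrite mul1r.
rewrite -[RHS](lebesgue_measure_translation c)// -[RHS]lebesgue_measureN; last first.
  rewrite -[X in measurable X]setTI; exact: (measurable_funD (f:=fun x=>x) (g:=fun=> c)).
rewrite /pushforward; congr lebesgue_measure.
by apply/seteqP; split => x /=; rewrite mulN1r.
Qed.

Variable n : nat.

(** Only s = 1 and s = -1 matter: one map covers translations and point
    reflections. *)
Definition affine (s : R) (c v : 'rV[R]_n) : 'rV[R]_n := s *: v + c.

Let fi (s : R) (c : 'rV[R]_n) (i : nat) (x : RB) : RB :=
  s * x + (if insub i is Some j then c ord0 j else 0).

Let mfi s c i : measurable_fun setT (fi s c i).
Proof. by apply: measurable_funD => //; exact: measurable_funM. Qed.

Lemma affine_tuple s c t : affine s c (rV_of_tuple t) = rV_of_tuple (coordwise (fi s c) t).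
Proof.
apply/rowP => i; rewrite !mxE tnth_mktuple /fi.
by case: insubP => [j _ ji|]; [rewrite (ord_inj ji)|rewrite ltn_ord].
Qed.

Lemma measurable_borelE (A : set (borel_rV n)) :
  measurable A <-> measurable (@rV_of_tuple R n @^-1` A).
Proof.
split=> mA.
  by rewrite -[X in measurable X]setTI; exact: measurable_rV_of_tuple.
exists (@rV_of_tuple R n @^-1` A) => //; rewrite setTI.
apply/seteqP; split => v /=; rewrite (_ : rV_of_tuple (tuple_of_rV v) = v)//;
  by apply/rowP => i; rewrite mxE tnth_mktuple.
Qed.

Lemma affine_pre s c (A : set (borel_rV n)) :
  @rV_of_tuple R n @^-1` (affine s c @^-1` A) =
  coordwise (fi s c) @^-1` (@rV_of_tuple R n @^-1` A).
Proof. by apply/seteqP; split => t /=; rewrite affine_tuple. Qed.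

Lemma measurable_affine_borel s c (A : set (borel_rV n)) : measurable A ->
  measurable (affine s c @^-1` A : set (borel_rV n)).
Proof.
rewrite !measurable_borelE affine_pre => mA.
by rewrite -[X in measurable X]setTI; apply: measurable_coordwise.
Qed.

Lemma lebesgue_borel_affine s c (A : set (borel_rV n)) : s ^+ 2 = 1 ->
  measurable A -> lebesgue_borel (affine s c @^-1` A) = lebesgue_borel A.
Proof.
move=> s1 /measurable_borelE mA.
rewrite /lebesgue_borel /pushforward affine_pre lebesgue_tuple_coordwise//.
move=> i B mB; exact: lebesgue_measure_isometry.
Qed.

Lemma affineK s c : s ^+ 2 = 1 -> cancel (affine s c) (affine s (- s *: c)).
Proof.
move=> s1 v; rewrite /affine scalerDr scalerA -expr2 s1 scale1r scaleNr; exact: addrK.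
Qed.

Lemma affineVK s c : s ^+ 2 = 1 -> cancel (affine s (- s *: c)) (affine s c).
Proof.
move=> s1 v; rewrite /affine scalerDr !scalerA -expr2 s1 scale1r.
by rewrite mulrN -expr2 s1 scaleN1r addrNK.
Qed.

Lemma leb_affine_le s c (A : set 'rV[R]_n) : s ^+ 2 = 1 ->
  (leb n (affine s c @^-1` A) <= leb n A)%E.
Proof.
move=> s1; apply: le_ereal_inf_tmp => _ [F [mF AF] <-].
apply: ereal_inf_lbound; exists (fun k => affine s c @^-1` F k).
  split=> [k|v Av]; first exact: measurable_affine_borel.
  by have [k _ Fk] := AF _ Av; exists k.
by apply: eq_eseriesr => k _; apply: lebesgue_borel_affine.
Qed.

(** The outer measure is an infimum over Borel covers, and the map carries
    covers to covers of the same size; the inverse map gives the other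
    inequality. *)
Lemma leb_affine s c (A : set 'rV[R]_n) : s ^+ 2 = 1 ->
  leb n (affine s c @^-1` A) = leb n A.
Proof.
move=> s1; apply/eqP; rewrite eq_le leb_affine_le //=.
have -> : A = affine s (- s *: c) @^-1` (affine s c @^-1` A).
  by apply/seteqP; split => v /=; rewrite affineVK.
rewrite (_ : affine s c @^-1` _ = affine s c @^-1` A) ?leb_affine_le//.
by apply/seteqP; split => v /=; rewrite affineVK.
Qed.

Lemma measurable_lebE (A : set (lebesgue_rV R n)) : measurable A <->
  forall X, (leb n X = leb n (X `&` A) + leb n (X `&` ~` A))%E.
Proof. by []. Qed.

(** Caratheodory measurability is a statement about the outer measure alone,
    hence transported by any bijection that preserves it. *)
Lemma measurable_affine s c : s ^+ 2 = 1 ->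
  measurable_fun setT (affine s c : lebesgue_rV R n -> lebesgue_rV R n).
Proof.
move=> s1 _ A /measurable_lebE mA; rewrite setTI; apply/measurable_lebE => X.
pose Y := affine s (- s *: c) @^-1` X.
have e B : leb n (affine s c @^-1` B) = leb n B by exact: leb_affine.
have XY x : Y (affine s c x) = X x by rewrite /Y /preimage /= affineK.
have h1 : affine s c @^-1` Y = X by apply/funext => x; exact: XY.
have h2 : affine s c @^-1` (Y `&` A) = X `&` affine s c @^-1` A.
  by apply/funext => x; rewrite /setI /preimage /mkset XY.
have h3 : affine s c @^-1` (Y `&` ~` A) = X `&` ~` (affine s c @^-1` A).
  by apply/funext => x; rewrite /setI /setC /preimage /mkset XY.
by have := mA Y; rewrite -(e Y) -(e (Y `&` A)) -(e (Y `&` ~` A)) h1 h2 h3.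
Qed.

Lemma measurable_borel_leb (A : set (borel_rV n)) : measurable A ->
  measurable (A : set (lebesgue_rV R n)).
Proof. exact: caratheodory_measurable_mu_ext. Qed.

Lemma leb_borelE (A : set (borel_rV n)) : measurable A ->
  leb n A = @lebesgue_borel R n A.
Proof. exact: measurable_mu_extE. Qed.

Definition cube (c : 'rV[R]_n) (r : R) : set 'rV[R]_n :=
  [set v | forall i, `|v ord0 i - c ord0 i| <= r].

Let cubeE c r : @rV_of_tuple R n @^-1` cube c r =
  box (fun i => `[ (if insub i is Some j then c ord0 j else 0) - r,
                   (if insub i is Some j then c ord0 j else 0) + r ]%classic).
Proof.
have e (i : 'I_n) : (if insub (i : nat) is Some j then c ord0 j else 0) = c ord0 i.
  by case: insubP => [j _ ji|]; [rewrite (ord_inj ji)|rewrite ltn_ord].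
by apply/seteqP; split => t /= h i; have := h i;
  rewrite /= e mxE in_itv /= ler_distl.
Qed.

Lemma measurable_cube_borel c r : measurable (cube c r : set (borel_rV n)).
Proof. by apply/measurable_borelE; rewrite cubeE; exact: measurable_box. Qed.

Lemma measurable_cube c r : measurable (cube c r : set (lebesgue_rV R n)).
Proof. exact/measurable_borel_leb/measurable_cube_borel. Qed.

Lemma leb_cube c r : 0 <= r -> leb n (cube c r) = ((2 * r) ^+ n)%:E.
Proof.
move=> r0; rewrite leb_borelE; last exact: measurable_cube_borel.
rewrite /lebesgue_borel /pushforward cubeE (@lebesgue_tuple_box _ _ _ (2 * r))// => i.
rewrite lebesgue_measure_itv /= lte_fin.
case: ltP => h; first by rewrite -EFinD; congr EFin; ring.
by congr EFin; lra.
Qed.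

Lemma measurable_coord_borel i : measurable_fun setT (fun v : borel_rV n => v ord0 i : RB).
Proof.
move=> _ B mB; rewrite setTI; apply/measurable_borelE.
rewrite (_ : _ @^-1` _ = (fun t => tnth t i) @^-1` B).
  by rewrite -[X in measurable X]setTI; exact: measurable_tnth.
by apply/seteqP; split => t /=; rewrite mxE.
Qed.

End rV_invariance.

(** * Euclidean geometry of row vectors *)

Section euclid.
Context {R : realType} {n : nat}.
Implicit Types (u v w : 'rV[R]_n) (a b : R).

Definition dot u v : R := \sum_i u ord0 i * v ord0 i.

Lemma dotC u v : dot u v = dot v u.
Proof. by apply: eq_bigr => i _; rewrite mulrC. Qed.

Lemma dotDl u v w : dot (u + v) w = dot u w + dot v w.
Proof. by rewrite /dot -big_split; apply: eq_bigr => i _; rewrite mxE mulrDl. Qed.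

Lemma dotDr u v w : dot u (v + w) = dot u v + dot u w.
Proof. by rewrite dotC dotDl !(dotC u). Qed.

Lemma dotZl a u v : dot (a *: u) v = a * dot u v.
Proof. by rewrite /dot mulr_sumr; apply: eq_bigr => i _; rewrite mxE mulrA. Qed.

Lemma dotZr a u v : dot u (a *: v) = a * dot u v.
Proof. by rewrite dotC dotZl dotC. Qed.

Lemma dotNl u v : dot (- u) v = - dot u v.
Proof. by rewrite -scaleN1r dotZl mulN1r. Qed.

Lemma dotNr u v : dot u (- v) = - dot u v.
Proof. by rewrite dotC dotNl dotC. Qed.

Lemma dot_ge0 u : 0 <= dot u u.
Proof. by apply: sumr_ge0 => i _; rewrite -expr2 sqr_ge0. Qed.

Lemma enormE u : enorm u = Num.sqrt (dot u u).
Proof. by rewrite /enorm big_ord1; congr Num.sqrt; apply: eq_bigr => i _; rewrite expr2. Qed.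

Lemma enorm_ge0 u : 0 <= enorm u. Proof. exact: sqrtr_ge0. Qed.

Lemma enorm_sqr u : enorm u ^+ 2 = dot u u.
Proof. by rewrite enormE sqr_sqrtr// dot_ge0. Qed.

Lemma dot_eq0 u : (dot u u == 0) = (u == 0).
Proof.
apply/eqP/eqP => [|->]; last by apply: big1 => i _; rewrite mxE mul0r.
move=> h; apply/rowP => i; rewrite mxE; apply/eqP; rewrite -sqrf_eq0 expr2; apply/eqP.
apply: (psumr_eq0P (P := xpredT) (F := fun i => u ord0 i * u ord0 i)) => // j _.
by rewrite -expr2 sqr_ge0.
Qed.

Lemma enorm_eq0 u : (enorm u == 0) = (u == 0).
Proof. by rewrite -dot_eq0 -enorm_sqr sqrf_eq0. Qed.

Lemma enorm0 : enorm (0 : 'rV[R]_n) = 0.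
Proof. by apply/eqP; rewrite enorm_eq0. Qed.

Lemma enorm_gt0 u : (0 < enorm u) = (u != 0).
Proof. by rewrite lt_neqAle enorm_ge0 andbT eq_sym enorm_eq0. Qed.

Lemma enormZ a u : enorm (a *: u) = `|a| * enorm u.
Proof.
by rewrite !enormE dotZl dotZr mulrA -expr2 sqrtrM ?sqr_ge0// sqrtr_sqr.
Qed.

Lemma enormN u : enorm (- u) = enorm u.
Proof. by rewrite -scaleN1r enormZ normrN1 mul1r. Qed.

Lemma enormBC u v : enorm (u - v) = enorm (v - u).
Proof. by rewrite -enormN opprB. Qed.

Lemma dot_sqr_le u v : dot u v ^+ 2 <= dot u u * dot v v.
Proof.
have [->|v0] := eqVneq v 0.
  by rewrite -(scale0r 0) !dotZr !mul0r expr0n mulr0.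
have vv : 0 < dot v v by rewrite lt_neqAle eq_sym dot_eq0 v0 dot_ge0.
rewrite -subr_ge0 -(pmulr_rge0 _ vv).
have := dot_ge0 (dot v v *: u + (- dot u v) *: v).
rewrite !(dotDl, dotDr, dotZl, dotZr) (dotC v u).
by congr (_ <= _); ring.
Qed.

Lemma dot_le u v : `|dot u v| <= enorm u * enorm v.
Proof.
by rewrite !enormE -sqrtrM ?dot_ge0// -sqrtr_sqr ler_wsqrtr// dot_sqr_le.
Qed.

Lemma enormD_sqr u v : enorm (u + v) ^+ 2 = enorm u ^+ 2 + 2 * dot u v + enorm v ^+ 2.
Proof. rewrite !enorm_sqr !(dotDl, dotDr) (dotC v u); ring. Qed.

Lemma enormD u v : enorm (u + v) <= enorm u + enorm v.
Proof.
rewrite -(@ler_pXn2r _ 2)// ?nnegrE ?addr_ge0 ?enorm_ge0//.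
rewrite enormD_sqr sqrrD.
have := le_trans (ler_norm _) (dot_le u v); lra.
Qed.

Lemma enormB_le u v : enorm u - enorm v <= enorm (u - v).
Proof. by have := enormD (u - v) v; rewrite subrK; lra. Qed.

Lemma enorm_dist u v : `|enorm u - enorm v| <= enorm (u - v).
Proof.
by rewrite ler_norml enormB_le andbT; have := enormB_le v u; rewrite enormBC; lra.
Qed.

(** The Euclidean norm lies below its tangent paraboloid at a nonzero
    vector: expand (|u+v| - |u|)^2 >= 0. This is what makes paraboloids
    touch u at the doubled maximum. *)
Lemma enormD_parab u v : u != 0 ->
  enorm (u + v) <= enorm u + dot u v / enorm u + enorm v ^+ 2 / (2 * enorm u).
Proof.
rewrite -enorm_gt0; set e := enorm u => e0.
have h : enorm (u + v) ^+ 2 = e ^+ 2 + 2 * dot u v + enorm v ^+ 2 by rewrite enormD_sqr.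
have := sqr_ge0 (enorm (u + v) - e); rewrite sqrrB h => k.
have -> : e + dot u v / e + enorm v ^+ 2 / (2 * e) =
  (2 * e ^+ 2 + 2 * dot u v + enorm v ^+ 2) / (2 * e) by field; rewrite gt_eqF.
by rewrite ler_pdivlMr ?mulr_gt0//; lra.
Qed.

Lemma coord_le u i : `|u ord0 i| <= enorm u.
Proof.
rewrite enormE -sqrtr_sqr ler_wsqrtr// /dot (bigD1 i)//= -expr2 lerDl.
by apply: sumr_ge0 => j _; rewrite -expr2 sqr_ge0.
Qed.

Lemma enorm_le_sum u : enorm u <= \sum_i `|u ord0 i|.
Proof.
rewrite -(@ler_pXn2r _ 2)// ?nnegrE ?enorm_ge0 ?sumr_ge0// enorm_sqr expr2 mulr_suml.
apply: ler_sum => i _.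
rewrite -expr2 -real_normK ?num_real// expr2 ler_wpM2l// (bigD1 i)//= lerDl.
by apply: sumr_ge0.
Qed.

Lemma enorm_le_cube u e : (forall i, `|u ord0 i| <= e) -> enorm u <= n%:R * e.
Proof.
move=> h; apply: (le_trans (enorm_le_sum u)).
apply: (@le_trans _ _ (\sum_(i < n) e)); first by apply: ler_sum => i _; exact: h.
by rewrite sumr_const card_ord mulr_natl.
Qed.

End euclid.

(** * Measurability on row vectors *)

Section rV_measurable.
Context {R : realType} {n : nat}.
Local Notation RB := (measurableTypeR R).

(** An open set is the union of the countably many rational cubes that it
    contains. *)
Lemma open_measurable_rV (U : set 'rV[R]_n) : open U -> measurable (U : set (borel_rV n)).
Proof.
move=> oU.
pose rad (k : nat) : R := k.+1%:R^-1.
pose ctr (q : 'rV[rat]_n) : 'rV[R]_n := map_mx ratr q.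
pose F (qk : 'rV[rat]_n * nat) : set (borel_rV n) :=
  if `[< cube (ctr qk.1) (rad qk.2) `<=` U >] then cube (ctr qk.1) (rad qk.2) else set0.
rewrite (_ : U = \bigcup_i F i).
  apply: countable_bigcupT_measurable => [|i]; first exact: countableP.
  by rewrite /F; case: ifP => _; [exact: measurable_cube_borel|exact: measurable0].
apply/seteqP; split=> [v Uv|v [i _]]; last by rewrite /F; case: asboolP => // h; exact: h.
have /nbhs_ballP[e /= e0 eU] : nbhs v U by move: oU; rewrite openE; exact.
have e20 : 0 < e / 2 by rewrite divr_gt0.
have [k] : exists k : nat, rad k < e / 2.
  have [N _ /(_ N (leqnn N)) /= h] := near_infty_natSinv_lt (PosNum e20).
  by exists N.
move=> ke.
have k0 : 0 < rad k by rewrite invr_gt0.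
have hq i : exists q : rat, `|v ord0 i - ratr q| <= rad k.
  have : v ord0 i < v ord0 i + rad k by rewrite ltrDl.
  move=> /rat_in_itvoo[q]; rewrite in_itv /= => /andP[h1 h2].
  by exists q; rewrite ler_distl; apply/andP; split; lra.
have [q hq'] := choice hq.
exists (\row_i q i, k) => //; rewrite /F.
case: asboolP => [_ i /=|]; first by rewrite !mxE.
case=> w hw; apply: eU; split=> // i j; rewrite (ord1 i) /ball /=.
have := hw j; have := hq' j; rewrite /ctr !mxE /= !ler_distl ltr_distl => /andP[? ?] /andP[? ?].
by apply/andP; split; lra.
Qed.

Lemma open_measurable_leb (U : set 'rV[R]_n) : open U -> measurable (U : set (lebesgue_rV R n)).
Proof. by move=> /open_measurable_rV; exact: measurable_borel_leb. Qed.

Lemma continuous_on_measurable (D : set 'rV[R]_n) (f : 'rV[R]_n -> R) : open D ->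
  (forall x, D x -> {for x, continuous f}) ->
  measurable_fun (D : set (lebesgue_rV R n)) (f : lebesgue_rV R n -> RB).
Proof.
move=> oD cf; apply: (measurability _ (RGenOpens.measurableE R)) => _ [_ [a [b ->] <-]].
apply: open_measurable_leb; rewrite openE => x [Dx fx] /=.
apply: filterI; first by move: oD; rewrite openE; exact.
apply: cf => //; apply: open_nbhs_nbhs; split => //; exact: interval_open.
Qed.

Local Notation L := (lebesgue_rV R n).

Lemma enorm_near (x : 'rV[R]_n) (e : R) : 0 < e -> \forall y \near x, enorm (y - x) < e.
Proof.
move=> e0; have e1 : 0 < e / (n%:R + 1) by rewrite divr_gt0// ltr_pwDr.
apply/nbhs_ballP; exists (e / (n%:R + 1)) => //= y [_ h].
apply: (@le_lt_trans _ _ (n%:R * (e / (n%:R + 1)))).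
  apply: enorm_le_cube => i; have := h ord0 i.
  by rewrite /ball /= !mxE distrC => /ltW.
rewrite mulrA ltr_pdivrMr ?ltr_pwDr// mulrC ltr_pM2l// ltrDl//.
Qed.

(** The topology comes from the max norm; Euclidean balls give the same
    neighbourhoods. *)
Lemma nbhs_eball (x : 'rV[R]_n) (A : set 'rV[R]_n) :
  nbhs x A <-> exists2 e, 0 < e & eball x e `<=` A.
Proof.
split=> [/nbhs_ballP[e /= e0 h]|[e e0 h]].
  exists e => // y xy; apply: h; split=> // i j; rewrite (ord1 i) /ball /= distrC.
  apply: le_lt_trans xy; apply: le_trans (coord_le (y - x) j); by rewrite !mxE.
by have hx := enorm_near x e0; apply: (filterS _ hx) => y; exact: h.
Qed.

Lemma enorm_continuous : continuous (@enorm R 1 n).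
Proof.
move=> x A /nbhs_ballP[e /= e0 h]; apply/nbhs_eball; exists e => // y xy.
by apply: h; rewrite /ball /= distrC; exact: le_lt_trans (enorm_dist y x) xy.
Qed.

Lemma open_eball (x : 'rV[R]_n) r : open (eball x r).
Proof.
rewrite openE => y yr; apply/nbhs_eball; exists (r - enorm (y - x)); first by rewrite subr_gt0.
move=> z; rewrite /eball /= => h; have := enormD (z - y) (y - x).
by rewrite addrA subrK; lra.
Qed.

Lemma continuous_measurable_rV (f : 'rV[R]_n -> R) : continuous f ->
  measurable_fun [set: L] (f : L -> RB).
Proof. by move=> cf; apply: continuous_on_measurable; [exact: openT|move=> x _; exact: cf]. Qed.

Lemma measurable_enorm : measurable_fun [set: L] (@enorm R 1 n : L -> RB).
Proof. exact/continuous_measurable_rV/enorm_continuous. Qed.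

Lemma measurable_coord i : measurable_fun [set: L] (fun v : L => v ord0 i : RB).
Proof.
move=> mT B mB; rewrite setTI.
have := @measurable_coord_borel R n i measurableT B mB; rewrite setTI.
exact: measurable_borel_leb.
Qed.

Lemma measurable_dot (b : 'rV[R]_n) : measurable_fun [set: L] (dot b : L -> RB).
Proof.
pose h (i : 'I_n) (v : L) : R := b ord0 i * v ord0 i.
have mh i : measurable_fun [set: L] (h i).
  have mc : measurable_fun [set: L] (cst (b ord0 i) : L -> R) := @measurable_cst _ _ L _ _ _.
  exact: (@measurable_funM _ L R setT _ _ mc (measurable_coord i)).
exact: (@measurable_sum _ L R setT _ (index_enum 'I_n) h mh).
Qed.

Lemma measurable_affine_comp s c (f : L -> RB) : s ^+ 2 = 1 ->
  measurable_fun [set: L] f ->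
  measurable_fun [set: L] (fun x : L => f (affine s c x)).
Proof.
move=> s1 mf.
exact: (@measurableT_comp _ _ _ L L RB f setT (affine s c) mf (@measurable_affine R n s c s1)).
Qed.

End rV_measurable.

(** * Real-valued integration *)

Section integral_layer.
Context d {T : measurableType d} {R : realType} (mu : {measure set T -> \bar R}).
Implicit Types (f g : T -> R).

(** Real-valued integration over the whole space: pairs of an integrability
    statement and an inequality between real numbers avoid extended reals
    later. The lemma prefixes msb, intg and Ig refer to measurability,
    integrability and the integral. *)
Definition integrableR f : Prop := mu.-integrable setT (EFin \o f).
Definition integralR f : R := Rintegral mu setT f.
Definition measurableR f : Prop := measurable_fun setT f.

Lemma msbD f g : measurableR f -> measurableR g -> measurableR (fun z => f z + g z).
Proof. exact: measurable_funD. Qed.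

Lemma msbB f g : measurableR f -> measurableR g -> measurableR (fun z => f z - g z).
Proof. exact: measurable_funB. Qed.

Lemma msbM f g : measurableR f -> measurableR g -> measurableR (fun z => f z * g z).
Proof. exact: measurable_funM. Qed.

Lemma msb_cst c : measurableR (fun=> c).
Proof. exact: measurable_cst. Qed.

Lemma msb_comp (h : R -> R) f : measurable_fun setT h -> measurableR f -> measurableR (fun z => h (f z)).
Proof. by move=> mh mf; exact: measurableT_comp. Qed.

Lemma msb_norm f : measurableR f -> measurableR (fun z => `|f z|).
Proof. by move=> mf; apply: (@msb_comp (fun x => `|x|)) => //; exact: normr_measurable. Qed.

Lemma msb_powR f e : measurableR f -> measurableR (fun z => f z `^ e).
Proof. by move=> mf; apply: (@msb_comp (fun x => x `^ e)) => //; exact: measurable_powR. Qed.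

Lemma msb_bool (b : T -> bool) : measurable_fun setT b -> measurableR (fun x => (b x)%:R).
Proof.
move=> mb.
have ms : measurable [set x : T | b x].
  by have := mb measurableT [set true] Logic.I; rewrite setTI.
rewrite /measurableR (_ : (fun x => _) = \1_[set x : T | b x]); first exact: measurable_indic.
apply/funext => x; rewrite indicE; case bx : (b x); first by rewrite mem_set.
by rewrite memNset//= bx.
Qed.

Lemma msb_le f g : measurableR f -> measurableR g -> measurableR (fun x => (f x <= g x)%R%:R).
Proof. by move=> mf mg; apply: msb_bool; exact: measurable_fun_ler. Qed.

Lemma msb_lt f g : measurableR f -> measurableR g -> measurableR (fun x => (f x < g x)%R%:R).
Proof. by move=> mf mg; apply: msb_bool; exact: measurable_fun_ltr. Qed.

Lemma intg_msb f : integrableR f -> measurableR f.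
Proof. by move=> /integrableP[/measurable_EFinP]. Qed.

Lemma intgE f : integrableR f -> (\int[mu]_(x in setT) (f x)%:E = (integralR f)%:E)%E.
Proof. by move=> h; rewrite /integralR /Rintegral fineK//; exact: integrable_fin_num. Qed.

Lemma intgD f g : integrableR f -> integrableR g -> integrableR (fun z => f z + g z).
Proof. by move=> hf hg; have := integrableD measurableT hf hg. Qed.

Lemma intgB f g : integrableR f -> integrableR g -> integrableR (fun z => f z - g z).
Proof. by move=> hf hg; have := integrableB measurableT hf hg. Qed.

Lemma intgZ c f : integrableR f -> integrableR (fun z => c * f z).
Proof. by move=> hf; have := integrableZl measurableT c hf. Qed.

Lemma intg_le f g : measurableR f -> (forall z, `|f z| <= g z) -> integrableR g -> integrableR f.
Proof.
move=> mf fg ig; apply: le_integrable ig => //; first exact/measurable_EFinP.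
by move=> z _ /=; rewrite lee_fin (le_trans (fg z))// ler_norm.
Qed.

Lemma intg_norm f : integrableR f -> integrableR (fun z => `|f z|).
Proof. by move=> h; have := integrable_norm h. Qed.

Lemma IgD f g : integrableR f -> integrableR g -> integralR (fun z => f z + g z) = integralR f + integralR g.
Proof. by move=> hf hg; exact: RintegralD. Qed.

Lemma IgB f g : integrableR f -> integrableR g -> integralR (fun z => f z - g z) = integralR f - integralR g.
Proof. by move=> hf hg; exact: RintegralB. Qed.

Lemma IgZ c f : integrableR f -> integralR (fun z => c * f z) = c * integralR f.
Proof. by move=> hf; exact: RintegralZl. Qed.

Lemma Ig_le f g : integrableR f -> integrableR g -> (forall z, f z <= g z) -> integralR f <= integralR g.
Proof. by move=> hf hg fg; apply: le_Rintegral. Qed.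

Lemma Ig_ge0 f : (forall z, 0 <= f z) -> 0 <= integralR f.
Proof. by move=> f0; apply: Rintegral_ge0. Qed.

Lemma Ig_norm f : integrableR f -> `|integralR f| <= integralR (fun z => `|f z|).
Proof. by move=> hf; exact: le_normr_Rintegral. Qed.

Lemma intg_ge0 f c : measurableR f -> (forall z, 0 <= f z) ->
  (\int[mu]_(x in setT) (f x)%:E <= c%:E)%E -> integrableR f /\ integralR f <= c.
Proof.
move=> mf f0 fc; suff hi : integrableR f by split=> //; rewrite -lee_fin -intgE.
apply/integrableP; split; first exact/measurable_EFinP.
apply: (@le_lt_trans _ _ c%:E); last exact: ltry.
by under eq_integral do rewrite /= ger0_norm//.
Qed.

Lemma intg_indic A c : measurable A -> mu A = c%:E ->
  integrableR (fun z => \1_A z) /\ integralR (fun z => \1_A z) = c.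
Proof.
move=> mA muA.
have e : (\int[mu]_(x in setT) ((\1_A x : R)%:E) = c%:E)%E.
  by rewrite integral_indic// setIT.
have [] := @intg_ge0 (fun z => \1_A z) c.
- exact: measurable_indic.
- by move=> z; rewrite indicE.
- by rewrite e.
by move=> h _; split => //; rewrite /integralR /Rintegral e.
Qed.

(** Domains of integration are written as boolean factors in the integrand. *)
Lemma integral_indicator_bool (b : T -> bool) f :
  (\int[mu]_(y in [set y | b y]) (f y)%:E =
   \int[mu]_(y in setT) ((b y)%:R * f y)%:E)%E.
Proof.
rewrite integral_mkcond; apply: eq_integral => y _; rewrite patchE.
case by_ : (b y); first by rewrite mem_set// mul1r.
by rewrite memNset ?mul0r//= by_.
Qed.

Lemma Ig_preserving (phi : T -> T) f : measurable_fun setT phi ->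
  (forall A, measurable A -> mu (phi @^-1` A) = mu A) -> integrableR f ->
  integrableR (fun z => f (phi z)) /\ integralR (fun z => f (phi z)) = integralR f.
Proof.
move=> mphi pres hf; have mf := intg_msb hf.
have mfE : measurable_fun setT (EFin \o f) by exact/measurable_EFinP.
have E (m : measure T R) h : (forall A, measurable A -> mu A = m A) ->
    (\int[mu]_(x in setT) h x = \int[m]_(x in setT) h x)%E.
  by move=> e; apply: eq_measure_integral => A mA _; exact: e.
have hi : integrableR (fun z => f (phi z)).
  apply/integrableP; split.
    by apply/measurable_EFinP; exact: (measurableT_comp mf mphi).
  have /integrableP[_] := hf; rewrite (E (pushforward mu phi)); last first.
    by move=> A mA; rewrite -[RHS]/(mu (phi @^-1` A)) pres.
  rewrite ge0_integral_pushforward//.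
  by apply: measurableT_comp => //; exact/measurable_EFinP.
split=> //; rewrite /integralR /Rintegral; congr fine.
rewrite [RHS](E (pushforward mu phi)); last first.
  by move=> A mA; rewrite -[RHS]/(mu (phi @^-1` A)) pres.
by rewrite [RHS](integral_pushforward mphi mfE).
Qed.

(** Monotone convergence along an increasing exhaustion. *)
Lemma intg_exhaust f c (b : nat -> T -> bool) : measurableR f -> (forall z, 0 <= f z) ->
  (forall z i j, (i <= j)%N -> b i z -> b j z) -> (forall z, exists i, b i z) ->
  (forall k, integrableR (fun z => (b k z)%:R * f z) /\ integralR (fun z => (b k z)%:R * f z) <= c) ->
  integrableR f /\ integralR f <= c.
Proof.
move=> mf f0 ndb exb h; apply: intg_ge0 => //.
pose g k z := ((b k z)%:R * f z)%:E.
have g0 k z : (0 <= g k z)%E by rewrite lee_fin mulr_ge0.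
have mg k : measurable_fun setT (g k).
  by apply/measurable_EFinP; exact: intg_msb (h k).1.
have ndg z : {homo g ^~ z : m k / (m <= k)%N >-> (m <= k)%E}.
  move=> m k mk; rewrite lee_fin ler_wpM2r// ler_nat.
  by case bm : (b m z) => //; rewrite (ndb _ _ _ mk bm).
have cg z : g ^~ z @ \oo --> (f z)%:E.
  apply: cvg_near_cst; have [N bN] := exb z.
  by exists N => // k /= Nk; rewrite /g (ndb _ _ _ Nk bN) mul1r.
rewrite (_ : \int[mu]_(x in setT) (f x)%:E =
  limn (fun k => \int[mu]_(x in setT) g k x))%E; last first.
  rewrite -monotone_convergence//; apply: eq_integral => z _.
  by apply/esym/cvg_lim => //; exact: cg.
apply: lime_le.
  apply: ereal_nondecreasing_is_cvgn => m k mk; apply: ge0_le_integral => //.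
  by move=> z _; exact: ndg.
apply: nearW => k; have := (h k).2; rewrite -lee_fin -(intgE (h k).1); exact: id.
Qed.

End integral_layer.

(** * Powers and the odd power function *)

Section power.
Context {R : realType}.
Implicit Types (a b c x y t q r : R).

(** The Hoelder exponent of J q on bounded sets. *)
Definition kap q : R := Num.min 1 q.

Lemma kap_gt0 q : 0 < q -> 0 < kap q.
Proof. by move=> q0; rewrite /kap lt_min ltr01. Qed.

Lemma kap_le q : kap q <= q. Proof. by rewrite /kap ge_min lexx orbT. Qed.
Lemma kap_le1 q : kap q <= 1. Proof. by rewrite /kap ge_min lexx. Qed.

Lemma powR_mono x y r : 0 <= r -> 0 <= x -> x <= y -> x `^ r <= y `^ r.
Proof.
by move=> r0 x0 xy; apply: ge0_ler_powR => //; rewrite nnegrE// (le_trans x0).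
Qed.

Lemma powRD_pos x r s : 0 < x -> x `^ (r + s) = x `^ r * x `^ s.
Proof. by move=> x0; rewrite powRD// (gt_eqF x0) implybT. Qed.

Lemma powR_div x y r : 0 <= x -> 0 < y -> (x / y) `^ r = x `^ r / y `^ r.
Proof.
move=> x0 y0; rewrite powRM// ?invr_ge0 ?ltW//; congr (_ * _).
by rewrite -(powR_inv1 (ltW y0)) -powRrM mulN1r powRN.
Qed.

(** The inequality e^x >= 1 + x at two points, after writing x as an
    exponential. *)
Lemma bernoulli_le1 x r : 0 <= x -> 0 <= r -> r <= 1 -> x `^ r <= 1 + r * (x - 1).
Proof.
move=> x0 r0 r1; have [->|xN0] := eqVneq x 0.
  have [->|rN0] := eqVneq r 0; first by rewrite powRr0; lra.
  by rewrite powR0//; lra.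
have xp : 0 < x by rewrite lt_neqAle eq_sym xN0.
have -> : x `^ r = expR (r * ln x) by rewrite /powR (negbTE xN0).
set v := ln x; have -> : x = expR v by rewrite /v lnK// posrE.
have h1 : expR (r * v) * (1 + (1 - r) * v) <= expR v.
  have -> : expR v = expR (r * v) * expR ((1 - r) * v) by rewrite -expRD; congr expR; ring.
  by rewrite ler_wpM2l ?expR_ge0// expR_ge1Dx.
have h2 : expR (r * v) * (1 - r * v) <= 1.
  have e : expR (r * v) * expR (- (r * v)) = 1 by rewrite -expRD subrr expR0.
  by rewrite -[X in _ <= X]e ler_wpM2l ?expR_ge0// expR_ge1Dx.
nra.
Qed.

Lemma bernoulli_ge1 x r : 0 <= x -> 1 <= r -> 1 + r * (x - 1) <= x `^ r.
Proof.
move=> x0 r1; have r0 : 0 < r by lra.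
have := @bernoulli_le1 (x `^ r) r^-1 (powR_ge0 _ _).
rewrite invr_ge0 (ltW r0) invf_le1// r1 => /(_ isT isT).
rewrite -powRrM divff ?gt_eqF// powRr1// => h.
have : r * x <= r * (1 + r^-1 * (x `^ r - 1)) by rewrite ler_pM2l.
rewrite mulrDr mulr1 mulrA divff ?gt_eqF// mul1r; lra.
Qed.

(** Bernoulli for q <= 1, monotonicity in the exponent for q >= 1. *)
Lemma powR_le_kap q t : 0 < q -> 0 <= t -> t <= 1 -> t `^ q <= 1 - kap q * (1 - t).
Proof.
move=> q0 t0 t1; rewrite /kap; case: (lerP 1 q) => q1.
  rewrite mul1r opprB addrC subrK.
  have [->|tN0] := eqVneq t 0; first by rewrite powR0// gt_eqF.
  have tp : 0 < t by rewrite lt_neqAle eq_sym tN0.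
  by rewrite -[leRHS](powRr1 t0) ger_powR// tp.
by have := bernoulli_le1 t0 (ltW q0) (ltW q1); lra.
Qed.

Lemma powR_gain q x y : 0 < q -> 0 <= x -> x <= y -> 0 < y ->
  kap q * y `^ q * (1 - x / y) <= y `^ q - x `^ q.
Proof.
move=> q0 x0 xy y0.
have t0 : 0 <= x / y by rewrite divr_ge0// ltW.
have t1 : x / y <= 1 by rewrite ler_pdivrMr// mul1r.
have := powR_le_kap q0 t0 t1; rewrite powR_div// ler_pdivrMr ?powR_gt0//.
lra.
Qed.

(** For q >= 1 this is the mean value inequality, for q <= 1 subadditivity
    of the power; the factor 1 + q covers both. *)
Lemma powR_sub_le q a b : 0 < q -> 0 <= b -> b <= a ->
  a `^ q - b `^ q <= (1 + q) * (a `^ (q - kap q) * (a - b) `^ kap q).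
Proof.
move=> q0 b0 ba.
have a0 : 0 <= a by lra.
have [->|aN0] := eqVneq a 0.
  rewrite (powR0 (lt0r_neq0 q0)); apply: (@le_trans _ _ 0).
    by rewrite sub0r oppr_le0 powR_ge0.
  by rewrite !mulr_ge0 ?powR_ge0//; lra.
have ap : 0 < a by rewrite lt_neqAle eq_sym aN0.
have t0 : 0 <= b / a by rewrite divr_ge0.
have t1 : b / a <= 1 by rewrite ler_pdivrMr// mul1r.
have aq : 0 < a `^ q by rewrite powR_gt0.
have eb : b `^ q = a `^ q * (b / a) `^ q by rewrite powR_div// mulrCA divff ?mulr1// gt_eqF.
rewrite /kap; case: (lerP 1 q) => q1.
  have := bernoulli_ge1 t0 q1 => h.
  have ea : a `^ q = a `^ (q - 1) * a by rewrite mulrC mulr_powRB1.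
  rewrite powRr1 ?subr_ge0//.
  have : a `^ q * (1 + q * (b / a - 1)) <= b `^ q by rewrite eb ler_wpM2l// ltW.
  have -> : a `^ q * (1 + q * (b / a - 1)) = a `^ q - q * (a `^ (q - 1) * (a - b)).
    by rewrite ea; field; rewrite gt_eqF.
  have : 0 <= a `^ (q - 1) * (a - b) by rewrite mulr_ge0 ?powR_ge0// subr_ge0.
  nra.
rewrite subrr powRr0 mul1r.
have h1 : b / a <= (b / a) `^ q.
  have [->|bN0] := eqVneq (b / a) 0; first exact: powR_ge0.
  have tp : 0 < b / a by rewrite lt_neqAle eq_sym bN0.
  by rewrite -[leLHS](powRr1 t0); apply: ger_powR; [rewrite tp|exact: ltW].
have h2 : 1 - b / a <= (1 - b / a) `^ q.
  have [->|bN0] := eqVneq (1 - b / a) 0; first exact: powR_ge0.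
  have tp : 0 < 1 - b / a by rewrite lt_neqAle eq_sym bN0 subr_ge0.
  rewrite -[leLHS](@powRr1 _ (1 - b / a)) ?(ltW tp)//; apply: ger_powR; last exact: ltW.
  by rewrite tp /=; lra.
have ed : (a - b) `^ q = a `^ q * (1 - b / a) `^ q.
  by rewrite -powRM ?subr_ge0//; congr (_ `^ _); field; rewrite gt_eqF.
have : a `^ q * 1 <= a `^ q * ((b / a) `^ q + (1 - b / a) `^ q) by rewrite ler_pM2l//; lra.
rewrite mulrDr -eb -ed mulr1.
have := powR_ge0 (a - b) q; nra.
Qed.

(** The nonlinearity of the operator, with q = p - 1. *)
Definition J q t : R := `|t| `^ (q - 1) * t.

Lemma J_pos q t : 0 < q -> 0 <= t -> J q t = t `^ q.
Proof. by move=> q0 t0; rewrite /J ger0_norm// mulrC mulr_powRB1. Qed.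

Lemma J_opp q t : J q (- t) = - J q t.
Proof. by rewrite /J normrN mulrN. Qed.

Lemma J_neg q t : 0 < q -> t <= 0 -> J q t = - (- t) `^ q.
Proof. by move=> q0 t0; rewrite -[in LHS](opprK t) J_opp J_pos// oppr_ge0. Qed.

Lemma J_abs q t : 0 < q -> `|J q t| = `|t| `^ q.
Proof. by move=> q0; rewrite /J normrM (ger0_norm (powR_ge0 _ _)) mulrC mulr_powRB1. Qed.

Lemma J_hom q c t : 0 < q -> 0 <= c -> J q (c * t) = c `^ q * J q t.
Proof.
move=> q0 c0; rewrite /J normrM (ger0_norm c0) powRM//.
by rewrite -(mulr_powRB1 c0 q0); ring.
Qed.

Lemma J_le q a b : 0 < q -> a <= b -> J q a <= J q b.
Proof.
move=> q0 ab; have [a0|a0] := lerP 0 a.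
  by rewrite !J_pos ?(le_trans a0 ab)//; apply: powR_mono => //; exact: ltW.
have [b0|b0] := lerP 0 b.
  rewrite J_neg ?(ltW a0)// J_pos//.
  by rewrite (@le_trans _ _ 0)// ?oppr_le0 powR_ge0.
rewrite (J_neg q0 (ltW a0)) (J_neg q0 (ltW b0)) lerN2; apply: powR_mono; [exact: ltW| |]; lra.
Qed.

Lemma J_sub_le q a b : 0 < q -> b <= a ->
  J q a - J q b <= (2 + q) * ((`|a| + `|b|) `^ (q - kap q) * (a - b) `^ kap q).
Proof.
move=> q0 ba.
have k0 := kap_gt0 q0.
have k1 := kap_le q.
have main x y : 0 <= y -> y <= x ->
  x `^ q - y `^ q <= (2 + q) * ((x + y) `^ (q - kap q) * (x - y) `^ kap q).
  move=> y0 yx; apply: (le_trans (powR_sub_le q0 y0 yx)).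
  apply: ler_pM; rewrite ?mulr_ge0 ?powR_ge0//; try lra.
  by apply: ler_wpM2r; rewrite ?powR_ge0// powR_mono//; lra.
have [b0|b0] := lerP 0 b.
  by have a0 := le_trans b0 ba; rewrite !J_pos// !ger0_norm//; exact: main.
have [a0|a0] := lerP a 0.
  rewrite !J_neg ?(ltW b0)// !ler0_norm ?(ltW b0)//.
  have := @main (- b) (- a); rewrite oppr_ge0 lerN2 => /(_ a0 ba).
  by rewrite (addrC (- b)) !opprK (addrC (- b)) (addrC ((- b) `^ q)).
rewrite J_pos ?(ltW a0)// J_neg ?(ltW b0)// (gtr0_norm a0) (ltr0_norm b0) opprK.
have -> : (a - b) `^ (q - kap q) * (a - b) `^ kap q = (a - b) `^ q.
  by rewrite -powRD_pos ?subrK//; lra.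
have : a `^ q <= (a - b) `^ q by rewrite powR_mono ?ltW//; lra.
have : (- b) `^ q <= (a - b) `^ q by rewrite powR_mono ?ltW//; lra.
have := powR_ge0 (a - b) q; nra.
Qed.

Lemma J_holder q a b : 0 < q ->
  `|J q a - J q b| <= (2 + q) * ((`|a| + `|b|) `^ (q - kap q) * `|a - b| `^ kap q).
Proof.
move=> q0; have [ab|ba] := lerP a b.
  have -> : `|J q a - J q b| = J q b - J q a by rewrite ler0_norm ?opprB// subr_le0 J_le.
  by rewrite (addrC `|a|); exact: J_sub_le.
have -> : `|J q a - J q b| = J q a - J q b.
  by rewrite ger0_norm// subr_ge0 J_le// ltW.
by apply: J_sub_le => //; exact: ltW.
Qed.

(** Only one-sided bounds on A and B are available at a doubled maximum;
    monotonicity of J makes them sufficient. *)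
Lemma J_err q A B S e : 0 < q -> 0 <= S -> 0 <= e -> B - e <= A -> - S <= A -> B <= S ->
  - ((2 + q) * ((2 * S) `^ (q - kap q) * e `^ kap q)) <= J q A - J q B.
Proof.
move=> q0 S0 e0 h1 h2 h3; have [AB|AB] := lerP B A.
  rewrite (@le_trans _ _ 0)// ?subr_ge0 ?J_le// oppr_le0 !mulr_ge0 ?powR_ge0//; lra.
rewrite lerNl opprB; apply: (le_trans (J_sub_le q0 (ltW AB))).
have k1 := kap_le q; have k0 := kap_gt0 q0.
rewrite ler_pM2l; last lra.
have : `|B| <= S by rewrite ler_norml; lra.
have : `|A| <= S by rewrite ler_norml; lra.
move=> ? ?; have := normr_ge0 A; have := normr_ge0 B => ? ?.
by apply: ler_pM; rewrite ?powR_ge0//; apply: powR_mono; lra.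
Qed.

(** Used on the gain cube, where y - x is only a small part of y. *)
Lemma J_gain q A B x y : 0 < q -> 0 <= x -> x <= y -> 0 < y -> - A <= x -> y <= - B ->
  kap q * y `^ q * (1 - x / y) <= J q A - J q B.
Proof.
move=> q0 x0 xy y0 Ax yB; apply: (le_trans (powR_gain q0 x0 xy y0)).
have : J q (- x) <= J q A by apply: J_le => //; lra.
have : J q B <= J q (- y) by apply: J_le => //; lra.
rewrite !J_opp (J_pos q0 x0) (J_pos q0 (ltW y0)); lra.
Qed.

End power.

(** * Integrals of radial powers *)

Section radial.
Context {R : realType} {n : nat}.
Local Notation L := (lebesgue_rV R n).
Local Notation msb := (@measurableR _ L R).
Local Notation intg := (@integrableR _ L R (leb n)).
Local Notation Ig := (@integralR _ L R (leb n)).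
Implicit Types (f g : 'rV[R]_n -> R) (z c : 'rV[R]_n).

Lemma Ig_affine s c f : s ^+ 2 = 1 -> intg f ->
  intg (fun z => f (affine s c z)) /\ Ig (fun z => f (affine s c z)) = Ig f.
Proof.
move=> s1; apply: Ig_preserving; first exact: measurable_affine.
by move=> A _; exact: leb_affine.
Qed.

Lemma Ig_cube c r : 0 <= r ->
  intg (fun z => \1_(cube c r) z) /\ Ig (fun z => \1_(cube c r) z) = (2 * r) ^+ n.
Proof. by move=> r0; apply: intg_indic; [exact: measurable_cube|exact: leb_cube]. Qed.

Lemma msb_enorm : msb (@enorm R 1 n). Proof. exact: measurable_enorm. Qed.

Lemma msb_enormB c : msb (fun z => enorm (z - c)).
Proof.
have := @measurable_affine_comp R n 1 (- c) _ (expr1n _ 2) msb_enorm.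
by rewrite /affine; under eq_fun do rewrite scale1r.
Qed.

Definition ann (r s : R) z : R := (r <= enorm z)%R%:R * (enorm z < s)%R%:R.

Lemma ann_ge0 r s z : 0 <= ann r s z. Proof. by rewrite mulr_ge0. Qed.

Lemma ann_in r s z : r <= enorm z -> enorm z < s -> ann r s z = 1.
Proof. by rewrite /ann => -> ->; rewrite mulr1. Qed.

Lemma ann_lt r s z : enorm z < r -> ann r s z = 0.
Proof. by rewrite /ann ltNge => /negbTE ->; rewrite mul0r. Qed.

Lemma ann_ge r s z : s <= enorm z -> ann r s z = 0.
Proof. by rewrite /ann leNgt => /negbTE ->; rewrite mulr0. Qed.

Lemma msb_ann r s : msb (ann r s).
Proof.
apply: msbM; first exact: (msb_le (msb_cst _) msb_enorm).
exact: (msb_lt msb_enorm (msb_cst _)).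
Qed.

Definition rad (e : R) z : R := enorm z `^ e.

Lemma rad_ge0 e z : 0 <= rad e z. Proof. exact: powR_ge0. Qed.

Lemma msb_rad e : msb (rad e). Proof. exact: (msb_powR e msb_enorm). Qed.

Lemma ann_case r s z : [\/ enorm z < r, s <= enorm z | r <= enorm z /\ enorm z < s].
Proof.
case: (ltP (enorm z) r) => h1; first by constructor 1.
by case: (leP s (enorm z)) => h2; [constructor 2|constructor 3].
Qed.

Lemma powR_anti (e x y : R) : e <= 0 -> 0 < x -> x <= y -> y `^ e <= x `^ e.
Proof.
move=> e0 x0 xy; have y0 := lt_le_trans x0 xy.
have -> : e = - (- e) by rewrite opprK.
have : 0 <= - e by rewrite oppr_ge0.
move: (- e) => e' e'0; rewrite (powRN x) (powRN y) lef_pV2 ?posrE ?powR_gt0//.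
by apply: powR_mono => //; exact: ltW.
Qed.

(** On a dyadic shell compare with a cube, so that neither polar coordinates
    nor the volume of balls are needed. *)
Lemma shell_le (r e : R) : 0 < r -> e <= 0 ->
  intg (fun z => ann r (2 * r) z * rad e z) /\
  Ig (fun z => ann r (2 * r) z * rad e z) <= 4 ^+ n * r `^ (n%:R + e).
Proof.
move=> r0 e0; have r20 : 0 <= 2 * r by lra.
have [i1 i2] := Ig_cube 0 r20.
have i3 := intgZ (r `^ e) i1.
have le z : ann r (2 * r) z * rad e z <= r `^ e * \1_(cube 0 (2 * r)) z.
  case: (ann_case r (2 * r) z) => [h|h|[h1 h2]].
  - by rewrite ann_lt// mul0r mulr_ge0 ?powR_ge0// indicE.
  - by rewrite ann_ge// mul0r mulr_ge0 ?powR_ge0// indicE.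
  rewrite ann_in// mul1r indicE mem_set; last first.
    by move=> i; rewrite mxE subr0 (le_trans (coord_le z i))// ltW.
  by rewrite mulr1 powR_anti.
have i4 : intg (fun z => ann r (2 * r) z * rad e z).
  apply: intg_le i3; first by apply: msbM; [exact: msb_ann|exact: msb_rad].
  by move=> z; rewrite ger0_norm ?mulr_ge0 ?ann_ge0 ?rad_ge0.
split=> //; apply: (le_trans (Ig_le i4 i3 le)); rewrite IgZ// i2.
rewrite powRD_pos// (powR_mulrn _ (ltW r0)).
have -> : 2 * (2 * r) = 4 * r by ring.
by rewrite exprMn mulrC mulrA.
Qed.

Lemma annS (r e : R) k : 0 < r ->
  (fun z => ann r (2 ^+ k.+1 * r) z * rad e z) =
  (fun z => ann r (2 * r) z * rad e z + ann (2 * r) (2 ^+ k * (2 * r)) z * rad e z).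
Proof.
move=> r0; apply/funext => z; rewrite -mulrDl; congr (_ * _).
have h : 2 ^+ k.+1 * r = 2 ^+ k * (2 * r) by rewrite exprSr mulrA.
have h1 : 1 <= (2 ^+ k : R) by rewrite exprn_ege1// ler1n.
have h2 : 2 * r <= 2 ^+ k * (2 * r) by rewrite ler_peMl//; lra.
rewrite h; case: (ann_case r (2 * r) z) => [hz|hz|[hz hz']].
- by rewrite !ann_lt ?addr0//; lra.
- rewrite (ann_ge _ hz) add0r.
  case: (leP (2 ^+ k * (2 * r)) (enorm z)) => hh; first by rewrite !ann_ge.
  by rewrite !ann_in//; lra.
- by rewrite (ann_lt _ hz') addr0 !ann_in//; lra.
Qed.

(** The sum of the geometric series of shell bounds, up to sign when t < 0. *)
Definition dyadic_cst (t : R) : R := 4 ^+ n / (2 `^ t - 1).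

Lemma powR2_neq1 (t : R) : t != 0 -> 2 `^ t - 1 != 0 :> R.
Proof. by move=> t0; rewrite subr_eq0 powR_eq1 !negb_or t0 andbT pnatr_eq1 /= -leNgt ler0n. Qed.

(** The shell bounds form a geometric series, which telescopes when the
    total degree t is nonzero. *)
Lemma ann_rad_le k (r t : R) : 0 < r -> t != 0 -> t <= n%:R ->
  intg (fun z => ann r (2 ^+ k * r) z * rad (t - n%:R) z) /\
  Ig (fun z => ann r (2 ^+ k * r) z * rad (t - n%:R) z)
    <= dyadic_cst t * ((2 ^+ k * r) `^ t - r `^ t).
Proof.
move=> r0 t0 tn; have e0 : t - n%:R <= 0 by lra.
elim: k r r0 => [|k IH] r r0.
  have -> : (fun z => ann r (2 ^+ 0 * r) z * rad (t - n%:R) z) = fun z => 0 * \1_(cube 0 1) z.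
    apply/funext => z; rewrite expr0 !mul1r mul0r.
    by case: (ltP (enorm z) r) => h; [rewrite ann_lt|rewrite ann_ge]; rewrite ?mul0r.
  have [i1 i2] := Ig_cube 0 (@ler01 R).
  by split; [exact: intgZ|rewrite IgZ// mul0r mul1r subrr mulr0].
have r20 : 0 < 2 * r by lra.
have [i1 i2] := shell_le r0 e0; have [i3 i4] := IH _ r20.
rewrite annS//; split; first exact: intgD.
rewrite IgD//.
have -> : 2 ^+ k.+1 * r = 2 ^+ k * (2 * r) by rewrite exprSr mulrA.
have -> : dyadic_cst t * ((2 ^+ k * (2 * r)) `^ t - r `^ t) =
  4 ^+ n * r `^ (n%:R + (t - n%:R)) + dyadic_cst t * ((2 ^+ k * (2 * r)) `^ t - (2 * r) `^ t).
  rewrite (powRM t _ (ltW r0))// (addrC n%:R) subrK /dyadic_cst; field; exact: powR2_neq1.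
exact: lerD.
Qed.

(** At total degree 0 every shell contributes the same amount. *)
Lemma ann_rad0_le k (r : R) : 0 < r ->
  intg (fun z => ann r (2 ^+ k * r) z * rad (- n%:R) z) /\
  Ig (fun z => ann r (2 ^+ k * r) z * rad (- n%:R) z) <= 4 ^+ n * k%:R.
Proof.
move=> r0; have e0 : - n%:R <= 0 :> R by rewrite oppr_le0.
elim: k r r0 => [|k IH] r r0.
  have -> : (fun z => ann r (2 ^+ 0 * r) z * rad (- n%:R) z) = fun z => 0 * \1_(cube 0 1) z.
    apply/funext => z; rewrite expr0 !mul1r mul0r.
    by case: (ltP (enorm z) r) => h; [rewrite ann_lt|rewrite ann_ge]; rewrite ?mul0r.
  have [i1 i2] := Ig_cube 0 (@ler01 R).
  by split; [exact: intgZ|rewrite IgZ// mul0r mulr0].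
have r20 : 0 < 2 * r by lra.
have [i1 i2] := shell_le r0 e0; have [i3 i4] := IH _ r20.
rewrite annS//; split; first exact: intgD.
rewrite IgD// -(natr1 k) mulrDr mulr1 addrC; apply: lerD => //.
by move: i2; rewrite addrN powRr0 mulr1.
Qed.

Lemma exists_pow2 (x : R) : exists k : nat, x <= 2 ^+ k.
Proof.
exists (Num.truncn x).+1.
have h : x < (Num.truncn x).+1%:R := truncnS_gt x.
by rewrite (le_trans (ltW h))// -natrX ler_nat ltnW// ltn_expl.
Qed.

Lemma ann_mono r r' s s' z : r' <= r -> s <= s' -> ann r s z <= ann r' s' z.
Proof.
move=> rr ss; case: (ann_case r s z) => [h|h|[h1 h2]].
- by rewrite ann_lt// ann_ge0.
- by rewrite ann_ge// ann_ge0.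
- by rewrite (ann_in h1 h2) ann_in//; lra.
Qed.

Lemma intg_ann_mono r r' s s' e C : r' <= r -> s <= s' ->
  intg (fun z => ann r' s' z * rad e z) /\ Ig (fun z => ann r' s' z * rad e z) <= C ->
  intg (fun z => ann r s z * rad e z) /\ Ig (fun z => ann r s z * rad e z) <= C.
Proof.
move=> rr ss [i1 i2].
have le z : ann r s z * rad e z <= ann r' s' z * rad e z.
  by rewrite ler_wpM2r ?rad_ge0// ann_mono.
have i3 : intg (fun z => ann r s z * rad e z).
  apply: intg_le i1; first by apply: msbM; [exact: msb_ann|exact: msb_rad].
  by move=> z; rewrite ger0_norm ?mulr_ge0 ?ann_ge0 ?rad_ge0.
by split=> //; apply: le_trans (Ig_le i3 i1 le) i2.
Qed.

(** The bound does not depend on the inner radius eps. *)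
Lemma rad_near0 (t eps r : R) : 0 < t -> t <= n%:R -> 0 < eps -> 0 < r ->
  intg (fun z => ann eps r z * rad (t - n%:R) z) /\
  Ig (fun z => ann eps r z * rad (t - n%:R) z) <= dyadic_cst t * r `^ t.
Proof.
move=> t0 tn e0 r0.
have [k hk] := exists_pow2 (r / eps).
have k0 : 0 < (2 ^+ k : R) by rewrite exprn_gt0.
pose r' := r / 2 ^+ k.
have r'0 : 0 < r' by rewrite divr_gt0.
have r'e : r' <= eps by rewrite /r' ler_pdivrMr// mulrC -ler_pdivrMr.
have [] := @ann_rad_le k r' t r'0 (lt0r_neq0 t0) tn.
have -> : 2 ^+ k * r' = r by rewrite /r' mulrC divfK// gt_eqF.
move=> i1 i2; apply: (intg_ann_mono r'e (lexx r)); split => //.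
apply: (le_trans i2); rewrite ler_wpM2l//; last by rewrite gerBl powR_ge0.
rewrite divr_ge0 ?exprn_ge0// subr_ge0 -[leLHS](powRr0 (2:R)).
by apply: ler_powR; [lra|exact: ltW].
Qed.

Lemma rad_log (r s : R) : 0 < r -> r <= s ->
  intg (fun z => ann r s z * rad (- n%:R) z) /\
  Ig (fun z => ann r s z * rad (- n%:R) z) <= 4 ^+ n * (1 + 2 * ln (s / r)).
Proof.
move=> r0 rs; have s0 := lt_le_trans r0 rs.
have sr1 : 1 <= s / r by rewrite ler_pdivlMr// mul1r.
have exk : exists k : nat, s / r <= 2 ^+ k by exact: exists_pow2.
have [k hk mink] : exists2 k : nat, s / r <= 2 ^+ k & k%:R <= 1 + 2 * ln (s / r).
  case: (ex_minnP exk) => k hk mk; exists k => //.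
  have ln0 : 0 <= ln (s / r) by exact: ln_ge0.
  case: k hk mk => [|k] hk mk; first by rewrite addr_ge0// mulr_ge0.
  have : 2 ^+ k < s / r by rewrite ltNge; apply/negP => /mk; rewrite ltnn.
  move=> h; have h2 : ln (2 ^+ k : R) <= ln (s / r).
    by rewrite ler_ln ?posrE ?exprn_gt0// ?divr_gt0// ltW.
  have l2 : 1 <= 2 * ln (2 : R).
    have := @expR_ge1Dx R (- ln 2).
    rewrite expRN lnK ?posrE//; lra.
  move: h2; rewrite lnXn// -(mulr_natr (ln 2) k) => h2.
  rewrite -(natr1 k); have : 0 <= k%:R * (2 * ln 2 - 1) :> R by rewrite mulr_ge0 ?subr_ge0.
  nra.
have := @ann_rad0_le k r r0; move=> [i1 i2].
have s2 : s <= 2 ^+ k * r by rewrite -ler_pdivrMr.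
apply: (intg_ann_mono (lexx r) s2); split=> //.
by apply: (le_trans i2); rewrite ler_wpM2l// exprn_ge0.
Qed.

Lemma rad_far (t r : R) : t < 0 -> 0 < r ->
  intg (fun z => (r <= enorm z)%R%:R * rad (t - n%:R) z) /\
  Ig (fun z => (r <= enorm z)%R%:R * rad (t - n%:R) z) <= - dyadic_cst t * r `^ t.
Proof.
move=> t0 r0.
have tn : t <= n%:R by rewrite (le_trans (ltW t0)).
apply: (@intg_exhaust _ L R (leb n) _ _ (fun k z => enorm z < 2 ^+ k * r)).
- apply: msbM; last exact: msb_rad.
  exact: (msb_le (msb_cst _) msb_enorm).
- by move=> z; rewrite mulr_ge0 ?rad_ge0.
- move=> z i j ij h; apply: (lt_le_trans h); rewrite ler_pM2r// ler_weXn2l// ler1n//.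
- move=> z; have [k hk] := exists_pow2 (enorm z / r).
  exists k.+1; rewrite -ltr_pdivrMr//; apply: (le_lt_trans hk).
  by rewrite exprS ltr_pMl ?exprn_gt0// ltr1n.
move=> k; have [i1 i2] := ann_rad_le k r0 (ltr0_neq0 t0) tn.
have -> : (fun z : L => (enorm z < 2 ^+ k * r)%R%:R * ((r <= enorm z)%R%:R * rad (t - n%:R) z))
   = (fun z => ann r (2 ^+ k * r) z * rad (t - n%:R) z).
  by apply/funext => z; rewrite /ann mulrCA mulrA.
split=> //; apply: (le_trans i2).
have c0 : dyadic_cst t <= 0.
  rewrite /dyadic_cst mulr_ge0_le0 ?exprn_ge0// invr_le0 subr_le0 -[leRHS](powRr0 (2:R)).
  by apply: ler_powR; [lra|exact: ltW].
have := powR_ge0 (2 ^+ k * r) t; nra.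
Qed.

End radial.

(** * Paraboloids as test functions *)

Section quadratic.
Context {R : realType} {n : nat}.
Implicit Types (x v b : 'rV[R]_n) (f g : 'rV[R]_n -> R).

Lemma lip_continuous f x C : (forall y, `|f y - f x| <= C * enorm (y - x)) -> {for x, continuous f}.
Proof.
move=> h A /nbhs_ballP[e /= e0 he]; apply/nbhs_eball.
have C0 : 0 < `|C| + 1 by rewrite ltr_pwDr.
exists (e / (`|C| + 1)); first exact: divr_gt0.
move=> y hy; apply: he; rewrite /ball /= distrC; apply: (le_lt_trans (h y)).
have : enorm (y - x) * (`|C| + 1) < e by rewrite -ltr_pdivlMr.
have := ler_norm C; have := enorm_ge0 (y - x); nra.
Qed.

Lemma cts_add f g x : {for x, continuous f} -> {for x, continuous g} ->
  {for x, continuous (fun y => f y + g y)}.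
Proof. by move=> hf hg; exact: (cvgD hf hg). Qed.

Lemma cts_mul f g x : {for x, continuous f} -> {for x, continuous g} ->
  {for x, continuous (fun y => f y * g y)}.
Proof. by move=> hf hg; exact: (cvgM hf hg). Qed.

Lemma cts_cst (c : R) x : {for x, continuous (fun _ : 'rV[R]_n => c)}.
Proof. exact: (@cst_continuous _ _ c x). Qed.

Lemma dot_continuous b x0 : continuous (fun y : 'rV[R]_n => dot b (y - x0)).
Proof.
move=> x; apply: (@lip_continuous _ _ (enorm b)) => y.
have -> : dot b (y - x0) - dot b (x - x0) = dot b (y - x).
  by rewrite -dotNr -dotDr; congr dot; rewrite opprB addrA subrK.
exact: dot_le.
Qed.

Lemma enormB_continuous x0 : continuous (fun y : 'rV[R]_n => enorm (y - x0)).
Proof.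
move=> x; apply: (@lip_continuous _ _ 1) => y; rewrite mul1r.
by apply: (le_trans (enorm_dist _ _)); rewrite opprB addrA subrK.
Qed.

Lemma derive_poly2 f x v c1 c2 :
  (forall h : R, f (h *: v + x) = f x + h * c1 + h ^+ 2 * c2) ->
  derivable f x v /\ 'D_v f x = c1.
Proof.
move=> h.
have lim : h^-1 *: ((f \o shift x) (h *: v) - f x) @[h --> 0^'] --> c1.
  apply: (@cvg_trans _ ((fun h : R => c1 + h * c2) @ 0^')).
    apply: near_eq_cvg; near=> k.
    have k0 : k != 0 by near: k; exact: nbhs_dnbhs_neq.
    by rewrite /= h /GRing.scale /=; field.
  have : (fun k : R => c1 + k * c2) k @[k --> (0:R)] --> c1 + 0 * c2.
    apply: cvgD; first exact: cvg_cst.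
    by apply: cvgM; [exact: cvg_id|exact: cvg_cst].
  by rewrite mul0r addr0; apply: cvg_trans; apply: cvg_app; exact: nbhs_dnbhs.
split; first by apply/cvg_ex; exists c1.
by rewrite /derive; apply: cvg_lim.
Unshelve. all: by end_near. Qed.

Lemma C2_quadratic D c b x0 M :
  C2 D (fun y : 'rV[R]_n => c + dot b (y - x0) + M * enorm (y - x0) ^+ 2).
Proof.
set f := (X in C2 _ X); move=> x Dx.
have e1 v y : derivable f y v /\ 'D_v f y = dot b v + 2 * M * dot v (y - x0).
  apply: (@derive_poly2 _ _ _ _ (M * enorm v ^+ 2)) => h.
  rewrite /f -(addrA (h *: v)) (dotDr b (h *: v)) dotZr (enormD_sqr (h *: v)) enormZ exprMn real_normK ?num_real// dotZl.
  ring.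
have e1' v : 'D_v f = fun y => dot b v + 2 * M * dot v (y - x0).
  by apply/funext => y; exact: (e1 v y).2.
have e2 v w y : derivable ('D_v f) y w /\ 'D_w ('D_v f) y = 2 * M * dot v w.
  rewrite e1'; apply: (@derive_poly2 _ _ _ _ 0) => h.
  by rewrite -(addrA (h *: w)) (dotDr v (h *: w)) dotZr; ring.
split.
- apply: cts_add; first by apply: cts_add; [exact: cts_cst|exact: dot_continuous].
  apply: cts_mul; first exact: cts_cst.
  by apply: cts_mul; exact: enormB_continuous.
- move=> i; split; first exact: (e1 'e_i x).1.
  rewrite e1'; apply: cts_add; first exact: cts_cst.
  by apply: cts_mul; [exact: cts_cst|exact: dot_continuous].
move=> i j; split; first exact: (e2 'e_i 'e_j x).1.
have -> : 'D_('e_j) ('D_('e_i) f) = fun=> 2 * M * dot 'e_i 'e_j.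
  by apply/funext => y; exact: (e2 _ _ _).2.
exact: cts_cst.
Qed.

End quadratic.

(** * Kernels and tails *)

Section viscosity.
Context {R : realType} {n : nat}.
Local Notation L := (lebesgue_rV R n).
Local Notation msb := (@measurableR _ L R).
Local Notation intg := (@integrableR _ L R (leb n)).
Local Notation Ig := (@integralR _ L R (leb n)).
Implicit Types (p s lam Lam q r e M eps : R) (u f g K : 'rV[R]_n -> R) (x y z b : 'rV[R]_n).

Lemma Ig_shift x f : intg f -> intg (fun z => f (x + z)) /\ Ig (fun z => f (x + z)) = Ig f.
Proof.
have := @Ig_affine R n 1 x f (expr1n _ 2).
by rewrite /affine; under eq_fun do rewrite scale1r addrC.
Qed.

Lemma Ig_refl f : intg f -> intg (fun z => f (- z)) /\ Ig (fun z => f (- z)) = Ig f.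
Proof.
have := @Ig_affine R n (-1) 0 f (sqrr_sign _ 1).
by rewrite /affine; under eq_fun do rewrite scaleN1r addr0.
Qed.

Lemma msb_shift x f : msb f -> msb (fun z => f (x + z)).
Proof.
move=> mf; have := @measurable_affine_comp R n 1 x f (expr1n _ 2) mf.
by rewrite /affine; under eq_fun do rewrite scale1r addrC.
Qed.

Lemma measurable_J q : measurable_fun [set: R] (J q).
Proof.
suff : @measurableR _ (measurableTypeR R) R (fun t : measurableTypeR R => `|t| `^ (q - 1) * t) by [].
by apply: msbM; [apply: msb_powR; apply: msb_norm; exact: measurable_id|exact: measurable_id].
Qed.

Lemma msb_J q f : msb f -> msb (fun z => J q (f z)).
Proof. exact: (msb_comp (measurable_J q)). Qed.

(** The kernel bounds for s p = q; at the origin they force the value 0,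
    since 0 ^ (-q-n) = 0. *)
Definition kern (lam Lam q : R) K : Prop := [/\ msb K, forall z, K (- z) = K z &
  forall z, lam * rad (- q - n%:R) z <= K z /\ K z <= Lam * rad (- q - n%:R) z].

Lemma kern_ge0 lam Lam q K z : 0 <= lam -> kern lam Lam q K -> 0 <= K z.
Proof.
by move=> l0 [_ _ /(_ z)[h _]]; apply: le_trans h; rewrite mulr_ge0 ?rad_ge0.
Qed.

(** The bounds on K say nothing at 0; changing the value there does not
    affect integrals over |z| >= r and makes the bounds hold everywhere. *)
Definition punctured K z : R := (z != 0)%:R * K z.

Lemma kern_punctured p s lam Lam q K : 0 < q -> p * s = q ->
  kernel_bounds p s lam Lam K -> kern lam Lam q (punctured K).
Proof.
move=> q0 ps [cK _ eK bK].
have oD : open [set z : 'rV[R]_n | z != 0].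
  rewrite openE => z /= z0; apply/nbhs_eball; exists (enorm z); first by rewrite enorm_gt0.
  move=> y; rewrite /eball /= => h; apply: contraTneq h => ->.
  by rewrite sub0r enormN ltxx.
have mD : measurable ([set z : 'rV[R]_n | z != 0] : set L) := open_measurable_leb oD.
have mK : measurable_fun ([set z : 'rV[R]_n | z != 0] : set L) (K : L -> R).
  by apply: continuous_on_measurable => // z; exact: cK.
split.
- have := (@measurable_restrictT _ _ L R _ K mD).1 mK.
  rewrite /msb (_ : K \_ _ = punctured K)//; apply/funext => z; rewrite patchE /punctured.
  case: (eqVneq z 0) => [->|z0]; first by rewrite memNset ?mul0r//= eqxx.
  by rewrite mem_set// mul1r.
- move=> z; rewrite /punctured oppr_eq0.
  by case: (eqVneq z 0) => [|z0]; rewrite ?mul0r// eK.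
move=> z; rewrite /punctured /rad; case: (eqVneq z 0) => [->|z0].
  by rewrite mul0r enorm0 powR0 ?mulr0//; apply/ltr0_neq0; have := ler0n R n; lra.
have := bK z z0; rewrite ps mul1r.
have -> : - q - n%:R = - (n%:R + q) by ring.
by rewrite powRN.
Qed.

Definition wgt (q : R) y : R := (1 + enorm y) `^ (- q - n%:R).

Lemma wgt_ge0 q y : 0 <= wgt q y. Proof. exact: powR_ge0. Qed.

Lemma msb_wgt q : msb (wgt q).
Proof. by apply: msb_powR; apply: msbD; [exact: msb_cst|exact: msb_enorm]. Qed.

(** The weight that dominates the tail integrand uniformly in the centre x. *)
Definition wt (q : R) u y : R := (1 + `|u y| `^ q) * wgt q y.

Lemma wt_ge0 q u y : 0 <= wt q u y.
Proof. by rewrite mulr_ge0 ?wgt_ge0// addr_ge0// powR_ge0. Qed.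

Lemma msb_wt q u : msb u -> msb (wt q u).
Proof.
move=> mu; apply: msbM; last exact: msb_wgt.
by apply: msbD; [exact: msb_cst|apply: msb_powR; exact: msb_norm].
Qed.

(** For |x| <= 2 and |z| >= r, 1 + |x + z| is at most a multiple of |z|. *)
Lemma rad_wgt q x z r : 0 < q -> enorm x <= 2 -> 0 < r -> r <= 1 -> r <= enorm z ->
  rad (- q - n%:R) z <= (4 / r) `^ (q + n%:R) * wgt q (x + z).
Proof.
move=> q0 x2 r0 r1 rz; have z0 : 0 < enorm z by lra.
have nn : 0 <= n%:R :> R by [].
have h : 1 + enorm (x + z) <= 4 / r * enorm z.
  have h1 : 1 <= enorm z / r by rewrite ler_pdivlMr// mul1r.
  have h2 : enorm z <= enorm z / r.
    by rewrite ler_pdivlMr// ler_piMr// ltW.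
  have -> : 4 / r * enorm z = 4 * (enorm z / r) by ring.
  have := enormD x z; lra.
have h1 : 0 < 1 + enorm (x + z) by rewrite ltr_pwDl// enorm_ge0.
have e0 : - q - n%:R <= 0 by lra.
have r4 : 0 < 4 / r by rewrite divr_gt0.
have := powR_anti e0 h1 h; rewrite /wgt /rad powRM ?(ltW r4) ?(ltW z0)// => h2.
have : (4 / r) `^ (q + n%:R) * ((4 / r) `^ (- q - n%:R) * enorm z `^ (- q - n%:R)) <=
  (4 / r) `^ (q + n%:R) * (1 + enorm (x + z)) `^ (- q - n%:R).
  by rewrite ler_wpM2l ?powR_ge0.
by rewrite mulrA -powRD_pos// (_ : q + n%:R + (- q - n%:R) = 0) ?powRr0 ?mul1r//; ring.
Qed.

Lemma powR_add_le q (a c : R) : 0 < q -> 0 <= a -> 0 <= c ->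
  (a + c) `^ q <= 2 `^ q * (a `^ q + c `^ q).
Proof.
move=> q0 a0 c0; case: (lerP a c) => ac.
  apply: (@le_trans _ _ ((2 * c) `^ q)); first by apply: powR_mono; lra.
  by rewrite powRM// ler_wpM2l ?powR_ge0// lerDr powR_ge0.
apply: (@le_trans _ _ ((2 * a) `^ q)); first by apply: powR_mono; lra.
by rewrite powRM// ler_wpM2l ?powR_ge0// lerDl powR_ge0.
Qed.

Lemma J_growth q (a c : R) : 0 < q ->
  `|J q (a - c)| <= 2 `^ q * (1 + `|a| `^ q) * (1 + `|c| `^ q).
Proof.
move=> q0; rewrite J_abs//; apply: (@le_trans _ _ ((`|a| + `|c|) `^ q)).
  by apply: powR_mono; rewrite ?ler_normB ?(ltW q0).
apply: (le_trans (powR_add_le q0 (normr_ge0 a) (normr_ge0 c))).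
rewrite -mulrA ler_wpM2l ?powR_ge0//.
have := powR_ge0 `|a| q; have := powR_ge0 `|c| q; nra.
Qed.

Lemma tail_integrand_le lam Lam q K u x z r : 0 <= lam -> 0 <= Lam -> 0 < q ->
  kern lam Lam q K -> enorm x <= 2 -> 0 < r -> r <= 1 ->
  `|(r <= enorm z)%R%:R * (J q (u x - u (x + z)) * K z)| <=
  Lam * (4 / r) `^ (q + n%:R) * 2 `^ q * (1 + `|u x| `^ q) * wt q u (x + z).
Proof.
move=> l0 L0 q0 kK x2 r0 r1; have K0 := kern_ge0 z l0 kK.
have ux0 : 0 <= 1 + `|u x| `^ q by rewrite addr_ge0// powR_ge0.
case: kK => _ _ /(_ z)[_ k2].
case: (leP r (enorm z)) => rz; last first.
  by rewrite mul0r normr0 !mulr_ge0 ?powR_ge0 ?wt_ge0.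
rewrite mul1r normrM (ger0_norm K0).
have h2 : K z <= Lam * ((4 / r) `^ (q + n%:R) * wgt q (x + z)).
  by apply: (le_trans k2); rewrite ler_wpM2l// rad_wgt.
have := ler_pM (normr_ge0 _) K0 (J_growth (u x) (u (x + z)) q0) h2.
move/le_trans; apply; rewrite /wt le_eqVlt; apply/orP; left; apply/eqP; ring.
Qed.

End viscosity.

(** * The contribution of the touching paraboloid *)

Section viscosity_ineq.
Context {R : realType} {n : nat}.
Local Notation L := (lebesgue_rV R n).
Local Notation msb := (@measurableR _ L R).
Local Notation intg := (@integrableR _ L R (leb n)).
Local Notation Ig := (@integralR _ L R (leb n)).
Implicit Types (p s lam Lam q r e M eps : R) (u f g K : 'rV[R]_n -> R) (x y z b : 'rV[R]_n).

Lemma intg_tail_J lam Lam q K u x r : 0 <= lam -> 0 <= Lam -> 0 < q ->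
  kern lam Lam q K -> msb u -> intg (wt q u) -> enorm x <= 2 -> 0 < r -> r <= 1 ->
  intg (fun z => (r <= enorm z)%R%:R * (J q (u x - u (x + z)) * K z)).
Proof.
move=> l0 L0 q0 kK mu iw x2 r0 r1.
have [iw' _] := Ig_shift x iw.
apply: intg_le (intgZ (Lam * (4 / r) `^ (q + n%:R) * 2 `^ q * (1 + `|u x| `^ q)) iw').
  apply: msbM; first exact: (msb_le (msb_cst _) msb_enorm).
  have [mK _ _] := kK; apply: msbM => //; apply: msb_J; apply: msbB; first exact: msb_cst.
  exact: msb_shift.
by move=> z; exact: (tail_integrand_le u z l0 L0 q0 kK x2 r0 r1).
Qed.

Definition near_cst (q Lam : R) : R := (2 + q) * Lam * @dyadic_cst R n (kap q).

(** The linear part integrates to zero by oddness, and the quadratic part is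
    absorbed by the Hoelder continuity of J; the remaining singularity is
    |z|^(kap-n), integrable uniformly in eps. This is the estimate that
    makes the principal value irrelevant. *)
Lemma near_lower_bound lam Lam q K b M eps r : 0 <= lam -> 0 <= Lam -> 0 < q -> (1 <= n)%N ->
  kern lam Lam q K -> 0 <= M -> 0 < eps -> eps <= r ->
  intg (fun z => ann eps r z * (J q (- dot b z - M * enorm z ^+ 2) * K z)) /\
  - (near_cst q Lam * ((2 * enorm b + M * r) `^ (q - kap q) * (M * r) `^ kap q)) <=
  Ig (fun z => ann eps r z * (J q (- dot b z - M * enorm z ^+ 2) * K z)).
Proof.
move=> l0 L0 q0 n1 kK M0 e0 er; have r0 := lt_le_trans e0 er.
have k0 := kap_gt0 q0; have kq := kap_le q; have k1 := kap_le1 q.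
have q2 : 0 <= 2 + q by lra.
have A0 : 0 <= 2 * enorm b + M * r by rewrite addr_ge0 ?mulr_ge0 ?enorm_ge0// ltW.
have qk : 0 <= q - kap q by lra.
have kn : kap q <= n%:R by rewrite (le_trans k1)// ler1n.
have [mK eK bK] := kK.
have mdot : msb (dot b) := measurable_dot b.
have msq : msb (fun z => enorm z ^+ 2) := measurable_funX 2 msb_enorm.
pose lin z := ann eps r z * (J q (- dot b z) * K z).
pose full z := ann eps r z * (J q (- dot b z - M * enorm z ^+ 2) * K z).
have mlin : msb lin.
  apply: msbM; first exact: msb_ann.
  apply: msbM => //; apply: msb_J.
  by rewrite (_ : (fun z => _) = fun z => 0 - dot b z); [apply: msbB => //; exact: msb_cst|apply/funext => z; rewrite sub0r].
have mfull : msb full.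
  apply: msbM; first exact: msb_ann.
  apply: msbM => //; apply: msb_J; apply: msbB; last by apply: msbM => //; exact: msb_cst.
  by rewrite (_ : (fun z => _) = fun z => 0 - dot b z); [apply: msbB => //; exact: msb_cst|apply/funext => z; rewrite sub0r].
have [ilog _] := @rad_log R n eps r e0 er.
have ilin : intg lin.
  apply: intg_le (intgZ (Lam * enorm b `^ q) ilog) => // z.
  rewrite /lin; case: (ann_case eps r z) => [h|h|[h1 h2]].
  - by rewrite ann_lt// !mul0r normr0 mulr0.
  - by rewrite ann_ge// !mul0r normr0 mulr0.
  rewrite ann_in// !mul1r normrM J_abs// normrN (ger0_norm (kern_ge0 z l0 kK)).
  have z0 : 0 < enorm z := lt_le_trans e0 h1.
  have d1 : `|dot b z| `^ q <= enorm b `^ q * enorm z `^ q.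
    by rewrite -powRM ?enorm_ge0//; apply: powR_mono; rewrite ?(ltW q0) ?dot_le.
  have := ler_pM (powR_ge0 _ _) (kern_ge0 z l0 kK) d1 (bK z).2.
  move/le_trans; apply; rewrite /rad le_eqVlt; apply/orP; left; apply/eqP.
  have -> : enorm z `^ (- n%:R) = enorm z `^ q * enorm z `^ (- q - n%:R).
    by rewrite -powRD_pos//; congr (_ `^ _); ring.
  ring.
have lin0 : Ig lin = 0.
  have [_] := Ig_refl ilin.
  rewrite (_ : (fun z => lin (- z)) = fun z => (-1) * lin z); last first.
    apply/funext => z; rewrite /lin /ann enormN eK dotNr J_opp mulN1r mulNr mulrN.
    by rewrite -(opprK (dot b z)) J_opp !opprK.
  rewrite IgZ//; move: (Ig lin) => I0; clear; lra.
have [irad brad] := @rad_near0 R n (kap q) eps r k0 kn e0 r0.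
pose C := (2 + q) * Lam * ((2 * enorm b + M * r) `^ (q - kap q) * M `^ kap q).
have C0 : 0 <= C by rewrite !mulr_ge0 ?powR_ge0.
have diff z : `|full z - lin z| <= C * (ann eps r z * rad (kap q - n%:R) z).
  rewrite /full /lin -mulrBr -mulrBl; case: (ann_case eps r z) => [h|h|[h1 h2]].
  - by rewrite ann_lt// !mul0r normr0 mulr0.
  - by rewrite ann_ge// !mul0r normr0 mulr0.
  rewrite ann_in// !mul1r normrM (ger0_norm (kern_ge0 z l0 kK)).
  have z0 : 0 < enorm z := lt_le_trans e0 h1.
  have MZ : 0 <= M * enorm z ^+ 2 by rewrite mulr_ge0 ?sqr_ge0.
  have d1 := dot_le b z.
  have d2 : `|- dot b z - M * enorm z ^+ 2| + `|- dot b z| <= (2 * enorm b + M * r) * enorm z.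
    have := ler_normB (- dot b z) (M * enorm z ^+ 2).
    rewrite normrN (ger0_norm MZ) => h.
    have : M * enorm z ^+ 2 <= M * r * enorm z.
      by rewrite expr2 mulrA ler_wpM2r ?(ltW z0)// ler_wpM2l// ltW.
    move: h d1; clear; lra.
  have d3 : `|- dot b z - M * enorm z ^+ 2 - - dot b z| = M * enorm z ^+ 2.
    by rewrite opprK addrAC addNr sub0r normrN ger0_norm.
  have h := J_holder (- dot b z - M * enorm z ^+ 2) (- dot b z) q0.
  rewrite d3 in h.
  have h3 : `|J q (- dot b z - M * enorm z ^+ 2) - J q (- dot b z)| <=
    (2 + q) * ((2 * enorm b + M * r) `^ (q - kap q) * enorm z `^ (q - kap q)
       * (M `^ kap q * enorm z `^ kap q * enorm z `^ kap q)).
    apply: (le_trans h); rewrite ler_wpM2l//.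
    rewrite (_ : M `^ kap q * _ * _ = (M * enorm z ^+ 2) `^ kap q); last first.
      by rewrite powRM ?sqr_ge0// expr2 powRM ?ltW// mulrA.
    rewrite ler_wpM2r ?powR_ge0// -(powRM _ A0 (ltW z0)).
    by apply: powR_mono => //; rewrite addr_ge0.
  have := ler_pM (normr_ge0 _) (kern_ge0 z l0 kK) h3 (bK z).2.
  move/le_trans; apply; rewrite /rad le_eqVlt; apply/orP; left; apply/eqP.
  have -> : enorm z `^ (kap q - n%:R) = enorm z `^ (q - kap q) *
      (enorm z `^ kap q * (enorm z `^ kap q * enorm z `^ (- q - n%:R))).
    by rewrite -!powRD_pos//; congr (_ `^ _); ring.
  rewrite /C; ring.
have ifull : intg full.
  rewrite (_ : full = fun z => (full z - lin z) + lin z); last first.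
    by apply/funext => z; rewrite subrK.
  apply: intgD => //; apply: intg_le (intgZ C irad) => //; exact: msbB.
split=> //.
have idiff : intg (fun z => full z - lin z) := intgB ifull ilin.
have -> : Ig full = Ig (fun z => full z - lin z) by rewrite IgB// lin0 subr0.
have : `|Ig (fun z => full z - lin z)| <= C * (@dyadic_cst R n (kap q) * r `^ kap q).
  apply: (le_trans (Ig_norm idiff)); apply: (le_trans (Ig_le (intg_norm idiff) (intgZ C irad) diff)).
  by rewrite IgZ// ler_wpM2l.
rewrite ler_norml => /andP[h _]; apply: le_trans h; rewrite lerN2 le_eqVlt.
apply/orP; left; apply/eqP.
by rewrite /C /near_cst (powRM _ M0 (ltW r0)); ring.
Qed.

End viscosity_ineq.

(** * From viscosity subsolutions to paraboloid inequalities *)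

Section viscosity_ineq.
Context {R : realType} {n : nat}.
Local Notation L := (lebesgue_rV R n).
Local Notation msb := (@measurableR _ L R).
Local Notation intg := (@integrableR _ L R (leb n)).
Local Notation Ig := (@integralR _ L R (leb n)).
Implicit Types (p s lam Lam q r e M eps : R) (u f g K : 'rV[R]_n -> R) (x y z b : 'rV[R]_n).

(** The form in which the equation is used; the last term bounds the
    contribution of the touching paraboloid inside the ball. *)
Definition parab_ineq (Lam q : R) K f u : Prop :=
  forall x0 r b M, 0 < r -> r <= 1 -> eball x0 r `<=` eball 0 2 -> 0 <= M ->
  (forall z, enorm z < r -> u (x0 + z) <= u x0 + dot b z + M * enorm z ^+ 2) ->
  Ig (fun z => (r <= enorm z)%R%:R * (J q (u x0 - u (x0 + z)) * K z)) <=
  f x0 + @near_cst R n q Lam * ((2 * enorm b + M * r) `^ (q - kap q) * (M * r) `^ kap q).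

Lemma patch_split u (x0 : 'rV[R]_n) r (eta : 'rV[R]_n -> R) y :
  patch u (eball x0 r) eta y = if enorm (y - x0) < r then eta y else u y.
Proof.
rewrite /patch; case: (ltP (enorm (y - x0)) r) => h; first by rewrite mem_set.
by rewrite memNset// /eball /= ltNge h.
Qed.

Lemma msb_if (c : 'rV[R]_n) r f g : msb f -> msb g ->
  msb (fun y => if enorm (y - c) < r then f y else g y).
Proof.
move=> mf mg.
have mb : msb (fun y => (enorm (y - c) < r)%R%:R) := msb_lt (msb_enormB c) (msb_cst r).
have -> : (fun y => if enorm (y - c) < r then f y else g y) =
  (fun y => (enorm (y - c) < r)%R%:R * f y + (1 - (enorm (y - c) < r)%R%:R) * g y).
  by apply/funext => y; case: ifP => _; rewrite ?mul1r ?mul0r ?subrr ?mul0r ?addr0 ?subr0 ?mul1r ?add0r.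
apply: msbD; apply: msbM => //; apply: msbB => //; exact: msb_cst.
Qed.

(** Since s p = p - 1, p (2 - s) = p + 1 > 2, so every paraboloid is an
    admissible test function. The truncated operators of the patched
    function are bounded below by the far integral minus the error of the
    near one, uniformly in the truncation, hence so is their limit. *)
Lemma visc_subsol_parab p s lam Lam K f u : (1 <= n)%N -> 1 < p -> 0 < s < 1 ->
  s * p = p - 1 -> 0 <= lam -> 0 <= Lam -> kernel_bounds p s lam Lam K ->
  msb u -> intg (wt (p - 1) u) -> visc_subsol p s K f (eball 0 2) u ->
  parab_ineq Lam (p - 1) (punctured K) f u.
Proof.
move=> n1 p1 s01 sp l0 L0 kb mu iw [_ visc _] x0 r b M r0 r1 sub M0 touch.
have [s0 s1] := andP s01.
set q := p - 1; have q0 : 0 < q by rewrite subr_gt0.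
have kK := kern_punctured q0 (etrans (mulrC p s) sp) kb.
have [mK eK bK] := kK.
pose eta y := u x0 + dot b (y - x0) + M * enorm (y - x0) ^+ 2.
have meta : msb eta.
  apply: continuous_measurable_rV => y.
  by have [] := @C2_quadratic R n setT (u x0) b x0 M y I.
have eta0 : eta x0 = u x0.
  rewrite /eta subrr enorm0 expr0n mulr0 addr0.
  by rewrite -(scale0r (0 : 'rV[R]_n)) dotZr mul0r addr0.
have [||l opl lf] := visc eta x0 r r0 sub (@C2_quadratic R n _ _ _ _ _) eta0.
- move=> y hy; have := touch (y - x0) hy; by rewrite addrC subrK.
- left; left; rewrite ltr_pdivrMr; last lra.
  have -> : p * (2 - s) = 2 * p - s * p by ring.
  rewrite sp; lra.
have x2 : enorm x0 <= 2.
  have : eball 0 2 x0 by apply: sub; rewrite /eball /= subrr enorm0.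
  by rewrite /eball /= subr0 => /ltW.
pose P := patch u (eball x0 r) eta.
have P0 : P x0 = u x0 by rewrite /P patch_split subrr enorm0 r0.
have mP : msb P.
  have := msb_if x0 r meta mu.
  by congr (msb _); apply/funext => y; rewrite /P patch_split.
pose far z := (r <= enorm z)%R%:R * (J q (u x0 - u (x0 + z)) * punctured K z).
have ifar : intg far := intg_tail_J l0 L0 q0 kK mu iw x2 r0 r1.
pose E := @near_cst R n q Lam * ((2 * enorm b + M * r) `^ (q - kap q) * (M * r) `^ kap q).
have trunc eps : 0 < eps -> eps <= r ->
    ((Ig far - E)%:E <= truncated_op p K P x0 eps)%E.
  move=> e0 er.
  have [inear bnear] := near_lower_bound b l0 L0 q0 n1 kK M0 e0 er.
  pose H y := (eps <= enorm (y - x0))%R%:R * (J q (u x0 - P y) * punctured K (y - x0)).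
  have HE z : H (x0 + z) =
      ann eps r z * (J q (- dot b z - M * enorm z ^+ 2) * punctured K z) + far z.
    have xz : x0 + z - x0 = z by rewrite addrC addKr.
    rewrite /H /far /P patch_split /eta xz.
    case: (ltP (enorm z) r) => h1.
      case: (leP eps (enorm z)) => h2; last first.
        by rewrite (ann_lt _ h2) !mul0r addr0.
      rewrite (ann_in h2 h1) mul0r addr0 !mul1r; congr (J q _ * _); ring.
    by rewrite (ann_ge _ h1) (le_trans er h1) mul0r add0r mul1r.
  have iHs : intg (fun z => H (x0 + z)).
    rewrite (_ : (fun z => H (x0 + z)) = fun z =>
      ann eps r z * (J q (- dot b z - M * enorm z ^+ 2) * punctured K z) + far z).
      exact: intgD.
    by apply/funext.
  have [iH IH] := Ig_shift (- x0) iHs.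
  have HH : (fun z => H (x0 + (- x0 + z))) = H by apply/funext => z; rewrite addNKr.
  rewrite HH in iH IH.
  have -> : truncated_op p K P x0 eps = (Ig H)%:E.
    rewrite -(@intgE _ L R (leb n) H iH) /truncated_op.
    have -> : ~` eball x0 eps = [set y | eps <= enorm (y - x0)].
      by apply/seteqP; split => y; rewrite /eball /setC /= leNgt => /negP.
    rewrite (@integral_indicator_bool _ L R (leb n) (fun y => eps <= enorm (y - x0))).
    apply: eq_integral => y _; congr EFin; rewrite /H.
    case: (leP eps (enorm (y - x0))) => h; last by rewrite !mul0r.
    rewrite !mul1r P0 /J /punctured -enorm_gt0 (lt_le_trans e0 h) mul1r.
    have yx : y - x0 != 0 by rewrite -enorm_gt0 (lt_le_trans e0 h).
    have [_ _ evenK _] := kb.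
    rewrite -(evenK _ yx) opprB; congr (_ `^ _ * _ * _); rewrite /q; ring.
  rewrite lee_fin IH.
  have -> : Ig (fun z => H (x0 + z)) =
      Ig (fun z => ann eps r z * (J q (- dot b z - M * enorm z ^+ 2) * punctured K z)) + Ig far.
    by rewrite -IgD//; congr Ig; apply/funext.
  by move: bnear; rewrite -/E => bnear; move: (Ig far) bnear => I1; clear; lra.
have lge : ((Ig far - E)%:E <= l)%E.
  have cl : cvg (truncated_op p K P x0 eps @[eps --> 0^'+]) by apply/cvg_ex; exists l.
  have <- : lim (truncated_op p K P x0 eps @[eps --> 0^'+]) = l by apply: cvg_lim.
  apply: lime_ge => //; near=> eps; apply: trunc; first by [].
  by near: eps; exact: nbhs_right_le.
have := le_trans lge lf; rewrite lee_fin -/E lerBlDr; exact.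
Unshelve. all: by end_near. Qed.

End viscosity_ineq.

(** * The nonlocal gain at a doubled maximum *)

Section contact.
Context {R : realType} {n : nat}.
Local Notation L := (lebesgue_rV R n).
Local Notation msb := (@measurableR _ L R).
Local Notation intg := (@integrableR _ L R (leb n)).
Local Notation Ig := (@integralR _ L R (leb n)).
Implicit Types (lam Lam q r rho tau mu P : R) (u K : 'rV[R]_n -> R) (a x y z w : 'rV[R]_n).

(** A Lipschitz cutoff between the ball of radius rho and that of radius 2
    rho, so that the far kernel keeps the regularity of K. *)
Definition chi rho z : R := Num.max 0 (Num.min 1 (2 - enorm z / rho)).

Lemma chi_ge0 rho z : 0 <= chi rho z. Proof. by rewrite le_max lexx. Qed.

Lemma chi_le1 rho z : chi rho z <= 1.
Proof. by rewrite ge_max ler01 ge_min lexx. Qed.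

Lemma chi_in rho z : 0 < rho -> enorm z <= rho -> chi rho z = 1.
Proof.
move=> r0 zr; have : enorm z / rho <= 1 by rewrite ler_pdivrMr// mul1r.
by move=> h; rewrite /chi min_l ?max_r//; lra.
Qed.

Lemma chi_out rho z : 0 < rho -> 2 * rho <= enorm z -> chi rho z = 0.
Proof.
move=> r0 zr; have : 2 <= enorm z / rho by rewrite ler_pdivlMr.
by move=> h; rewrite /chi min_r ?max_l//; lra.
Qed.

Lemma msb_chi rho : msb (chi rho).
Proof.
apply: measurable_maxr; first exact: msb_cst.
apply: measurable_minr; first exact: msb_cst.
apply: msbB; first exact: msb_cst.
by apply: msbM; [exact: msb_enorm|exact: msb_cst].
Qed.

(** The centre a/4 stays away from 0 and from a, where the kernel and the
    distance are singular. *)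
Definition gain_cube a tau : set 'rV[R]_n := cube (4^-1 *: a) (tau * enorm a / n%:R).

(** Points of the cube lie almost on the axis of a, so |a+z| + |a-z| is
    nearly 2|a| and the two one-sided tangent bounds leave room for the
    concavity of the modulus. *)
Lemma gain_cube_geom a tau z : (1 <= n)%N -> a != 0 -> 0 < tau -> tau <= 8^-1 ->
  gain_cube a tau z ->
  [/\ 9 / 8 * enorm a <= enorm (a + z), enorm (a - z) <= 7 / 8 * enorm a,
      enorm (a + z) + enorm (a - z) <= 2 * enorm a + 2 * tau ^+ 2 * enorm a,
      enorm z <= enorm a / 2 & enorm a / 8 <= enorm z].
Proof.
move=> n1 a0 t0 t8 hz; have al0 : 0 < enorm a by rewrite enorm_gt0.
pose w := z - 4^-1 *: a.
have zE : z = 4^-1 *: a + w by rewrite /w addrC subrK.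
have nn : 0 < n%:R :> R by rewrite ltr0n.
have wt : enorm w <= tau * enorm a.
  have -> : tau * enorm a = n%:R * (tau * enorm a / n%:R) by field; rewrite gt_eqF.
  apply: enorm_le_cube => i.
  by rewrite !mxE; have := hz i; rewrite !mxE.
have wt2 : enorm w ^+ 2 <= tau ^+ 2 * enorm a ^+ 2.
  by rewrite -exprMn ler_pXn2r ?nnegrE ?enorm_ge0 ?mulr_ge0 ?enorm_ge0// ltW.
have w8 : enorm w <= enorm a / 8.
  by rewrite (le_trans wt)// mulrC ler_pM2l.
have e1 : a + z = (5 / 4) *: a + w.
  by rewrite zE addrA -{1}(scale1r a) -scalerDl; congr (_ *: _ + _); field.
have e2 : a - z = (3 / 4) *: a - w.
  by rewrite zE opprD addrA -{1}(scale1r a) -scaleNr -scalerDl; congr (_ *: _ + _); field.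
have n54 : enorm ((5 / 4) *: a) = 5 / 4 * enorm a by rewrite enormZ ger0_norm.
have n34 : enorm ((3 / 4) *: a) = 3 / 4 * enorm a by rewrite enormZ ger0_norm.
have n14 : enorm (4^-1 *: a) = 4^-1 * enorm a by rewrite enormZ ger0_norm.
split.
- rewrite e1; have := enormB_le ((5 / 4) *: a) (- w); rewrite opprK enormN n54; lra.
- rewrite e2; have := enormD ((3 / 4) *: a) (- w); rewrite enormN n34; lra.
- have a54 : (5 / 4) *: a != 0 by rewrite scaler_eq0 negb_or a0 andbT; apply: lt0r_neq0; lra.
  have a34 : (3 / 4) *: a != 0 by rewrite scaler_eq0 negb_or a0 andbT; apply: lt0r_neq0; lra.
  have p1 := enormD_parab w a54; have p2 := enormD_parab (- w) a34.
  rewrite -e1 n54 dotZl in p1; rewrite -e2 n34 dotZl dotNr enormN in p2.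
  have q1 : 5 / 4 * dot a w / (5 / 4 * enorm a) = dot a w / enorm a by field; rewrite gt_eqF.
  have q2 : 3 / 4 * - dot a w / (3 / 4 * enorm a) = - (dot a w / enorm a) by field; rewrite gt_eqF.
  rewrite q1 in p1; rewrite q2 in p2.
  have s1 : enorm w ^+ 2 / (2 * (5 / 4 * enorm a)) <= 2 / 5 * tau ^+ 2 * enorm a.
    rewrite ler_pdivrMr ?mulr_gt0//; move: wt2; rewrite [enorm a ^+ 2]expr2; lra.
  have s2 : enorm w ^+ 2 / (2 * (3 / 4 * enorm a)) <= 2 / 3 * tau ^+ 2 * enorm a.
    rewrite ler_pdivrMr ?mulr_gt0//; move: wt2; rewrite [enorm a ^+ 2]expr2; lra.
  have : 0 <= tau ^+ 2 * enorm a by rewrite mulr_ge0 ?sqr_ge0// ltW.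
  lra.
- by rewrite zE; have := enormD (4^-1 *: a) w; rewrite n14; lra.
- by rewrite zE; have := enormB_le (4^-1 *: a) (- w); rewrite opprK enormN n14; lra.
Qed.

Definition err_cst (Lam q : R) : R := (2 + q) * Lam * 4 `^ (q - kap q).
(** The last factor comes from the volume of the gain cube. *)
Definition gain_cst (lam q : R) : R := lam * kap q * 8 `^ (- q) * (2 / n%:R) ^+ n.

Section pointwise.
Variables (lam Lam q r rho tau mu P : R) (K A B : 'rV[R]_n -> R) (a : 'rV[R]_n).
Hypotheses (n1 : (1 <= n)%N) (l0 : 0 <= lam) (L0 : 0 <= Lam) (q0 : 0 < q)
  (kK : kern lam Lam q K) (a0 : a != 0) (t0 : 0 < tau) (t8 : tau <= 8^-1)
  (P0 : 0 < P) (mu0 : 0 <= mu) (muP : mu <= P * tau ^+ 2)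
  (r0 : 0 < r) (ra : r < enorm a / 8) (arho : enorm a <= rho).
Hypotheses
  (h1 : forall z, enorm z < 2 * rho -> B z - mu * enorm z <= A z)
  (h2 : forall z, enorm z < 2 * rho ->
     - (P * (enorm (a + z) - enorm a)) - mu * enorm z <= A z)
  (h3 : forall z, enorm z < 2 * rho -> B z <= P * (enorm (a - z) - enorm a))
  (h4 : forall z, enorm z < 2 * rho -> 9 / 8 * enorm a <= enorm (a + z) ->
     - A z <= P * (enorm (a + z) - enorm a) - 4 * tau ^+ 2 * P * enorm a + mu * enorm z).

Let al0 : 0 < enorm a. Proof. by rewrite enorm_gt0. Qed.
Let rho0 : 0 < rho. Proof. exact: lt_le_trans al0 arho. Qed.

Let t21 : tau ^+ 2 <= 1.
Proof.
have t1 : tau <= 1 by apply: (le_trans t8); lra.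
by apply: exprn_ile1 => //; exact: ltW.
Qed.

(** Loss outside the gain cube: |A| and |B| may be of size P |z|, but J(A) -
    J(B) is controlled by the shift error mu |z|. *)
Lemma pointwise_err z : r <= enorm z -> enorm z < 2 * rho ->
  - (err_cst Lam q * (P `^ (q - kap q) * mu `^ kap q) * rad (- n%:R) z) <=
  (J q (A z) - J q (B z)) * (chi rho z * K z).
Proof.
move=> rz zr; have z0 : 0 < enorm z := lt_le_trans r0 rz.
have q2 : 0 <= 2 + q by rewrite addr_ge0// ltW.
have muP' : mu <= P.
  by apply: (le_trans muP); rewrite ger_pMr.
have K0 := kern_ge0 z l0 kK; have [_ _ /(_ z)[_ kz]] := kK.
have tri1 : enorm (a + z) - enorm a <= enorm z by have := enormD a z; lra.
have tri2 : enorm (a - z) - enorm a <= enorm z by have := enormD a (- z); rewrite enormN; lra.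
have S0 : 0 <= 2 * P * enorm z by rewrite !mulr_ge0 ?(ltW P0) ?(ltW z0).
have e0 : 0 <= mu * enorm z by rewrite mulr_ge0 ?(ltW z0).
have b1 : - (2 * P * enorm z) <= A z.
  apply: le_trans (h2 zr).
  have : P * (enorm (a + z) - enorm a) <= P * enorm z by rewrite ler_pM2l.
  have : mu * enorm z <= P * enorm z by rewrite ler_pM2r.
  lra.
have b2 : B z <= 2 * P * enorm z.
  apply: (le_trans (h3 zr)).
  have : P * (enorm (a - z) - enorm a) <= P * enorm z by rewrite ler_pM2l.
  have : 0 <= P * enorm z by rewrite mulr_ge0 ?ltW.
  lra.
have je := J_err q0 S0 e0 (h1 zr) b1 b2.
have -> : err_cst Lam q * (P `^ (q - kap q) * mu `^ kap q) * rad (- n%:R) z =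
  (2 + q) * ((2 * (2 * P * enorm z)) `^ (q - kap q) * (mu * enorm z) `^ kap q) *
  (Lam * rad (- q - n%:R) z).
  have -> : 2 * (2 * P * enorm z) = 4 * P * enorm z by ring.
  rewrite /rad (powRM (q - kap q) _ (ltW z0)) ?mulr_ge0 ?(ltW P0)//.
  rewrite (powRM (q - kap q) _ (ltW P0))// (powRM (kap q) mu0 (ltW z0)).
  have -> : enorm z `^ (- n%:R) = enorm z `^ (q - kap q) *
     (enorm z `^ kap q * enorm z `^ (- q - n%:R)).
    by rewrite -!powRD_pos//; congr (_ `^ _); ring.
  rewrite /err_cst; ring.
set X := (2 + q) * _ in je *.
have X0 : 0 <= X by rewrite /X !mulr_ge0 ?powR_ge0.
have c0 := chi_ge0 rho z; have c1 := chi_le1 rho z.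
have cK : 0 <= chi rho z * K z by rewrite mulr_ge0.
have h5 : - X * (chi rho z * K z) <= (J q (A z) - J q (B z)) * (chi rho z * K z).
  by rewrite ler_wpM2r.
apply: le_trans h5; rewrite mulNr lerN2 ler_wpM2l//.
apply: le_trans kz; rewrite ler_piMl//.
Qed.

(** On the gain cube -B exceeds -A by a fraction tau^2 of P |a|, and -B is
    comparable to P |a|. *)
Lemma pointwise_gain z : gain_cube a tau z ->
  lam * kap q * (P * enorm a / 8) `^ q * tau ^+ 2 * enorm a `^ (- q - n%:R) <=
  (J q (A z) - J q (B z)) * K z.
Proof.
move=> hz; have [g1 g2 g3 g4 g5] := gain_cube_geom n1 a0 t0 t8 hz.
have zr : enorm z < 2 * rho.
  by apply: (le_lt_trans g4); move: al0 arho; lra.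
have [_ _ /(_ z)[kz _]] := kK; have K0 := kern_ge0 z l0 kK.
have k0 := kap_gt0 q0.
pose Y := P * (enorm a - enorm (a - z)).
pose X := P * (enorm (a + z) - enorm a) - 4 * tau ^+ 2 * P * enorm a + mu * enorm z.
have XA : - A z <= X := h4 zr g1.
have YB : Y <= - B z by have := h3 zr; rewrite /Y; lra.
have Pa0 : 0 < P * enorm a by rewrite mulr_gt0.
have t20 : 0 < tau ^+ 2 by rewrite exprn_gt0.
have YX : tau ^+ 2 * (P * enorm a) <= Y - X.
  have m1 : mu * enorm z <= P * tau ^+ 2 * (enorm a / 2).
    by apply: ler_pM => //; exact: enorm_ge0.
  have m2 : P * (enorm (a + z) + enorm (a - z)) <=
      P * (2 * enorm a + 2 * tau ^+ 2 * enorm a) by rewrite ler_pM2l.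
  have m3 : 0 <= P * tau ^+ 2 * enorm a by rewrite !mulr_ge0 ?ltW.
  by move: m1 m2 m3; rewrite /Y /X; lra.
have Y8 : P * enorm a / 8 <= Y.
  have : P * enorm (a - z) <= P * (7 / 8 * enorm a) by rewrite ler_pM2l.
  by rewrite /Y; lra.
have Y0 : 0 < Y by apply: lt_le_trans Y8; rewrite divr_gt0.
have Ya : Y <= P * enorm a.
  by rewrite /Y ler_pM2l// gerBl enorm_ge0.
pose x := Num.max X 0.
have x0 : 0 <= x by rewrite le_max lexx orbT.
have xY : x <= Y.
  rewrite ge_max (ltW Y0) andbT; have : 0 <= tau ^+ 2 * (P * enorm a) by rewrite mulr_ge0 ?ltW.
  by move: YX; lra.
have Ax : - A z <= x by rewrite le_max XA.
have jg := J_gain q0 x0 xY Y0 Ax YB.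
have ratio : tau ^+ 2 <= 1 - x / Y.
  rewrite lerBrDr -lerBrDl ler_pdivrMr// /x ge_max; apply/andP; split.
    have : tau ^+ 2 * Y <= tau ^+ 2 * (P * enorm a) by rewrite ler_pM2l.
    by move: YX; lra.
  by rewrite mulr_ge0 ?subr_ge0// ltW.
have zpos : 0 < enorm z by apply: lt_le_trans g5; rewrite divr_gt0.
have kz' : lam * enorm a `^ (- q - n%:R) <= K z.
  apply: le_trans kz; rewrite ler_wpM2l// powR_anti//.
    by have := ler0n R n; move: q0; lra.
  by apply: (le_trans g4); move: al0; lra.
have jg' : kap q * (P * enorm a / 8) `^ q * tau ^+ 2 <= J q (A z) - J q (B z).
  have h8 : (P * enorm a / 8) `^ q <= Y `^ q.
    by apply: powR_mono => //; [exact: ltW|rewrite divr_ge0// ltW].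
  apply: le_trans jg; apply: ler_pM => //; last by rewrite ler_pM2l.
    by rewrite mulr_ge0 ?powR_ge0// ltW.
  exact: ltW.
have -> : lam * kap q * (P * enorm a / 8) `^ q * tau ^+ 2 * enorm a `^ (- q - n%:R) =
  (kap q * (P * enorm a / 8) `^ q * tau ^+ 2) * (lam * enorm a `^ (- q - n%:R)) by ring.
apply: ler_pM => //; last by rewrite mulr_ge0 ?powR_ge0.
by apply: mulr_ge0; [apply: mulr_ge0; [exact: ltW|exact: powR_ge0]|exact: ltW].
Qed.

Lemma pointwise_bound z :
  lam * kap q * (P * enorm a / 8) `^ q * tau ^+ 2 * enorm a `^ (- q - n%:R)
    * \1_(gain_cube a tau) z
  - err_cst Lam q * (P `^ (q - kap q) * mu `^ kap q) * (ann r (2 * rho) z * rad (- n%:R) z)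
  + (J q (A z) - J q (B z)) * ((1 - chi rho z) * K z)
  <= (r <= enorm z)%R%:R * (J q (A z) * K z) - (r <= enorm z)%R%:R * (J q (B z) * K z).
Proof.
rewrite -mulrBr -mulrBl.
have rrho : r <= rho by move: ra arho al0; lra.
have e1 : 0 <= err_cst Lam q * (P `^ (q - kap q) * mu `^ kap q).
  by rewrite !mulr_ge0 ?powR_ge0//; move: q0; lra.
have split1 : (J q (A z) - J q (B z)) * K z = (J q (A z) - J q (B z)) * (chi rho z * K z) +
    (J q (A z) - J q (B z)) * ((1 - chi rho z) * K z) by ring.
case: (pselect (gain_cube a tau z)) => hQ.
  have [_ _ _ g4 g5] := gain_cube_geom n1 a0 t0 t8 hQ.
  have rz : r <= enorm z by apply: le_trans g5; exact: ltW.
  have zr : enorm z <= rho by apply: (le_trans g4); move: al0 arho; lra.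
  rewrite indicE mem_set// mulr1 rz mul1r chi_in// subrr mul0r mulr0 addr0.
  rewrite lerBlDr; apply: (le_trans (pointwise_gain hQ)); rewrite lerDl.
  by apply: mulr_ge0 => //; apply: mulr_ge0; [exact: ann_ge0|exact: rad_ge0].
rewrite indicE memNset// mulr0 sub0r.
case: (ann_case r (2 * rho) z) => [h|h|[ha hb]].
- rewrite (ann_lt _ h) (leNgt r) h mul0r mulr0 oppr0 mul0r add0r.
  by rewrite chi_in ?subrr ?mul0r ?mulr0// (le_trans (ltW h)).
- rewrite (ann_ge _ h) mul0r mulr0 oppr0 add0r chi_out// subr0 mul1r.
  by rewrite (_ : r <= enorm z) ?mul1r// (le_trans _ h)//; move: rrho rho0; lra.
rewrite (ann_in ha hb) ha !mul1r split1 lerD2r; exact: pointwise_err.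
Qed.

(** Integrating the pointwise bounds: the gain over the volume of the cube,
    the loss against |z|^(-n), which costs a logarithm. *)
Lemma contact_estimate f1 f2 E1 E2 F :
  msb A -> msb B ->
  intg (fun z => (r <= enorm z)%R%:R * (J q (A z) * K z)) ->
  intg (fun z => (r <= enorm z)%R%:R * (J q (B z) * K z)) ->
  Ig (fun z => (r <= enorm z)%R%:R * (J q (A z) * K z)) <= f1 + E1 ->
  f2 - E2 <= Ig (fun z => (r <= enorm z)%R%:R * (J q (B z) * K z)) ->
  - F <= Ig (fun z => (J q (A z) - J q (B z)) * ((1 - chi rho z) * K z)) ->
  gain_cst lam q * (P `^ q * tau ^+ n.+2) <=
  f1 - f2 + E1 + E2 + F +
  err_cst Lam q * (P `^ (q - kap q) * mu `^ kap q) * (4 ^+ n * (1 + 2 * ln (2 * rho / r))).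
Proof.
move=> mA mB iA iB hA hB hF.
have rr : r <= 2 * rho by move: ra arho al0; lra.
have cr0 : 0 <= tau * enorm a / n%:R by rewrite divr_ge0// mulr_ge0// ltW.
have [iQ eQ] := @Ig_cube R n (4^-1 *: a) (tau * enorm a / n%:R) cr0.
have [iN bN] := @rad_log R n r (2 * rho) r0 rr.
set g := lam * kap q * (P * enorm a / 8) `^ q * tau ^+ 2 * enorm a `^ (- q - n%:R).
set c := err_cst Lam q * (P `^ (q - kap q) * mu `^ kap q).
have c0 : 0 <= c.
  by rewrite /c !mulr_ge0 ?powR_ge0//; move: q0; lra.
have [mK _ _] := kK.
have iF : intg (fun z => (J q (A z) - J q (B z)) * ((1 - chi rho z) * K z)).
  apply: intg_le (intgD (intg_norm iA) (intg_norm iB)).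
    apply: msbM; first by apply: msbB; exact: msb_J.
    apply: msbM => //; apply: msbB; first exact: msb_cst.
    exact: msb_chi.
  move=> z; have K0 := kern_ge0 z l0 kK.
  have c1 := chi_ge0 rho z; have c2 := chi_le1 rho z.
  case: (leP r (enorm z)) => h.
    have nM X : `|X * K z| = `|X| * K z by rewrite normrM (ger0_norm K0).
    rewrite !mul1r mulrA !nM -mulrDl ler_wpM2r//.
    have cc : 0 <= 1 - chi rho z by rewrite subr_ge0.
    rewrite (normrM (J q (A z) - J q (B z))) (ger0_norm cc).
    apply: (@le_trans _ _ (`|J q (A z) - J q (B z)| * 1)).
      by rewrite ler_wpM2l// gerBl.
    by rewrite mulr1; exact: ler_normB.
  rewrite chi_in ?subrr ?mul0r ?mulr0 ?normr0 ?addr0//.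
  by apply: (le_trans (ltW h)); move: ra arho al0; lra.
have iL : intg (fun z => g * \1_(gain_cube a tau) z - c * (ann r (2 * rho) z * rad (- n%:R) z)
   + (J q (A z) - J q (B z)) * ((1 - chi rho z) * K z)).
  by apply: intgD => //; apply: intgB; exact: intgZ.
have := Ig_le iL (intgB iA iB) pointwise_bound.
rewrite IgB// IgD//; last by apply: intgB; exact: intgZ.
rewrite IgB; [|exact: intgZ|exact: intgZ].
rewrite !IgZ// eQ => main.
have gE : gain_cst lam q * (P `^ q * tau ^+ n.+2) = g * (2 * (tau * enorm a / n%:R)) ^+ n.
  rewrite /g powR_div ?mulr_ge0 ?(ltW P0) ?(ltW al0)// powRM ?(ltW P0) ?(ltW al0)//.
  have -> : 2 * (tau * enorm a / n%:R) = (2 / n%:R) * tau * enorm a by field; rewrite pnatr_eq0 -lt0n.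
  rewrite !exprMn /gain_cst powRN.
  have e : enorm a `^ q * enorm a `^ (- q - n%:R) * enorm a ^+ n = 1.
    rewrite -(powR_mulrn _ (ltW al0)) -!powRD_pos//.
    by rewrite (_ : q + (- q - n%:R) + n%:R = 0) ?powRr0//; ring.
  transitivity (lam * kap q * (8 `^ q)^-1 * (2 / n%:R) ^+ n * (P `^ q * tau ^+ n.+2) *
    (enorm a `^ q * enorm a `^ (- q - n%:R) * enorm a ^+ n)); first by rewrite e mulr1.
  rewrite !exprS exprMn; ring.
rewrite gE.
have : c * Ig (fun z => ann r (2 * rho) z * rad (- n%:R) z) <=
    c * (4 ^+ n * (1 + 2 * ln (2 * rho / r))) by rewrite ler_wpM2l.
move: main hA hB hF; lra.
Qed.

End pointwise.

End contact.

(** * Doubling the variables *)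

Section doubling.
Context {R : realType} {n : nat}.
Implicit Types (lam Lam q r rho tau mu P : R) (u K : 'rV[R]_n -> R) (a b x y z w : 'rV[R]_n).

Lemma compact_closed_eball r : compact [set x : 'rV[R]_n | enorm x <= r].
Proof.
apply: bounded_closed_compact.
  exists r; split; first exact: num_real.
  move=> M rM x /= xr; apply: (le_trans _ (ltW rM)); apply: le_trans xr.
  rewrite /Num.Def.normr /= mx_normrE; apply/bigmax_leP; split=> [|[i j] _ /=]; first exact: enorm_ge0.
  by rewrite (ord1 i); exact: coord_le.
rewrite (_ : [set x | _] = (@enorm R 1 n) @^-1` [set t | t <= r])//.
apply: closed_comp; first by move=> x _; exact: enorm_continuous.
exact: closed_le.
Qed.

Definition Phi (u : 'rV[R]_n -> R) (phi : R -> R) (Lc m : R) (x0 x y : 'rV[R]_n) : R :=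
  u x - u y - Lc * phi (enorm (x - y)) - m * enorm (x - x0) ^+ 2.

Lemma doubling_max u phi Lc m x0 r : (forall x, enorm x < 2 -> {for x, continuous u}) ->
  (forall x : 'rV[R]_n, {for x, continuous (fun z => phi (enorm z))}) ->
  r < 2 -> enorm x0 <= r ->
  exists xb yb, [/\ enorm xb <= r, enorm yb <= r &
    forall x y, enorm x <= r -> enorm y <= r -> Phi u phi Lc m x0 x y <= Phi u phi Lc m x0 xb yb].
Proof.
move=> cu cphi r2 x0r.
pose D : set ('rV[R]_n) := [set x | enorm x <= r].
pose Ph (xy : 'rV[R]_n * 'rV[R]_n) := Phi u phi Lc m x0 xy.1 xy.2.
have cD : compact (D `*` D) by apply: compact_setX; exact: compact_closed_eball.
have D0 : D `*` D !=set0 by exists (x0, x0).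
have cP : {within D `*` D, continuous Ph}.
  apply: continuous_in_subspaceT => -[x y]; rewrite inE => -[/= Dx Dy].
  have c1 : {for (x, y), continuous (fun xy : 'rV[R]_n * 'rV[R]_n => u xy.1)}.
    by apply: (@cvg_comp _ _ _ _ _ _ (nbhs x)); [exact: cvg_fst|apply: cu; exact: le_lt_trans r2].
  have c2 : {for (x, y), continuous (fun xy : 'rV[R]_n * 'rV[R]_n => u xy.2)}.
    by apply: (@cvg_comp _ _ _ _ _ _ (nbhs y)); [exact: cvg_snd|apply: cu; exact: le_lt_trans r2].
  have c3 : {for (x, y), continuous (fun xy : 'rV[R]_n * 'rV[R]_n => phi (enorm (xy.1 - xy.2)))}.
    apply: (@cvg_comp _ _ _ _ (fun z => phi (enorm z)) _ (nbhs (x - y))); last exact: cphi.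
    by apply: cvgB; [exact: cvg_fst|exact: cvg_snd].
  have c4 : {for (x, y), continuous (fun xy : 'rV[R]_n * 'rV[R]_n => enorm (xy.1 - x0))}.
    apply: (@cvg_comp _ _ _ _ (fun z => enorm (z - x0)) _ (nbhs x)); last exact: enormB_continuous.
    exact: cvg_fst.
  apply: cvgB; first apply: cvgB; first exact: (cvgB c1 c2).
    exact: (cvgM (cvg_cst Lc) c3).
  exact: (cvgM (cvg_cst m) (cvgM c4 c4)).
have [[xb yb]] := compact_EVT_max D0 cD cP.
rewrite inE => -[/= Dx Dy] h; exists xb, yb; split=> // x y xr yr.
by have := h (x, y); rewrite inE; apply.
Qed.

End doubling.

Section contact_inequality.
Context {R : realType} {n : nat}.
Local Notation L := (lebesgue_rV R n).
Local Notation msb := (@measurableR _ L R).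
Local Notation intg := (@integrableR _ L R (leb n)).
Local Notation Ig := (@integralR _ L R (leb n)).
Implicit Types (lam Lam q r rho tau mu P d Lc m nu Rb F : R) (u K f : 'rV[R]_n -> R) (a b x y z w : 'rV[R]_n).

(** d is a slope of phi at t0; the second bound is the strict concavity that
    the gain cube uses. *)
Definition concave_at (phi : R -> R) (t0 d tau : R) : Prop :=
  (forall t, 0 <= t -> phi t <= phi t0 + d * (t - t0)) /\
  (forall t, 9 / 8 * t0 <= t -> phi t <= phi t0 + d * (t - t0) - 4 * tau ^+ 2 * d * t0).

Lemma near_error q P M r al bn : 0 < q -> 0 < P -> 0 < al -> al <= 1 ->
  0 <= bn -> bn <= 2 * P -> 0 <= M -> M <= P / al -> r = al ^+ 2 ->
  (2 * bn + M * r) `^ (q - kap q) * (M * r) `^ kap q <= 5 `^ (q - kap q) * P `^ q * al `^ kap q.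
Proof.
move=> q0 P0 al0 al1 b0 b2 M0 MP ->.
have k0 := kap_gt0 q0; have kq := kap_le q.
have Mr : M * al ^+ 2 <= P * al.
  apply: (@le_trans _ _ (P / al * al ^+ 2)); first by rewrite ler_wpM2r// sqr_ge0.
  by rewrite expr2 mulrA divfK// gt_eqF.
have Mr0 : 0 <= M * al ^+ 2 by rewrite mulr_ge0// sqr_ge0.
have PalP : P * al <= P by rewrite ger_pMr.
have -> : 5 `^ (q - kap q) * P `^ q * al `^ kap q = (5 * P) `^ (q - kap q) * (P * al) `^ kap q.
  rewrite (powRM (q - kap q) _ (ltW P0))// (powRM (kap q) (ltW P0) (ltW al0)).
  have -> : P `^ q = P `^ (q - kap q) * P `^ kap q by rewrite -powRD_pos// subrK.
  ring.
apply: ler_pM; rewrite ?powR_ge0//; apply: powR_mono => //; lra.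
Qed.

Lemma near_cst_ge0 q Lam : 0 < q -> 0 <= Lam -> 0 <= @near_cst R n q Lam.
Proof.
move=> q0 L0; have k0 := kap_gt0 q0; rewrite /near_cst /dyadic_cst.
apply: mulr_ge0; first by rewrite mulr_ge0// addr_ge0// ltW.
rewrite divr_ge0 ?exprn_ge0// subr_ge0 -[leLHS](powRr0 (2:R)).
by apply: ler_powR; [rewrite ler1n|exact: ltW].
Qed.

Lemma sqr_shift x x0 z : enorm (x + z - x0) ^+ 2 - enorm (x - x0) ^+ 2 = 2 * dot (x - x0) z + enorm z ^+ 2.
Proof. by rewrite (_ : x + z - x0 = x - x0 + z) ?enormD_sqr; [ring|rewrite addrAC]. Qed.

Lemma contact_neq u phi Lc m x0 xb yb : phi 0 = 0 -> 0 < m ->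
  0 < Phi u phi Lc m x0 xb yb -> xb - yb != 0.
Proof.
move=> phi00 m0; apply: contraTneq => h; rewrite /Phi h enorm0 phi00 mulr0 subr0.
have -> : xb = yb by apply/eqP; rewrite -subr_eq0 h.
by rewrite subrr sub0r -leNgt oppr_le0 mulr_ge0 ?sqr_ge0// ltW.
Qed.

(** The maximum of Phi, tested against moving x alone, y alone, or both
    points together, gives the one-sided bounds that the contact estimate
    needs; near the maximum the same comparisons give the paraboloids for
    the two viscosity inequalities. *)
Lemma contact_inequality lam Lam q rho tau mu d Lc m nu Rb F K u f1 f2 (phi : R -> R) x0 xb yb :
  let a := xb - yb in let al := enorm a in let P := Lc * d in
  (1 <= n)%N -> 0 <= lam -> 0 <= Lam -> 0 < q -> kern lam Lam q K ->
  msb u -> intg (wt q u) ->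
  parab_ineq Lam q K f1 u -> parab_ineq Lam q K f2 (fun x => - u x) ->
  Rb < 2 -> phi 0 = 0 -> 0 < Lc -> 0 < d -> 0 < m ->
  (forall x y, enorm x <= Rb -> enorm y <= Rb ->
     Phi u phi Lc m x0 x y <= Phi u phi Lc m x0 xb yb) ->
  0 < Phi u phi Lc m x0 xb yb ->
  enorm xb + 2 * rho <= Rb -> enorm yb + 2 * rho <= Rb ->
  enorm (xb - x0) <= nu -> 0 < tau -> tau <= 8^-1 ->
  al <= 16^-1 -> al <= rho -> rho <= 2^-1 ->
  mu = 2 * m * (nu + rho) -> mu <= P * tau ^+ 2 -> concave_at phi al d tau ->
  - F <= Ig (fun z => (J q (u xb - u (xb + z)) - J q (u yb - u (yb + z))) *
                      ((1 - chi rho z) * K z)) ->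
  @gain_cst R n lam q * (P `^ q * tau ^+ n.+2) <=
  f1 xb + f2 yb + F + 2 * @near_cst R n q Lam * 5 `^ (q - kap q) * (P `^ q * al `^ kap q) +
  err_cst Lam q * (P `^ (q - kap q) * mu `^ kap q) * (4 ^+ n * (1 + 4 * - ln al)).
Proof.
move=> a al P n1 l0 L0 q0 kK mu_ iw v1 v2 Rb2 phi00 Lc0 d0 m0 cmax pos xbR ybR xbnu t0 t8 al16 alrho
  rho1 muE muP conc hF.
have a0 : a != 0 := contact_neq phi00 m0 pos.
have al0 : 0 < al by rewrite enorm_gt0.
have P0 : 0 < P by rewrite mulr_gt0.
have rho0 : 0 < rho := lt_le_trans al0 alrho.
have nu0 : 0 <= nu := le_trans (enorm_ge0 _) xbnu.
have mu0 : 0 <= mu by rewrite muE !mulr_ge0 ?addr_ge0// ltW.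
have t21 : tau ^+ 2 <= 1.
  have t1 : tau <= 1 by move: t8; clear; lra.
  by apply: exprn_ile1 => //; exact: ltW.
have muP' : mu <= P by apply: (le_trans muP); rewrite ger_pMr.
pose A z := u xb - u (xb + z).
pose B z := u yb - u (yb + z).
have inx z : enorm z < 2 * rho -> enorm (xb + z) <= Rb.
  by move=> h; have := enormD xb z; move: xbR h; clear; lra.
have iny z : enorm z < 2 * rho -> enorm (yb + z) <= Rb.
  by move=> h; have := enormD yb z; move: ybR h; clear; lra.
have xb2 : enorm xb <= Rb by move: xbR rho0; clear; lra.
have yb2 : enorm yb <= Rb by move: ybR rho0; clear; lra.
have psi z : enorm z < 2 * rho ->
    m * (enorm (xb + z - x0) ^+ 2 - enorm (xb - x0) ^+ 2) <= mu * enorm z.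
  move=> h; rewrite sqr_shift muE.
  have dd : dot (xb - x0) z <= nu * enorm z.
    apply: (le_trans (le_trans (ler_norm _) (dot_le _ _))).
    by rewrite ler_wpM2r// enorm_ge0.
  have zz : enorm z ^+ 2 <= 2 * rho * enorm z by rewrite expr2 ler_wpM2r ?enorm_ge0// ltW.
  have -> : 2 * m * (nu + rho) * enorm z = m * (2 * (nu * enorm z) + 2 * rho * enorm z) by ring.
  by rewrite ler_pM2l//; move: dd zz; clear; lra.
have [tang gap] := conc.
have Aphi z : enorm z < 2 * rho ->
    - A z <= Lc * (phi (enorm (a + z)) - phi al) + m * (enorm (xb + z - x0) ^+ 2 - enorm (xb - x0) ^+ 2).
  move=> h; have := cmax _ _ (inx z h) yb2; rewrite /Phi /A /al /a.
  rewrite (_ : xb + z - yb = xb - yb + z); last by rewrite addrAC.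
  by clear; lra.
have Bphi z : enorm z < 2 * rho -> B z <= Lc * (phi (enorm (a - z)) - phi al).
  move=> h; have := cmax _ _ xb2 (iny z h); rewrite /Phi /B /al /a.
  rewrite (_ : xb - (yb + z) = xb - yb - z); last by rewrite opprD addrA.
  by clear; lra.
have tangL w : Lc * (phi (enorm w) - phi al) <= P * (enorm w - al).
  by rewrite /P -mulrA ler_pM2l// lerBlDl; exact: (tang _ (enorm_ge0 w)).
have h1 z : enorm z < 2 * rho -> B z - mu * enorm z <= A z.
  move=> h; have := cmax _ _ (inx z h) (iny z h); have := psi z h; rewrite /Phi /A /B.
  rewrite (_ : xb + z - (yb + z) = xb - yb); last by rewrite opprD addrACA subrr addr0.
  by clear; lra.
have h2 z : enorm z < 2 * rho -> - (P * (enorm (a + z) - al)) - mu * enorm z <= A z.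
  move=> h; have := Aphi z h; have := psi z h; have := tangL (a + z); clear; lra.
have h3 z : enorm z < 2 * rho -> B z <= P * (enorm (a - z) - al).
  move=> h; have := Bphi z h; have := tangL (a - z); clear; lra.
have h4 z : enorm z < 2 * rho -> 9 / 8 * al <= enorm (a + z) ->
    - A z <= P * (enorm (a + z) - al) - 4 * tau ^+ 2 * P * al + mu * enorm z.
  move=> h hz; have := Aphi z h; have := psi z h.
  have : Lc * (phi (enorm (a + z)) - phi al) <= Lc * (d * (enorm (a + z) - al) - 4 * tau ^+ 2 * d * al).
    by rewrite ler_pM2l// lerBlDl addrA; exact: gap.
  by rewrite /P; clear; lra.
(* Any power of al above 1 would do: the near errors become powers of al, and
   log(1/r) stays comparable to log(1/al). *)
pose r := al ^+ 2.
have r0 : 0 < r by rewrite exprn_gt0.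
have ra : r < al / 8.
  by rewrite /r expr2 ltr_pM2l//; move: al16; clear; lra.
have al1 : al <= 1 by move: al16; clear; lra.
have r1 : r <= 1 by rewrite /r exprn_ile1// ltW.
have r2rho : r < 2 * rho by move: ra alrho rho0; clear; lra.
have mP : m <= P / (2 * al).
  rewrite ler_pdivlMr ?mulr_gt0//; apply: le_trans muP'; rewrite muE.
  have : m * al <= m * (nu + rho) by rewrite ler_pM2l//; move: alrho nu0; clear; lra.
  by clear; lra.
pose b1 := (P / al) *: a + (2 * m) *: (xb - x0).
pose M1 := P / (2 * al) + m.
pose b2 := - ((P / al) *: a).
pose M2 := P / (2 * al).
have na : enorm ((P / al) *: a) = P.
  by rewrite enormZ ger0_norm ?divr_ge0 ?ltW// divfK// gt_eqF.
have nb1 : enorm b1 <= 2 * P.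
  apply: (le_trans (enormD _ _)); rewrite na enormZ ger0_norm ?mulr_ge0 ?(ltW m0)//.
  have : 2 * m * enorm (xb - x0) <= 2 * m * (nu + rho).
    by rewrite ler_wpM2l ?mulr_ge0 ?(ltW m0)//; move: xbnu rho0; clear; lra.
  by rewrite -muE; move: muP'; clear; lra.
have nb2 : enorm b2 <= 2 * P by rewrite enormN na; move: P0; clear; lra.
have M20 : 0 <= M2 by rewrite divr_ge0 ?mulr_ge0// ltW.
have M10 : 0 <= M1 by rewrite addr_ge0// ltW.
have P2 : P / (2 * al) + P / (2 * al) = P / al by field; rewrite gt_eqF.
have M1P : M1 <= P / al by rewrite /M1 -P2 lerD2l.
have M2P : M2 <= P / al by rewrite /M2 -P2 lerDl.
have subx : eball xb r `<=` eball 0 2.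
  move=> y; rewrite /eball /= subr0 => h; have := enormD (y - xb) xb; rewrite subrK.
  by move: h r2rho xbR Rb2; clear; lra.
have suby : eball yb r `<=` eball 0 2.
  move=> y; rewrite /eball /= subr0 => h; have := enormD (y - yb) yb; rewrite subrK.
  by move: h r2rho ybR Rb2; clear; lra.
have parab w : P * (enorm (a + w) - al) <= P / al * dot a w + P / (2 * al) * enorm w ^+ 2.
  have := enormD_parab w a0; rewrite -/al => h.
  have -> : P / al * dot a w + P / (2 * al) * enorm w ^+ 2 =
    P * (dot a w / al + enorm w ^+ 2 / (2 * al)) by field; rewrite gt_eqF.
  by rewrite ler_pM2l//; move: h; clear; lra.
have touch1 z : enorm z < r -> u (xb + z) <= u xb + dot b1 z + M1 * enorm z ^+ 2.
  move=> h; have hz := lt_trans h r2rho.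
  have := Aphi z hz; have := tangL (a + z); have := parab z.
  rewrite sqr_shift /A /b1 /M1 (dotDl ((P / al) *: a)) !dotZl; clear; lra.
have touch2 z : enorm z < r -> - u (yb + z) <= - u yb + dot b2 z + M2 * enorm z ^+ 2.
  move=> h; have hz := lt_trans h r2rho.
  have := Bphi z hz; have := tangL (a - z); have := parab (- z).
  rewrite /B /b2 /M2 dotNl dotZl dotNr enormN; clear; lra.
have I1 := v1 _ _ _ _ r0 r1 subx M10 touch1.
have I2 := v2 _ _ _ _ r0 r1 suby M20 touch2.
have e1 := near_error q0 P0 al0 al1 (enorm_ge0 b1) nb1 M10 M1P (erefl r).
have e2 := near_error q0 P0 al0 al1 (enorm_ge0 b2) nb2 M20 M2P (erefl r).
have nc0 := near_cst_ge0 q0 L0.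
have x2 : enorm xb <= 2 by move: xb2 Rb2; clear; lra.
have y2 : enorm yb <= 2 by move: yb2 Rb2; clear; lra.
have iA := intg_tail_J l0 L0 q0 kK mu_ iw x2 r0 r1.
have iB := intg_tail_J l0 L0 q0 kK mu_ iw y2 r0 r1.
set E := @near_cst R n q Lam * (5 `^ (q - kap q) * P `^ q * al `^ kap q).
have hA : Ig (fun z => (r <= enorm z)%R%:R * (J q (A z) * K z)) <= f1 xb + E.
  exact: le_trans I1 (lerD (lexx (f1 xb)) (ler_wpM2l nc0 e1)).
have hB : - f2 yb - E <= Ig (fun z => (r <= enorm z)%R%:R * (J q (B z) * K z)).
  have : Ig (fun z => (-1) * ((r <= enorm z)%R%:R * (J q (B z) * K z))) <= f2 yb + E.
    have I2' := le_trans I2 (lerD (lexx (f2 yb)) (ler_wpM2l nc0 e2)).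
    apply: le_trans I2'; rewrite le_eqVlt; apply/orP; left; apply/eqP; congr Ig.
    apply/funext => z; rewrite mulN1r -mulrN -mulNr -J_opp /B; congr (_ * (J q _ * _)); ring.
  rewrite IgZ; last exact: iB.
  by clear; lra.
have mA : msb A by apply: msbB; [exact: msb_cst|exact: msb_shift].
have mB : msb B by apply: msbB; [exact: msb_cst|exact: msb_shift].
have := contact_estimate n1 l0 L0 q0 kK a0 t0 t8 P0 mu0 muP r0 ra alrho h1 h2 h3 h4 mA mB iA iB hA hB hF.
move/le_trans; apply.
have ec0 : 0 <= err_cst Lam q * (P `^ (q - kap q) * mu `^ kap q).
  rewrite !mulr_ge0 ?powR_ge0//; by rewrite addr_ge0// ltW.
have lnle : ln (2 * rho / r) <= 2 * - ln al.
  have -> : 2 * - ln al = ln (1 / r).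
    by rewrite /r div1r lnV ?posrE ?exprn_gt0// lnXn// mulrN -(mulr_natl (ln al) 2).
  rewrite ler_ln ?posrE ?divr_gt0 ?mulr_gt0// ler_pM2r ?invr_gt0//.
  by move: rho1; clear; lra.
have c4 : 4 ^+ n * (1 + 2 * ln (2 * rho / r)) <= 4 ^+ n * (1 + 4 * - ln al).
  by rewrite ler_wpM2l ?exprn_ge0//; move: lnle; clear; lra.
have := ler_wpM2l ec0 c4.
rewrite -/al -/E => h.
have -> : 2 * @near_cst R n q Lam * 5 `^ (q - kap q) * (P `^ q * al `^ kap q) = 2 * E.
  by rewrite /E; ring.
by move: h; clear; lra.
Qed.

End contact_inequality.

(** * Logarithmic moduli of continuity *)

Section modulus.
Context {R : realType}.
Implicit Types (t l v x y : R).

Lemma ln_1716 : 17^-1 <= ln (17 / 16 : R).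
Proof.
have := @expR_ge1Dx R (- ln (17 / 16)).
by rewrite expRN lnK ?posrE//; lra.
Qed.

(** Moduli phi(t) = t G(log(1/t)) with phi'(t) = H(l), H = G - G', l =
    log(1/t). The tangent condition is concavity of phi, and the gap
    condition is a quantitative decrease of H between the scales t and 17/16
    t. *)
Record log_profile (G G' : R -> R) (lr : R) : Prop := LogProfile {
  lp_lr : 1 <= lr;
  lp_G' : forall l, lr <= l -> 0 <= G' l;
  lp_H : forall l, lr <= l -> 0 < G l - G' l;
  lp_tan : forall l l', lr <= l -> lr <= l' -> G l' - G l <= G' l * (expR (l' - l) - 1);
  lp_gap : forall l, lr <= l - ln (17 / 16) -> 
    (G l - G' l) / (25 * l ^+ 2) <= (G l - G' l) - (G (l - ln (17 / 16)) - G' (l - ln (17 / 16)))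
}.

(** The modulus is constant from the scale exp (- lr) on, where concavity
    may fail. *)
Definition phi_of (G : R -> R) (lr : R) t : R :=
  Num.min t (expR (- lr)) * G (- ln (Num.min t (expR (- lr)))).

Section profile.
Variables (G G' : R -> R) (lr : R).
Hypothesis lp : log_profile G G' lr.
Let rr : R := expR (- lr).
Let phi := phi_of G lr.
Let H l := G l - G' l.

Let rr0 : 0 < rr. Proof. exact: expR_gt0. Qed.

Let lnt_ge t : 0 < t -> t <= rr -> lr <= - ln t.
Proof.
move=> t0 tr; rewrite lerNr -(expRK (- lr)) ler_ln ?posrE//.
Qed.

Lemma phi_of0 : phi 0 = 0.
Proof. by rewrite /phi /phi_of min_l ?mul0r// expR_ge0. Qed.

Lemma phi_of_small t : t <= rr -> phi t = t * G (- ln t).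
Proof. by move=> tr; rewrite /phi /phi_of min_l. Qed.

Lemma phi_of_large t : rr <= t -> phi t = phi rr.
Proof. by move=> tr; rewrite /phi /phi_of min_r// min_l. Qed.

Lemma phi_tangent t0 t : 0 < t0 -> t0 <= rr -> 0 <= t ->
  phi t <= phi t0 + H (- ln t0) * (t - t0).
Proof.
move=> t00 t0r t_0; have l0 := lnt_ge t00 t0r.
have Hp := lp_H lp l0; have G'p := lp_G' lp l0.
have small x : 0 <= x -> x <= rr -> phi x <= phi t0 + H (- ln t0) * (x - t0).
  move=> x0 xr; rewrite (phi_of_small t0r).
  have [->|xN0] := eqVneq x 0.
    rewrite phi_of0 /H sub0r.
    have : 0 <= t0 * G' (- ln t0) by rewrite mulr_ge0// ltW.
    lra.
  have xp : 0 < x by rewrite lt_neqAle eq_sym xN0.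
  rewrite (phi_of_small xr).
  have := lp_tan lp l0 (lnt_ge xp xr).
  have -> : expR (- ln x - - ln t0) = t0 / x.
    by rewrite opprK addrC expRD expRN !lnK ?posrE.
  move=> h; have : x * (G (- ln x) - G (- ln t0)) <= x * (G' (- ln t0) * (t0 / x - 1)).
    by rewrite ler_pM2l.
  have -> : x * (G' (- ln t0) * (t0 / x - 1)) = G' (- ln t0) * (t0 - x).
    by field; rewrite gt_eqF.
  rewrite /H; lra.
case: (lerP t rr) => tr; first exact: small.
rewrite phi_of_large ?(ltW tr)//; apply: (le_trans (small rr (ltW rr0) (lexx _))).
by rewrite lerD2l ler_pM2l// lerD2r ltW.
Qed.

(** From 17/16 t0 on, before 9/8 t0 is reached, the slope has dropped by at
    least a fraction 1/(25 l^2) of itself. *)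
Lemma phi_concave_at t0 : 0 < t0 -> t0 < rr ->
  concave_at phi t0 (H (- ln t0)) ((40 * - ln t0)^-1).
Proof.
move=> t00 t0r; set l := - ln t0; have l0 : lr <= l := lnt_ge t00 (ltW t0r).
have lr1 := lp_lr lp; have l1 : 1 <= l := le_trans lr1 l0.
have lp0 : 0 < l := lt_le_trans ltr01 l1.
have Hp : 0 < H l := lp_H lp l0.
split=> [t|t tt]; first exact: phi_tangent (ltW t0r).
have -> : 4 * (40 * l)^-1 ^+ 2 * H l * t0 = H l / (25 * l ^+ 2) * (t0 / 16).
  have -> : (40 * l)^-1 ^+ 2 = (8 * 5 * l)^-1 ^+ 2 by congr (_^-1 ^+ 2); congr (_ * _); ring.
  by rewrite exprVn; field; rewrite gt_eqF.
have HX : H l / (25 * l ^+ 2) * (t0 / 16) <= H l * (t0 / 16).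
  rewrite ler_wpM2r ?divr_ge0// ?(ltW t00)// ler_pdivrMr ?mulr_gt0 ?exprn_gt0//.
  rewrite ler_peMr ?(ltW Hp)//.
  have l2 : 1 <= l ^+ 2 by exact: exprn_ege1.
  lra.
have Ht : 0 < H l * t0 by rewrite mulr_gt0.
have t_0 : 0 <= t by lra.
pose s := 17 / 16 * t0.
have s0 : 0 < s by rewrite /s; lra.
have ts : t0 / 16 <= t - s by rewrite /s; lra.
case: (lerP rr s) => hs.
  have rt : rr <= t by rewrite /s in hs; lra.
  rewrite (phi_of_large rt); have := phi_tangent t00 (ltW t0r) (ltW rr0).
  rewrite -/l => h.
  have : H l * (rr - t0) <= H l * (t - t0) - H l * t0 / 16.
    have -> : H l * (t - t0) - H l * t0 / 16 = H l * (t - t0 - t0 / 16) by ring.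
    by rewrite ler_pM2l//; move: hs; rewrite /s; lra.
  lra.
have ls : - ln s = l - ln (17 / 16).
  have p1716 : 0 < 17 / 16 :> R by rewrite divr_gt0.
  by rewrite /s lnM ?posrE// opprD addrC.
have lrs : lr <= l - ln (17 / 16) by rewrite -ls; exact: lnt_ge (ltW hs).
have := lp_gap lp lrs; rewrite -!/(H _) -ls => gap.
have p1 := phi_tangent s0 (ltW hs) t_0.
have p2 := phi_tangent t00 (ltW t0r) (ltW s0); rewrite -/l in p2.
have gp : 0 <= H l / (25 * l ^+ 2).
  by rewrite divr_ge0 ?mulr_ge0 ?sqr_ge0// ltW.
have g2 : H l / (25 * l ^+ 2) * (t0 / 16) <= (H l - H (- ln s)) * (t - s).
  apply: ler_pM => //; lra.
lra.
Qed.

End profile.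

(** The resulting phi is comparable to t, yet strictly concave at every
    small scale. *)
Definition lip_G l : R := 1 - l^-1.
Definition lip_G' l : R := l^-1 ^+ 2.

Lemma lip_G_profile lr : 4 <= lr -> log_profile lip_G lip_G' lr.
Proof.
move=> lr4; have ln0 : 0 < ln (17 / 16 : R) by rewrite (lt_le_trans _ ln_1716)// invr_gt0.
split; rewrite /lip_G /lip_G'.
- by lra.
- by move=> l _; exact: sqr_ge0.
- move=> l hl; have l0 : 0 < l by lra.
  have h : l^-1 <= 4^-1 by rewrite lef_pV2 ?posrE//; lra.
  have h0 : 0 < l^-1 by rewrite invr_gt0.
  nra.
- move=> l l' hl hl'; have l0 : 0 < l by lra. have l'0 : 0 < l' by lra.
  have e := @expR_ge1Dx R (l' - l).
  apply: (@le_trans _ _ (l^-1 ^+ 2 * (l' - l))); last by rewrite ler_wpM2l ?sqr_ge0//; lra.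
  rewrite -subr_ge0.
  have -> : l^-1 ^+ 2 * (l' - l) - (1 - l'^-1 - (1 - l^-1)) = (l' - l) ^+ 2 / (l ^+ 2 * l').
    by field; rewrite !gt_eqF.
  by rewrite divr_ge0 ?sqr_ge0// mulr_ge0 ?sqr_ge0// ltW.
move=> l hl; set dl := ln _ in hl ln0 *.
have l0 : 0 < l by lra. have l'0 : 0 < l - dl by lra.
have i1 : l^-1 <= (l - dl)^-1 by rewrite lef_pV2 ?posrE//; lra.
have i0 : 0 < l^-1 by rewrite invr_gt0.
have d17 : 17^-1 <= dl := ln_1716.
have i2 : 17^-1 * l^-1 ^+ 2 <= (l - dl)^-1 - l^-1.
  have -> : (l - dl)^-1 - l^-1 = dl * (l^-1 * (l - dl)^-1) by field; rewrite !gt_eqF.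
  apply: ler_pM => //; rewrite ?invr_ge0 ?sqr_ge0//.
  by rewrite expr2 ler_pM2l.
have i3 : l^-1 ^+ 2 <= (l - dl)^-1 ^+ 2.
  by apply: lerXn2r => //; rewrite nnegrE; apply: ltW; rewrite ?invr_gt0.
have i4 : (1 - l^-1 - l^-1 ^+ 2) / (25 * l ^+ 2) <= 25^-1 * l^-1 ^+ 2.
  have -> : 25^-1 * l^-1 ^+ 2 = 1 / (25 * l ^+ 2) by field; rewrite gt_eqF.
  rewrite ler_pM2r ?invr_gt0 ?mulr_gt0 ?exprn_gt0//.
  have := sqr_ge0 (l^-1); lra.
have := sqr_ge0 (l^-1); lra.
Qed.

(** The profile of the modulus t (log(1/t))^(N+1). *)
Definition log_G (N : nat) l : R := l ^+ N.+1.
Definition log_G' (N : nat) l : R := N.+1%:R * l ^+ N.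

(** The tangent condition is Bernoulli's inequality for the exponent (N+1)/l
    <= 1. *)
Lemma log_G_profile N lr : 2 * N.+1%:R <= lr -> log_profile (log_G N) (log_G' N) lr.
Proof.
move=> lrN; have ln0 : 0 < ln (17 / 16 : R) by rewrite (lt_le_trans _ ln_1716)// invr_gt0.
have N1 : 1 <= N.+1%:R :> R by rewrite ler1n.
have HE l : log_G N l - log_G' N l = l ^+ N * (l - N.+1%:R) by rewrite /log_G /log_G' exprS; ring.
split.
- lra.
- by move=> l hl; rewrite /log_G' mulr_ge0// exprn_ge0//; lra.
- by move=> l hl; rewrite HE mulr_gt0 ?exprn_gt0//; lra.
- move=> l l' hl hl'; have l0 : 0 < l by lra. have l'0 : 0 < l' by lra.
  set v := l' - l; pose c := N.+1%:R / l.
  have c0 : 0 <= c by rewrite /c divr_ge0// ltW.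
  have c1 : c <= 1 by rewrite /c ler_pdivrMr//; lra.
  have b := bernoulli_le1 (ltW (expR_gt0 v)) c0 c1.
  have e1 : l' / l <= expR (v / l).
    have -> : l' / l = 1 + v / l by rewrite /v; field; rewrite gt_eqF.
    exact: expR_ge1Dx.
  have e2 : (l' / l) ^+ N.+1 <= expR v `^ c.
    have -> : expR v `^ c = expR (v / l) ^+ N.+1.
      rewrite /powR gt_eqF ?expR_gt0// expRK -expRM_natl; congr expR; rewrite /c.
      by field; rewrite gt_eqF.
    by rewrite ler_pXn2r ?nnegrE ?expR_ge0// divr_ge0// ltW.
  have := le_trans e2 b; rewrite expr_div_n ler_pdivrMr ?exprn_gt0// /log_G /log_G'.
  have -> : (1 + c * (expR v - 1)) * l ^+ N.+1 = l ^+ N.+1 + N.+1%:R * l ^+ N * (expR v - 1).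
    by rewrite /c exprS; field; rewrite gt_eqF.
  lra.
move=> l hl; set dl := ln _ in hl ln0 *; rewrite !HE.
have l0 : 0 < l by lra.
have d17 : 17^-1 <= dl := ln_1716.
have lN : 0 < l ^+ N by rewrite exprn_gt0.
have h1 : (l - dl) ^+ N * (l - dl - N.+1%:R) <= l ^+ N * (l - dl - N.+1%:R).
  rewrite ler_wpM2r//; first lra.
  by apply: lerXn2r; rewrite ?nnegrE; lra.
have h2 : l ^+ N * (l - N.+1%:R) / (25 * l ^+ 2) <= l ^+ N * 25^-1.
  rewrite -mulrA ler_pM2l// ler_pdivrMr ?mulr_gt0 ?exprn_gt0//.
  have -> : 25^-1 * (25 * l ^+ 2) = l * l by field.
  have : l <= l * l by rewrite ler_peMl//; lra.
  lra.
have h3 : l ^+ N * 25^-1 <= l ^+ N * dl by rewrite ler_pM2l//; lra.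
lra.
Qed.

(** Errors that are powers of |a| = exp (- l) absorb any power of l. *)
Lemma pow_exp_decay (b : R) (k : nat) : 0 < b ->
  exists2 C, 0 < C & forall l, 0 <= l -> expR (- (b * l)) * l ^+ k <= C.
Proof.
move=> b0; case: k => [|k].
  exists 1 => [//|l l0]; rewrite expr0 mulr1 -[leRHS]expR0 ler_expR oppr_le0.
  by rewrite mulr_ge0// ltW.
have kb : 0 < k.+1%:R / b by rewrite divr_gt0.
exists ((k.+1%:R / b) ^+ k.+1); first exact: exprn_gt0.
move=> l l0.
have kN : k.+1%:R != 0 :> R by rewrite pnatr_eq0.
have bN : b != 0 by rewrite gt_eqF.
have gen (K : R) : K != 0 -> K / b * (b * l / K) = l /\ K * (b * l / K) = b * l.
  by move=> KN; split; field; rewrite ?KN ?bN.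
have [g1 g2] := gen _ kN.
have h : l <= k.+1%:R / b * expR (b * l / k.+1%:R).
  rewrite -[leLHS]g1 ler_pM2l//; apply: le_trans (expR_ge1Dx _); by rewrite lerDr.
have : l ^+ k.+1 <= (k.+1%:R / b) ^+ k.+1 * expR (b * l).
  apply: (@le_trans _ _ ((k.+1%:R / b * expR (b * l / k.+1%:R)) ^+ k.+1)).
    by rewrite ler_pXn2r ?nnegrE// mulr_ge0 ?expR_ge0// ltW.
  by rewrite exprMn -expRM_natl g2.
by move=> h2; rewrite expRN mulrC ler_pdivrMr ?expR_gt0.
Qed.

End modulus.

Section modulus_continuity.
Context {R : realType}.
Implicit Types (t l : R).

Lemma ln_expR_le t lr : 0 < t -> t <= expR (- lr) -> lr <= - ln t.
Proof. by move=> t0 tr; rewrite lerNr -(expRK (- lr)) ler_ln ?posrE// expR_gt0. Qed.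

Lemma phi_of_sqrt (G : R -> R) lr C : 0 <= C ->
  (forall l, lr <= l -> `|G l| <= C * expR (l / 2)) ->
  forall t, 0 <= t -> `|phi_of G lr t| <= C * Num.sqrt t.
Proof.
move=> C0 hG t t0; have [->|tN0] := eqVneq t 0.
  by rewrite /phi_of min_l ?expR_ge0// mul0r normr0 mulr_ge0 ?sqrtr_ge0.
have tp : 0 < t by rewrite lt_neqAle eq_sym tN0.
rewrite /phi_of; set t' := Num.min t _.
have t'0 : 0 < t' by rewrite lt_min tp expR_gt0.
have t'r : t' <= expR (- lr) by rewrite ge_min lexx orbT.
have t't : t' <= t by rewrite ge_min lexx.
have s0 : 0 < Num.sqrt t' by rewrite sqrtr_gt0.
have e : expR (- ln t' / 2) = (Num.sqrt t')^-1.
  rewrite mulNr expRN; congr (_^-1).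
  by rewrite -(powR12_sqrt (ltW t'0)) /powR gt_eqF// mulrC.
have := hG _ (ln_expR_le t'0 t'r); rewrite e => h.
rewrite normrM (gtr0_norm t'0).
apply: (@le_trans _ _ (t' * (C / Num.sqrt t'))); first by rewrite ler_wpM2l// ltW.
have -> : t' * (C / Num.sqrt t') = C * Num.sqrt t'.
  by rewrite -{1}(sqr_sqrtr (ltW t'0)); field; rewrite gt_eqF.
by rewrite ler_wpM2l// ler_wsqrtr.
Qed.

Lemma phi_of_continuous n (G : R -> R) lr C : 0 <= C ->
  (forall l, lr <= l -> {for l, continuous G}) ->
  (forall l, lr <= l -> `|G l| <= C * expR (l / 2)) ->
  forall x : 'rV[R]_n, {for x, continuous (fun z : 'rV[R]_n => phi_of G lr (enorm z))}.
Proof.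
move=> C0 cG hG x; have [->|x0] := eqVneq x 0.
  have h := phi_of_sqrt C0 hG.
  move=> A /nbhs_ballP[e /= e0 he]; apply/nbhs_eball.
  have C1 : 0 < C + 1 by rewrite ltr_pwDr.
  exists ((e / (C + 1)) ^+ 2); first by rewrite exprn_gt0// divr_gt0.
  move=> y; rewrite /eball /= subr0 => hy; apply: he; rewrite /ball /=.
  rewrite enorm0 {1}/phi_of min_l ?expR_ge0// mul0r sub0r normrN.
  apply: (le_lt_trans (h _ (enorm_ge0 y))).
  have : Num.sqrt (enorm y) < e / (C + 1).
    rewrite -(ger0_norm (_ : 0 <= e / (C + 1))) ?divr_ge0 ?ltW//.
    by rewrite -sqrtr_sqr ltr_sqrt// exprn_gt0// divr_gt0.
  rewrite ltr_pdivlMr//; have := sqrtr_ge0 (enorm y); nra.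
have xp : 0 < enorm x by rewrite enorm_gt0.
pose t' := Num.min (enorm x) (expR (- lr)).
have t'0 : 0 < t' by rewrite lt_min xp expR_gt0.
have t'r : t' <= expR (- lr) by rewrite ge_min lexx orbT.
have cmin : {for x, continuous (fun z : 'rV[R]_n => Num.min (enorm z) (expR (- lr)))}.
  by apply: (@continuous_min R _ (@enorm R 1 n) (fun=> expR (- lr))); [exact: enorm_continuous|exact: cts_cst].
have cln : {for x, continuous (fun z : 'rV[R]_n => ln (Num.min (enorm z) (expR (- lr))))}.
  exact: (@continuous_comp _ _ _ _ (@ln R) x cmin (continuous_ln t'0)).
have cN : {for x, continuous (fun z : 'rV[R]_n => - ln (Num.min (enorm z) (expR (- lr))))}.
  exact: (cvgN cln).
apply: cts_mul; first exact: cmin.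
exact: (@continuous_comp _ _ _ _ G x cN (cG _ (ln_expR_le t'0 t'r))).
Qed.

Lemma lip_G_bounds l : 4 <= l -> 2^-1 <= @lip_G R l - lip_G' l /\ @lip_G R l - lip_G' l <= 1.
Proof.
move=> l4; have l0 : 0 < l by lra.
have h : l^-1 <= 4^-1 by rewrite lef_pV2 ?posrE//; lra.
have h0 : 0 < l^-1 by rewrite invr_gt0.
rewrite /lip_G /lip_G'; split; nra.
Qed.

Lemma lip_G_le1 l : 4 <= l -> 2^-1 <= @lip_G R l /\ @lip_G R l <= 1.
Proof.
move=> l4; have l0 : 0 < l by lra.
have h : l^-1 <= 4^-1 by rewrite lef_pV2 ?posrE//; lra.
have h0 : 0 < l^-1 by rewrite invr_gt0.
rewrite /lip_G; split; lra.
Qed.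

Lemma lip_G_continuous l : 4 <= l -> {for l, continuous (@lip_G R)}.
Proof.
move=> l4; apply: (@cvgB R); first exact: cvg_cst.
by apply: cvgV; [rewrite gt_eqF//; lra|exact: cvg_id].
Qed.

Lemma lip_G_exp l : 4 <= l -> `|@lip_G R l| <= 1 * expR (l / 2).
Proof.
move=> l4; have [h1 h2] := lip_G_le1 l4; rewrite ger0_norm ?mul1r; last lra.
apply: (le_trans h2); apply: le_trans (expR_ge1Dx _); lra.
Qed.

Lemma log_G_bounds N l : 2 * N.+1%:R <= l ->
  2^-1 * l ^+ N.+1 <= @log_G R N l - log_G' N l /\ @log_G R N l - log_G' N l <= l ^+ N.+1.
Proof.
move=> lN; have N1 : 1 <= N.+1%:R :> R by rewrite ler1n.
have lp : 0 <= l ^+ N by rewrite exprn_ge0//; lra.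
rewrite /log_G /log_G' exprS; split; last by rewrite gerBl mulr_ge0.
have : N.+1%:R * l ^+ N <= l / 2 * l ^+ N by rewrite ler_wpM2r//; lra.
lra.
Qed.

Lemma log_G_continuous N l : {for l, continuous (@log_G R N)}.
Proof. exact: exprn_continuous. Qed.

Lemma log_G_exp N : exists2 C, 0 <= C & forall l, 0 <= l -> `|@log_G R N l| <= C * expR (l / 2).
Proof.
have h2 : 0 < (2^-1 : R) by rewrite invr_gt0.
have [C C0 h] := pow_exp_decay N.+1 h2.
exists C; first exact: ltW.
move=> l l0; rewrite ger0_norm ?exprn_ge0//.
have := h l l0; rewrite expRN mulrC ler_pdivrMr ?expR_gt0//.
by rewrite [2^-1 * l]mulrC.
Qed.

End modulus_continuity.

(** * The contradiction scheme and the far integral *)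

Section log_lipschitz.
Context {R : realType} {n : nat}.
Local Notation L := (lebesgue_rV R n).
Local Notation msb := (@measurableR _ L R).
Local Notation intg := (@integrableR _ L R (leb n)).
Local Notation Ig := (@integralR _ L R (leb n)).
Implicit Types (lam Lam q r rho tau mu P d Lc m nu Rb F : R) (u K f : 'rV[R]_n -> R) (a b x y z w : 'rV[R]_n).

(** The penalization keeps x within 1/16 of x0, because u oscillates by at
    most 2. *)
Definition pen : R := 2 * 16 ^+ 2.

Lemma expRN_small lr : 32 <= lr -> expR (- lr) <= 32^-1 :> R.
Proof.
move=> h; rewrite expRN lef_pV2 ?posrE ?expR_gt0//.
by apply: le_trans (expR_ge1Dx _); move: h; clear; lra.
Qed.

(** The part of the contradiction argument common to both estimates: if the
    estimate fails, the doubled function has an interior positive maximum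
    whose two points are close. *)
Lemma doubling_argument u (G G' : R -> R) lr C Lc Rb x0 y0 :
  log_profile G G' lr -> 32 <= lr -> 0 <= C ->
  (forall l, lr <= l -> {for l, continuous G}) ->
  (forall l, lr <= l -> `|G l| <= C * expR (l / 2)) ->
  (forall l, lr <= l -> 0 <= G l) ->
  (forall x, enorm x < 2 -> {for x, continuous u}) ->
  (forall x, enorm x < 2 -> `|u x| <= 1) ->
  Rb < 2 -> enorm x0 + 4^-1 <= Rb -> enorm y0 <= Rb -> 0 < Lc ->
  2 <= Lc * (expR (- lr) * G lr) ->
  (forall xb yb, let al := enorm (xb - yb) in 0 < al -> al < expR (- lr) ->
     enorm (xb - x0) <= 16^-1 -> enorm xb + 8^-1 <= Rb -> enorm yb + 16^-1 <= Rb ->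
     (forall x y, enorm x <= Rb -> enorm y <= Rb ->
        Phi u (phi_of G lr) Lc pen x0 x y <= Phi u (phi_of G lr) Lc pen x0 xb yb) ->
     0 < Phi u (phi_of G lr) Lc pen x0 xb yb -> False) ->
  u x0 - u y0 <= Lc * phi_of G lr (enorm (x0 - y0)).
Proof.
move=> lp lr32 C0 cG hG G0 cu bu Rb2 x0R y0R Lc0 Lcb contra.
rewrite leNgt; apply/negP => hlt.
have x0R' : enorm x0 <= Rb by move: x0R; clear; lra.
have cphi := phi_of_continuous (n := n) C0 cG hG.
have [xb [yb [xbR ybR cmax]]] := doubling_max Lc pen cu cphi Rb2 x0R'.
have pen0 : 0 < pen by rewrite /pen mulr_gt0// exprn_gt0.
have pos : 0 < Phi u (phi_of G lr) Lc pen x0 xb yb.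
  apply: lt_le_trans (cmax x0 y0 x0R' y0R).
  by rewrite /Phi subrr enorm0 expr0n mulr0 subr0 subr_gt0.
have a0 := contact_neq (phi_of0 G lr) pen0 pos.
set al := enorm (xb - yb).
have al0 : 0 < al by rewrite enorm_gt0.
have u2 : u xb - u yb <= 2.
  have := bu _ (le_lt_trans xbR Rb2); have := bu _ (le_lt_trans ybR Rb2).
  by rewrite !ler_norml => /andP[? ?] /andP[? ?]; lra.
have phi0 : 0 <= phi_of G lr al.
  case: (lerP al (expR (- lr))) => h.
    rewrite phi_of_small// mulr_ge0 ?(ltW al0)// G0// ln_expR_le//.
  rewrite phi_of_large ?(ltW h)// phi_of_small// mulr_ge0 ?expR_ge0// G0//.
  by rewrite expRK opprK.
have alr : al < expR (- lr).
  rewrite ltNge; apply/negP => h.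
  have : phi_of G lr al = expR (- lr) * G lr.
    by rewrite phi_of_large// phi_of_small// expRK opprK.
  move=> e; move: pos; rewrite /Phi -/al e.
  have : 0 <= pen * enorm (xb - x0) ^+ 2 by rewrite mulr_ge0 ?sqr_ge0// ltW.
  by move: u2 Lcb; clear; lra.
have xnu : enorm (xb - x0) <= 16^-1.
  rewrite leNgt; apply/negP => h.
  have : 16^-1 ^+ 2 < enorm (xb - x0) ^+ 2.
    by rewrite ltr_pXn2r ?nnegrE ?enorm_ge0.
  move=> h2; have : pen * 16^-1 ^+ 2 < pen * enorm (xb - x0) ^+ 2 by rewrite ltr_pM2l.
  have -> : pen * 16^-1 ^+ 2 = 2 by rewrite /pen; field.
  have : 0 <= Lc * phi_of G lr al by rewrite mulr_ge0// ltW.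
  by move: pos u2; rewrite /Phi -/al; clear; lra.
have al32 : al <= 32^-1 := le_trans (ltW alr) (expRN_small lr32).
have xbx : enorm xb <= enorm x0 + 16^-1.
  by have := enormD (xb - x0) x0; rewrite subrK; move: xnu; clear; lra.
apply: (contra xb yb) => //.
  by move: xbx x0R; clear; lra.
have : enorm yb <= enorm xb + al.
  by have := enormD xb (- (xb - yb)); rewrite opprB addrC subrK enormBC -/al.
by move: xbx x0R al32; clear; lra.
Qed.

Definition far_cst Lam q rho W : R := Lam * (4 / rho) `^ (q + n%:R) * 2 `^ q * 2 * W.

Lemma far_bound lam Lam q K u x rho W : 0 <= lam -> 0 <= Lam -> 0 < q ->
  kern lam Lam q K -> msb u -> intg (wt q u) -> Ig (wt q u) <= W ->
  enorm x <= 2 -> `|u x| <= 1 -> 0 < rho -> rho <= 1 ->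
  intg (fun z => J q (u x - u (x + z)) * ((1 - chi rho z) * K z)) /\
  Ig (fun z => `|J q (u x - u (x + z)) * ((1 - chi rho z) * K z)|) <= far_cst Lam q rho W.
Proof.
move=> l0 L0 q0 kK mu iw bw x2 u1 r0 r1.
have [iw' ew] := Ig_shift x iw.
have u1q : `|u x| `^ q <= 1.
  apply: (@le_trans _ _ (1 `^ q)); last by rewrite powR1.
  exact (powR_mono (ltW q0) (normr_ge0 _) u1).
pose c := Lam * (4 / rho) `^ (q + n%:R) * 2 `^ q * 2.
have c0 : 0 <= c by rewrite !mulr_ge0 ?powR_ge0.
have cle : Lam * (4 / rho) `^ (q + n%:R) * 2 `^ q * (1 + `|u x| `^ q) <= c.
  rewrite /c; apply: ler_wpM2l; first by rewrite !mulr_ge0 ?powR_ge0.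
  by move: u1q; clear; lra.
have ib := intgZ c iw'.
have [mK _ _] := kK.
have mf : msb (fun z => J q (u x - u (x + z)) * ((1 - chi rho z) * K z)).
  apply: msbM; first by apply: msb_J; apply: msbB; [exact: msb_cst|exact: msb_shift].
  apply: msbM; last exact mK.
  apply: msbB; [exact: msb_cst|exact: msb_chi].
have le z : `|J q (u x - u (x + z)) * ((1 - chi rho z) * K z)| <= c * wt q u (x + z).
  have c1 := chi_ge0 rho z; have c2 := chi_le1 rho z.
  have cc : 0 <= 1 - chi rho z by rewrite subr_ge0.
  have t := tail_integrand_le u z l0 L0 q0 kK x2 r0 r1.
  apply: (@le_trans _ _ `|(rho <= enorm z)%R%:R * (J q (u x - u (x + z)) * K z)|).
    case: (leP rho (enorm z)) => h.
      move: (J q _) (K z) => j k; rewrite mul1r mulrCA (normrM (1 - chi rho z)) (ger0_norm cc).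
      by apply: ler_piMl; [exact: normr_ge0|rewrite gerBl].
    by rewrite (chi_in r0 (ltW h)) subrr mul0r mulr0 normr0; exact: normr_ge0.
  exact (le_trans t (ler_wpM2r (wt_ge0 q u (x + z)) cle)).
have i1 : intg (fun z => J q (u x - u (x + z)) * ((1 - chi rho z) * K z)) := intg_le mf le ib.
split; first exact i1.
apply: (le_trans (Ig_le (intg_norm i1) ib le)).
by rewrite (IgZ c iw') ew /far_cst -/c; exact: (ler_wpM2l c0 bw).
Qed.

(** The crude bound, without regularity of the kernel. *)
Lemma far_difference_bound lam Lam q K u x y rho W : 0 <= lam -> 0 <= Lam -> 0 < q ->
  kern lam Lam q K -> msb u -> intg (wt q u) -> Ig (wt q u) <= W ->
  enorm x <= 2 -> `|u x| <= 1 -> enorm y <= 2 -> `|u y| <= 1 -> 0 < rho -> rho <= 1 ->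
  - (2 * far_cst Lam q rho W) <= Ig (fun z => (J q (u x - u (x + z)) - J q (u y - u (y + z))) *
                      ((1 - chi rho z) * K z)).
Proof.
move=> l0 L0 q0 kK mu iw bw x2 u1 y2 v1 r0 r1.
have [i1 b1] := far_bound l0 L0 q0 kK mu iw bw x2 u1 r0 r1.
have [i2 b2] := far_bound l0 L0 q0 kK mu iw bw y2 v1 r0 r1.
rewrite (_ : (fun z => _) = fun z => J q (u x - u (x + z)) * ((1 - chi rho z) * K z) -
  J q (u y - u (y + z)) * ((1 - chi rho z) * K z)); last first.
  by apply/funext => z; rewrite mulrBl.
rewrite (IgB i1 i2).
have := le_trans (Ig_norm i1) b1; have := le_trans (Ig_norm i2) b2.
rewrite !ler_norml => /andP[_ h2] /andP[h1 _]; move: h1 h2; clear; lra.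
Qed.

End log_lipschitz.

(** * Log-Lipschitz estimate for normalized solutions *)

Section log_lipschitz_main.
Context {R : realType} {n : nat}.
Local Notation L := (lebesgue_rV R n).
Local Notation msb := (@measurableR _ L R).
Local Notation intg := (@integrableR _ L R (leb n)).
Local Notation Ig := (@integralR _ L R (leb n)).
Implicit Types (lam Lam q r rho tau mu P d Lc m nu Rb F : R) (u K f : 'rV[R]_n -> R) (a b x y z w : 'rV[R]_n).

(** All data are bounded by the parameters; that -u is a subsolution expresses
    the supersolution property of u. *)
Record norm_sol (lam Lam q W : R) (K f1 f2 u : 'rV[R]_n -> R) : Prop := NormSol {
  ns_kern : kern lam Lam q K;
  ns_msb : msb u;
  ns_intg : intg (wt q u);
  ns_W : Ig (wt q u) <= W;
  ns_cont : forall x, enorm x < 2 -> {for x, continuous u};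
  ns_le1 : forall x, enorm x < 2 -> `|u x| <= 1;
  ns_sub : parab_ineq Lam q K f1 u;
  ns_sup : parab_ineq Lam q K f2 (fun x => - u x)
}.

Lemma gain_cst_gt0 lam q : (1 <= n)%N -> 0 < lam -> 0 < q -> 0 < @gain_cst R n lam q.
Proof.
move=> n1 l0 q0; rewrite /gain_cst mulr_gt0 ?exprn_gt0 ?divr_gt0 ?ltr0n//.
by rewrite !mulr_gt0 ?kap_gt0 ?powR_gt0.
Qed.

Lemma err_cst_ge0 Lam q : 0 < q -> 0 <= Lam -> 0 <= err_cst Lam q.
Proof. by move=> q0 L0; rewrite /err_cst !mulr_ge0 ?powR_ge0// addr_ge0// ltW. Qed.

Lemma far_cst_ge0 Lam q rho W : 0 <= Lam -> 0 <= W -> 0 <= @far_cst R n Lam q rho W.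
Proof. by move=> L0 W0; rewrite /far_cst !mulr_ge0 ?powR_ge0. Qed.

(** The gain is of order l^(-n-2), the errors of order l^(-n-3). *)
Lemma gain_beats_errors (c0 C Pq l : R) : 0 < c0 -> 0 < Pq -> 1 <= l ->
  C * 40 ^+ n.+2 / c0 < l ->
  c0 * (Pq * (40 * l)^-1 ^+ n.+2) * l ^+ n.+3 <= C * Pq -> False.
Proof.
move=> c00 P0 l1 hl h.
have l0 : 0 < l := lt_le_trans ltr01 l1.
have e : c0 * (Pq * (40 * l)^-1 ^+ n.+2) * l ^+ n.+3 = c0 * l / 40 ^+ n.+2 * Pq.
  have ln0 : l ^+ n.+2 != 0 by rewrite expf_neq0// gt_eqF.
  rewrite exprVn exprMn (exprS l n.+2).
  move: (l ^+ n.+2) ln0 => X X0.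
  have : (40 : R) ^+ n.+2 != 0 by rewrite expf_neq0// pnatr_eq0.
  move: ((40 : R) ^+ n.+2) => Y Y0; field; by rewrite X0 Y0.
move: h; rewrite e ler_pM2r// ler_pdivrMr ?exprn_gt0// => h.
by move: hl; rewrite ltr_pdivrMr// ltNge => /negP; apply; rewrite mulrC.
Qed.

(** With G = l^(N+1) the slope satisfies P >= l^(N+1), so P^q / P^(q-kap) =
    P^kap exceeds l^(n+4) as soon as (N+1) kap >= n + 4; bounded right-hand
    sides, the crude far bound and a fixed radius rho are then all
    negligible against the gain. *)
Lemma log_lipschitz_norm q : (1 <= n)%N -> 0 < q ->
  exists N : nat, forall lam Lam W c1 : R, 0 < lam -> lam <= Lam -> 0 <= W -> 0 <= c1 ->
  exists2 C : R, 0 <= C & forall K u, norm_sol lam Lam q W K (fun=> c1) (fun=> c1) u ->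
    forall x y, enorm x <= 3 / 2 -> enorm y <= 7 / 4 ->
      u x - u y <= C * (enorm (x - y) * (1 + `|ln (enorm (x - y))| ^+ N)).
Proof.
move=> n1 q0; have k0 := kap_gt0 q0; have kq := kap_le q; have k1 := kap_le1 q.
(* N + 1 exceeds (n+4) / kap, so that P^kap dominates l^(n+4). *)
pose N := Num.truncn ((n.+4)%:R / kap q).
have N4 : n.+4%:R <= N.+1%:R * kap q.
  by rewrite -ler_pdivrMr// ltW//; exact: truncnS_gt.
have N4' : n.+4%:R <= N.+1%:R :> R.
  by apply: (le_trans N4); rewrite ler_piMr.
have N3 : (3 <= N.+1)%N by rewrite -(ler_nat R); apply: le_trans N4'; rewrite ler_nat.
exists N.+1 => lam Lam W c1 l0 lL W0 c10.
have l0' := ltW l0; have L0 : 0 <= Lam := le_trans l0' lL.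
pose rho : R := 32^-1; pose nu : R := 16^-1.
pose mu : R := 2 * pen * (nu + rho).
have pen0 : 0 < pen :> R by rewrite /pen mulr_gt0// exprn_gt0.
have rho0 : 0 < rho by rewrite invr_gt0.
have nu0 : 0 < nu by rewrite invr_gt0.
have mu0 : 0 <= mu by rewrite !mulr_ge0 ?addr_ge0// ltW.
pose c0 := @gain_cst R n lam q.
have c00 : 0 < c0 := gain_cst_gt0 n1 l0 q0.
have [D D0 decay] := @pow_exp_decay R (kap q) n.+3 k0.
pose F := 2 * @far_cst R n Lam q rho W.
have F0 : 0 <= F by rewrite mulr_ge0// far_cst_ge0.
pose nc := 2 * @near_cst R n q Lam * 5 `^ (q - kap q).
have nc0 : 0 <= nc.
  by apply: mulr_ge0; [apply: mulr_ge0; [by []|exact: near_cst_ge0]|exact: powR_ge0].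
pose ec := err_cst Lam q * mu `^ kap q * 4 ^+ n.
have ec0 : 0 <= ec.
  by rewrite /ec mulr_ge0 ?exprn_ge0// mulr_ge0 ?powR_ge0// err_cst_ge0.
pose Ct := (c1 + c1 + F) + nc * D + ec * 5.
have [lr [lr32 lrN lrmu lrC]] : exists lr : R, [/\ 32 <= lr, 2 * N.+1%:R <= lr,
    mu * 40 ^+ 2 <= lr & Ct * 40 ^+ n.+2 / c0 < lr].
  have A1 : 0 <= 2 * N.+1%:R :> R by rewrite mulr_ge0.
  have A2 : 0 <= mu * 40 ^+ 2 by rewrite mulr_ge0 ?sqr_ge0.
  have A3 := ler_norm (Ct * 40 ^+ n.+2 / c0).
  have A4 := normr_ge0 (Ct * 40 ^+ n.+2 / c0).
  exists (32 + 2 * N.+1%:R + mu * 40 ^+ 2 + `|Ct * 40 ^+ n.+2 / c0|).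
  move: A1 A2 A3 A4; move: (2 * N.+1%:R) (mu * 40 ^+ 2) (Ct * 40 ^+ n.+2 / c0) => X Y Z.
  by clear; split; lra.
have lr1 : 1 <= lr by apply: le_trans lr32; rewrite ler1n.
have lp := log_G_profile lrN.
have [CG CG0 hCG] := @log_G_exp R N.
pose rr := expR (- lr).
have rr0 : 0 < rr by exact: expR_gt0.
pose Lc := 2 / rr.
have Lc0 : 0 < Lc by rewrite divr_gt0.
have Lc2 : 2 <= Lc.
  by rewrite /Lc ler_pdivlMr// ler_piMr// -[leRHS]expR0 ler_expR oppr_le0; exact: le_trans lr1.
exists (Lc * lr ^+ N.+1); first by rewrite mulr_ge0 ?exprn_ge0 ?(ltW Lc0)//; exact: le_trans lr1.
move=> K u [kK mu_ iw bw cu bu v1 v2] x y hx hy.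
have key : u x - u y <= Lc * phi_of (@log_G R N) lr (enorm (x - y)).
  apply: (doubling_argument (Rb := 7 / 4) lp lr32 CG0 _ _ _ cu bu _ _ hy Lc0).
  - by move=> l _; exact: log_G_continuous.
  - by move=> l hl; apply: hCG; apply: le_trans hl; exact: le_trans lr1.
  - by move=> l hl; rewrite exprn_ge0//; apply: le_trans hl; exact: le_trans lr1.
  - by clear; lra.
  - by move: hx; clear; lra.
  - rewrite mulrA /Lc divfK ?gt_eqF// ler_peMr// exprn_ege1//.
  move=> xb yb al al0 alr xbnu xbR ybR cmax pos.
  pose l := - ln al.
  have lrl : lr <= l by apply: ln_expR_le => //; exact: ltW.
  have l1 : 1 <= l := le_trans lr1 lrl.
  have lp0 : 0 < l := lt_le_trans ltr01 l1.
  pose d := @log_G R N l - log_G' N l.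
  have [d1 d2] := log_G_bounds (le_trans lrN lrl).
  pose P := Lc * d.
  have lN0 : 0 < l ^+ N.+1 by rewrite exprn_gt0.
  have PN : l ^+ N.+1 <= P.
    apply: (@le_trans _ _ (2 * (2^-1 * l ^+ N.+1))); first by rewrite mulrA divff ?mul1r// pnatr_eq0.
    apply: ler_pM => //; by rewrite mulr_ge0// ?invr_ge0// ltW.
  have P1 : 1 <= P by apply: le_trans PN; exact: exprn_ege1.
  have P0 : 0 < P := lt_le_trans ltr01 P1.
  have d0 : 0 < d by move: P0; rewrite /P pmulr_rgt0.
  have al32 : al <= 32^-1 := le_trans (ltW alr) (expRN_small lr32).
  pose tau := (40 * l)^-1.
  have tau0 : 0 < tau by rewrite invr_gt0 mulr_gt0.
  have tau8 : tau <= 8^-1.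
    rewrite lef_pV2 ?posrE ?mulr_gt0//; by move: l1; clear; lra.
  have muP : mu <= P * tau ^+ 2.
    rewrite /tau exprVn ler_pdivlMr ?exprn_gt0 ?mulr_gt0// exprMn mulrA.
    apply: (@le_trans _ _ (l * l ^+ 2)).
      by rewrite ler_pM2r ?exprn_gt0//; exact: le_trans lrmu lrl.
    rewrite -exprS; apply: le_trans PN; exact: ler_weXn2l.
  have xb2 : enorm xb < 2 by move: xbR; clear; lra.
  have yb2 : enorm yb < 2 by move: ybR; clear; lra.
  have r1 : rho <= 1 by rewrite /rho invf_le1// ler1n.
  have hF := far_difference_bound l0' L0 q0 kK mu_ iw bw (ltW xb2) (bu _ xb2) (ltW yb2) (bu _ yb2) rho0 r1.
  have conc := phi_concave_at lp al0 alr.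
  have R74 : 7 / 4 < 2 :> R by clear; lra.
  have xbR' : enorm xb + 2 * rho <= 7 / 4 by move: xbR; rewrite /rho; clear; lra.
  have ybR' : enorm yb + 2 * rho <= 7 / 4 by move: ybR; rewrite /rho; clear; lra.
  have al16 : al <= 16^-1 by move: al32; clear; lra.
  have rho2 : rho <= 2^-1 by rewrite /rho; clear; lra.
  have main := contact_inequality n1 l0' L0 q0 kK mu_ iw v1 v2 R74 (phi_of0 (@log_G R N) lr) Lc0 d0 pen0
    cmax pos xbR' ybR' xbnu tau0 tau8 al16 al32 rho2 (erefl mu) muP conc hF.
  have Pq0 : 0 < P `^ q by rewrite powR_gt0.
  have Pk : l ^+ n.+4 <= P `^ kap q.
    have : l ^+ n.+4 <= (l ^+ N.+1) `^ kap q.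
      rewrite -(powR_mulrn _ (ltW lp0)) -(powR_mulrn _ (ltW lp0)) -powRrM.
      exact: ler_powR.
    move/le_trans; apply; apply: powR_mono => //; exact: ltW.
  have Pkq : P `^ kap q <= P `^ q by apply: ler_powR.
  have l34 : l ^+ n.+3 <= l ^+ n.+4 by apply: ler_weXn2l.
  have ln3 : 0 < l ^+ n.+3 by rewrite exprn_gt0.
  apply: (@gain_beats_errors c0 Ct (P `^ q) l c00 Pq0 l1).
    exact: lt_le_trans lrC lrl.
  have := ler_wpM2r (ltW ln3) main; move/le_trans; apply.
  rewrite -/F -/l -/P -/nc /Ct.
  have T1 : (c1 + c1 + F) * l ^+ n.+3 <= (c1 + c1 + F) * P `^ q.
    rewrite ler_wpM2l ?addr_ge0//; exact: le_trans l34 (le_trans Pk Pkq).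
  have T2 : nc * (P `^ q * al `^ kap q) * l ^+ n.+3 <= nc * D * P `^ q.
    have := decay l (ltW lp0).
    have -> : expR (- (kap q * l)) = al `^ kap q.
      by rewrite /powR gt_eqF// /l; congr expR; ring.
    move=> h; have -> : nc * (P `^ q * al `^ kap q) * l ^+ n.+3 =
      nc * P `^ q * (al `^ kap q * l ^+ n.+3) by ring.
    have -> : nc * D * P `^ q = nc * P `^ q * D by ring.
    by rewrite ler_wpM2l// mulr_ge0// ltW.
  have T3 : err_cst Lam q * (P `^ (q - kap q) * mu `^ kap q) * (4 ^+ n * (1 + 4 * l)) * l ^+ n.+3
      <= ec * 5 * P `^ q.
    have -> : err_cst Lam q * (P `^ (q - kap q) * mu `^ kap q) * (4 ^+ n * (1 + 4 * l)) * l ^+ n.+3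
      = ec * P `^ (q - kap q) * ((1 + 4 * l) * l ^+ n.+3) by rewrite /ec; ring.
    have eP : P `^ q = P `^ (q - kap q) * P `^ kap q by rewrite -powRD_pos// subrK.
    have -> : ec * 5 * P `^ q = ec * P `^ (q - kap q) * (5 * P `^ kap q) by rewrite eP; ring.
    apply: ler_wpM2l; first by rewrite mulr_ge0 ?powR_ge0.
    apply: (@le_trans _ _ (5 * l ^+ n.+4)).
      rewrite (exprS l n.+3) mulrA ler_pM2r//; by move: l1; clear; lra.
    by apply: ler_wpM2l => //; exact: Pk.
  move: T1 T2 T3; clear; lra.
apply: (le_trans key); rewrite -(mulrA Lc) ler_pM2l//.
set t := enorm (x - y); have t0 : 0 <= t := enorm_ge0 _.
have lrN1 : 1 <= lr ^+ N.+1 by exact: exprn_ege1.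
have lnN0 : 0 <= `|ln t| ^+ N.+1 by exact: exprn_ge0.
case: (lerP t rr) => h.
  rewrite phi_of_small// /log_G.
  have [->|tN0] := eqVneq t 0; first by rewrite !mul0r mulr0.
  rewrite (mulrCA (lr ^+ _)) ler_wpM2l//.
  have tp : 0 < t by rewrite lt_neqAle eq_sym tN0.
  have lge : lr <= - ln t := ln_expR_le tp h.
  have -> : `|ln t| = - ln t.
    by rewrite ler0_norm// -oppr_ge0; apply: le_trans lge; exact: le_trans lr1.
  have p0 : 0 <= (- ln t) ^+ N.+1.
    by apply: exprn_ge0; apply: le_trans lge; exact: le_trans lr1.
  apply: (@le_trans _ _ (1 * (1 + (- ln t) ^+ N.+1))); first by rewrite mul1r lerDr.
  by rewrite ler_wpM2r// addr_ge0.
rewrite phi_of_large ?(ltW h)// phi_of_small// /log_G expRK opprK.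
rewrite mulrC; apply: ler_pM; rewrite ?exprn_ge0 ?expR_ge0//; first exact: le_trans lr1.
apply: (le_trans (ltW h)); by rewrite ler_peMr// lerDl.
Qed.

End log_lipschitz_main.

(** * The far integral for Hoelder kernels *)

Section far_difference_holder.
Context {R : realType} {n : nat}.
Local Notation L := (lebesgue_rV R n).
Local Notation msb := (@measurableR _ L R).
Local Notation intg := (@integrableR _ L R (leb n)).
Local Notation Ig := (@integralR _ L R (leb n)).
Implicit Types (lam Lam q r rho tau mu P d Lc m nu Rb F M alpha eta : R) (u K f k : 'rV[R]_n -> R) (a b x y z w : 'rV[R]_n).

Lemma chi_lip rho z z' : 0 < rho -> `|chi rho z - chi rho z'| <= enorm (z - z') / rho.
Proof.
move=> r0; have e : `|enorm z / rho - enorm z' / rho| <= enorm (z - z') / rho.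
  by rewrite -mulrBl normrM (gtr0_norm (_ : 0 < rho^-1)) ?invr_gt0// ler_pM2r ?invr_gt0// enorm_dist.
move: e; rewrite /chi; move: (enorm z / rho) (enorm z' / rho) (enorm (z - z') / rho) => s t c.
rewrite !ler_norml => /andP[h1 h2].
have [m1 [m2 m3]] : [/\ True, Num.min 1 (2 - s) <= 1 & Num.min 1 (2 - t) <= 1] /\
    Num.min 1 (2 - s) - Num.min 1 (2 - t) <= c /\ Num.min 1 (2 - t) - Num.min 1 (2 - s) <= c.
  by case: (lerP 1 (2 - s)) => ?; case: (lerP 1 (2 - t)) => ?; split => //; split; lra.
move: (Num.min 1 (2 - s)) (Num.min 1 (2 - t)) m2 m3 => X Y m2 m3.
by case: (lerP 0 X) => ?; case: (lerP 0 Y) => ?; apply/andP; split; lra.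
Qed.

Lemma powR_neg_diff (N s t : R) : 1 <= N -> 0 < s -> s <= t ->
  `|s `^ (- N) - t `^ (- N)| <= N * ((t - s) / t) * s `^ (- N).
Proof.
move=> N1 s0 st; have t0 := lt_le_trans s0 st.
have h : t `^ (- N) = s `^ (- N) * (s / t) `^ N.
  rewrite (powR_div _ (ltW s0) t0) !powRN; field.
  by rewrite !gt_eqF ?powR_gt0.
have r0 : 0 <= s / t by rewrite divr_ge0// ltW.
have b := bernoulli_ge1 r0 N1.
have sN : 0 <= s `^ (- N) by exact: powR_ge0.
have mono : t `^ (- N) <= s `^ (- N).
  by apply: powR_anti => //; rewrite oppr_le0; apply: le_trans N1.
rewrite ger0_norm ?subr_ge0// h.
have -> : N * ((t - s) / t) = - (N * (s / t - 1)) by field; rewrite gt_eqF.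
move: b sN; move: ((s / t) `^ N) (s `^ (- N)) (N * (s / t - 1)) => X Y Z; clear; nra.
Qed.

Definition far_kernel rho K z : R := (1 - chi rho z) * K z.

Section kernel.
Variables (q rho M alpha Lam : R) (K k : 'rV[R]_n -> R) (x y : 'rV[R]_n).
Hypotheses (n1 : (1 <= n)%N) (q0 : 0 < q) (M0 : 0 <= M) (al0 : 0 < alpha)
  (Kk : forall z, K z = k z * rad (- q - n%:R) z)
  (kM : forall z, `|k z| <= M)
  (kH : forall z z', `|k z - k z'| <= M * enorm (z - z') `^ alpha)
  (r0 : 0 < rho) (r1 : rho <= 1) (x2 : enorm x <= 2) (y2 : enorm y <= 2)
  (ar : enorm (x - y) <= rho / 2).
Let al := enorm (x - y).
Let N := q + n%:R.

(** The difference is a sum of three: k changes by its Hoelder modulus, the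
    cutoff and the power of |z| by |x - y| / rho. *)
Lemma far_kernel_holder w : `|far_kernel rho K (w - x) - far_kernel rho K (w - y)| <=
  (8 / rho) `^ N * (M * (al `^ alpha + (1 + 2 * N) * (al / rho))) * wgt q w.
Proof.
have al_0 : 0 <= al := enorm_ge0 _.
have N1 : 1 <= N.
  have : 1 <= n%:R :> R by rewrite ler1n.
  by rewrite /N; move: q0; lra.
have rhs0 : 0 <= (8 / rho) `^ N * (M * (al `^ alpha + (1 + 2 * N) * (al / rho))) * wgt q w.
  have h1 : 0 <= al `^ alpha := powR_ge0 _ _.
  have h2 : 0 <= al / rho by rewrite divr_ge0// ltW.
  have h3 : 0 <= 1 + 2 * N by move: N1; lra.
  have h4 : 0 <= (1 + 2 * N) * (al / rho) by exact: mulr_ge0.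
  have h5 : 0 <= M * (al `^ alpha + (1 + 2 * N) * (al / rho)) by rewrite mulr_ge0// addr_ge0.
  apply: mulr_ge0; last exact: wgt_ge0.
  by apply: mulr_ge0; first exact: powR_ge0.
set z := w - x; set z' := w - y.
have zz' : enorm (z - z') = al by rewrite /z /z' /al opprB addrC addrA subrK enormBC.
have d1 : `|enorm z - enorm z'| <= al by rewrite -zz' enorm_dist.
have [d2 d3] : enorm z - enorm z' <= al /\ enorm z' - enorm z <= al.
  by move: d1; rewrite ler_norml => /andP[d2 d3]; split; lra.
have [both|nb] := pselect (enorm z < rho /\ enorm z' < rho).
  by rewrite /far_kernel !chi_in ?(ltW both.1) ?(ltW both.2)// subrr !mul0r subrr normr0.
have [hz hz'] : rho / 2 <= enorm z /\ rho / 2 <= enorm z'.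
  have : rho <= enorm z \/ rho <= enorm z'.
    case: (lerP rho (enorm z)) => h1; first by left.
    case: (lerP rho (enorm z')) => h2; first by right.
    by case: nb.
  have arl : al <= rho / 2 := ar.
  by move: d2 d3 arl r0 => {}d2 {}d3 arl r00 [h|h]; split; lra.
have r20 : 0 < rho / 2 by rewrite divr_gt0.
have r21 : rho / 2 <= 1 by move: r0 r1; lra.
have e48 : 4 / (rho / 2) = 8 / rho by field; rewrite gt_eqF.
have w1 : rad (- q - n%:R) z <= (8 / rho) `^ N * wgt q w.
  have := rad_wgt q0 x2 r20 r21 hz; rewrite e48 /z.
  by rewrite [x + _]addrC subrK.
have w2 : rad (- q - n%:R) z' <= (8 / rho) `^ N * wgt q w.
  have := rad_wgt q0 y2 r20 r21 hz'; rewrite e48 /z'.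
  by rewrite [y + _]addrC subrK.
set W := (8 / rho) `^ N * wgt q w in w1 w2 *.
have W0 : 0 <= W by rewrite mulr_ge0 ?powR_ge0 ?wgt_ge0.
have z0 : 0 < enorm z := lt_le_trans r20 hz.
have z'0 : 0 < enorm z' := lt_le_trans r20 hz'.
have alr0 : 0 <= al / rho by rewrite divr_ge0// ltW.
have rdiff : `|rad (- q - n%:R) z - rad (- q - n%:R) z'| <= N * (2 * (al / rho)) * W.
  have eN : - q - n%:R = - N by rewrite /N opprD.
  have N0 : 0 <= N := le_trans ler01 N1.
  have e2 : 2 * (al / rho) = al / (rho / 2) by field; rewrite gt_eqF.
  rewrite e2; move: w1 w2; rewrite /rad eN => w1 w2.
  have gen (s t : R) : 0 < s -> s <= t -> rho / 2 <= t -> t - s <= al -> s `^ (- N) <= W ->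
      `|s `^ (- N) - t `^ (- N)| <= N * (al / (rho / 2)) * W.
    move=> s0 st rt ts sW; apply: (le_trans (powR_neg_diff N1 s0 st)).
    have t0 := lt_le_trans s0 st.
    have ts0 : 0 <= t - s by rewrite subr_ge0.
    have q1 : (t - s) / t <= al / (rho / 2).
      by apply: ler_pM => //; rewrite ?invr_ge0 ?(ltW t0)// lef_pV2.
    apply: ler_pM => //; rewrite ?powR_ge0//.
      by rewrite mulr_ge0// divr_ge0// ltW.
    by rewrite ler_wpM2l.
  case/orP: (le_total (enorm z) (enorm z')) => h; first exact: (gen _ _ z0 h hz' d3 w1).
  rewrite distrC; exact: (gen _ _ z'0 h hz d2 w2).
have cd : `|chi rho z - chi rho z'| <= al / rho by rewrite -zz'; exact: chi_lip.
have kd : `|k z - k z'| <= M * al `^ alpha by rewrite -zz'; exact: kH.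
have c0 := chi_ge0 rho z; have c1 := chi_le1 rho z.
have c0' := chi_ge0 rho z'; have c1' := chi_le1 rho z'.
have -> : far_kernel rho K z - far_kernel rho K z' =
  (1 - chi rho z) * ((k z - k z') * rad (- q - n%:R) z)
  + - (chi rho z - chi rho z') * (k z' * rad (- q - n%:R) z)
  + (1 - chi rho z') * (k z' * (rad (- q - n%:R) z - rad (- q - n%:R) z')).
  rewrite /far_kernel !Kk.
  move: (chi rho z) (chi rho z') (k z) (k z') (rad (- q - n%:R) z) (rad (- q - n%:R) z') => c d e f g h.
  by clear; ring.
have one (s : R) : 0 <= s -> s <= 1 -> `|1 - s| <= 1.
  by move=> s0 s1; rewrite ger0_norm ?subr_ge0// gerBl.
have t1 : `|(1 - chi rho z) * ((k z - k z') * rad (- q - n%:R) z)| <= M * al `^ alpha * W.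
  have nr : `|(k z - k z') * rad (- q - n%:R) z| = `|k z - k z'| * rad (- q - n%:R) z.
    by rewrite (normrM (k z - k z')) (ger0_norm (rad_ge0 _ _)).
  rewrite (normrM (1 - chi rho z)) nr -[leRHS]mul1r.
  apply: ler_pM; first exact: normr_ge0.
  - by apply: mulr_ge0; [exact: normr_ge0|exact: rad_ge0].
  - exact: one.
  - by apply: ler_pM; [exact: normr_ge0|exact: rad_ge0|exact: kd|exact: w1].
have t2 : `|- (chi rho z - chi rho z') * (k z' * rad (- q - n%:R) z)| <= al / rho * (M * W).
  have nr : `|k z' * rad (- q - n%:R) z| = `|k z'| * rad (- q - n%:R) z.
    by rewrite (normrM (k z')) (ger0_norm (rad_ge0 _ _)).
  rewrite (normrM (- (chi rho z - chi rho z'))) normrN nr.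
  apply: ler_pM; first exact: normr_ge0.
  - by apply: mulr_ge0; [exact: normr_ge0|exact: rad_ge0].
  - exact: cd.
  - by apply: ler_pM; [exact: normr_ge0|exact: rad_ge0|exact: kM|exact: w1].
have t3 : `|(1 - chi rho z') * (k z' * (rad (- q - n%:R) z - rad (- q - n%:R) z'))| <=
    M * (N * (2 * (al / rho)) * W).
  rewrite (normrM (1 - chi rho z')) (normrM (k z')) -[leRHS]mul1r.
  apply: ler_pM; first exact: normr_ge0.
  - by apply: mulr_ge0; exact: normr_ge0.
  - exact: one.
  - by apply: ler_pM; [exact: normr_ge0|exact: normr_ge0|exact: kM|exact: rdiff].
apply: (le_trans (ler_normD _ _)); apply: (le_trans (lerD (ler_normD _ _) (lexx _))).
apply: (le_trans (lerD (lerD t1 t2) t3)).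
rewrite le_eqVlt; apply/orP; left; apply/eqP; rewrite /W; ring.
Qed.

End kernel.

Lemma J_increment_growth q (a1 a2 c eta : R) : 0 < q -> `|a1| <= 1 -> `|a2| <= 1 -> `|a1 - a2| <= eta ->
  `|J q (a1 - c) - J q (a2 - c)| <= (2 + q) * (2 `^ q * 2 `^ q) * eta `^ kap q * (1 + `|c| `^ q).
Proof.
move=> q0 h1 h2 he; have k0 := kap_gt0 q0; have kq := kap_le q.
apply: (le_trans (J_holder _ _ q0)).
have -> : a1 - c - (a2 - c) = a1 - a2 by ring.
have c0 : 0 <= 1 + `|c| by rewrite addr_ge0.
have b1 : `|a1 - c| + `|a2 - c| <= 2 * (1 + `|c|).
  by have := ler_normB a1 c; have := ler_normB a2 c; move: h1 h2; clear; lra.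
have b2 : (`|a1 - c| + `|a2 - c|) `^ (q - kap q) <= (2 * (1 + `|c|)) `^ q.
  apply: (@le_trans _ _ ((2 * (1 + `|c|)) `^ (q - kap q))).
    by apply: powR_mono; rewrite ?subr_ge0// addr_ge0.
  apply: ler_powR; last by rewrite gerBl ltW.
  by have := normr_ge0 c; clear; lra.
have b3 : (2 * (1 + `|c|)) `^ q <= 2 `^ q * (2 `^ q * (1 + `|c| `^ q)).
  rewrite powRM// ler_wpM2l ?powR_ge0//.
  by have := powR_add_le q0 (ler01 : 0 <= (1 : R)) (normr_ge0 c); rewrite powR1.
have b4 : `|a1 - a2| `^ kap q <= eta `^ kap q by apply: powR_mono => //; exact: ltW.
have -> : (2 + q) * (2 `^ q * 2 `^ q) * eta `^ kap q * (1 + `|c| `^ q) =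
  (2 + q) * (2 `^ q * (2 `^ q * (1 + `|c| `^ q)) * eta `^ kap q) by ring.
apply: ler_wpM2l; first by rewrite addr_ge0// ltW.
apply: ler_pM; rewrite ?powR_ge0//; exact: le_trans b2 b3.
Qed.

Definition far_holder_cst (Lam q M W : R) : R :=
  ((2 + q) * (2 `^ q * 2 `^ q) * Lam + 2 `^ q * 2 * M * (1 + 2 * (q + n%:R))) * W.

(** After translating both integrals to the common variable w = x + z = y +
    z, the difference only involves J(u(x) - u(w)) - J(u(y) - u(w)) and the
    difference of the translated kernels. *)
Lemma far_difference_holder lam Lam q K k u x y rho W M alpha eta : (1 <= n)%N ->
  0 <= lam -> 0 <= Lam -> 0 < q ->
  kern lam Lam q K -> msb u -> intg (wt q u) -> Ig (wt q u) <= W ->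
  0 <= M -> 0 < alpha -> (forall z, K z = k z * rad (- q - n%:R) z) ->
  (forall z, `|k z| <= M) -> (forall z z', `|k z - k z'| <= M * enorm (z - z') `^ alpha) ->
  enorm x <= 2 -> `|u x| <= 1 -> enorm y <= 2 -> `|u y| <= 1 -> 0 < rho -> rho <= 1 ->
  enorm (x - y) <= rho / 2 -> `|u x - u y| <= eta ->
  - (far_holder_cst Lam q M W * ((8 / rho) `^ (q + n%:R) *
       (eta `^ kap q + (enorm (x - y) `^ alpha + enorm (x - y) / rho))))
  <= Ig (fun z => (J q (u x - u (x + z)) - J q (u y - u (y + z))) * ((1 - chi rho z) * K z)).
Proof.
move=> n1 l0 L0 q0 kK mu iw bw M0 a0 Kk kM kH x2 u1 y2 v1 r0 r1 ar he.
have [i1 _] := far_bound l0 L0 q0 kK mu iw bw x2 u1 r0 r1.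
have [i2 _] := far_bound l0 L0 q0 kK mu iw bw y2 v1 r0 r1.
have -> : (fun z => (J q (u x - u (x + z)) - J q (u y - u (y + z))) * ((1 - chi rho z) * K z)) =
   (fun z => J q (u x - u (x + z)) * ((1 - chi rho z) * K z) -
  J q (u y - u (y + z)) * ((1 - chi rho z) * K z)).
  by apply/funext => z; rewrite mulrBl.
rewrite (IgB i1 i2).
have [j1 e1] := Ig_shift (- x) i1; have [j2 e2] := Ig_shift (- y) i2.
have s1 : (fun z => J q (u x - u (x + (- x + z))) * ((1 - chi rho (- x + z)) * K (- x + z))) =
  (fun w => J q (u x - u w) * far_kernel rho K (w - x)).
  by apply/funext => w; rewrite addNKr /far_kernel (addrC (- x)).
have s2 : (fun z => J q (u y - u (y + (- y + z))) * ((1 - chi rho (- y + z)) * K (- y + z))) =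
  (fun w => J q (u y - u w) * far_kernel rho K (w - y)).
  by apply/funext => w; rewrite addNKr /far_kernel (addrC (- y)).
rewrite s1 in j1 e1; rewrite s2 in j2 e2; rewrite -e1 -e2 -(IgB j1 j2).
set al := enorm (x - y).
have al_0 : 0 <= al := enorm_ge0 _.
have alr0 : 0 <= al / rho by rewrite divr_ge0// ltW.
have eta0 : 0 <= eta := le_trans (normr_ge0 _) he.
pose N := q + n%:R.
have N0 : 0 <= N by rewrite addr_ge0// ltW.
pose E := eta `^ kap q + (al `^ alpha + al / rho).
have E0 : 0 <= E by rewrite !addr_ge0 ?powR_ge0.
have E1 : eta `^ kap q <= E.
  by rewrite /E lerDl addr_ge0// powR_ge0.
have E2 : al `^ alpha + (1 + 2 * N) * (al / rho) <= (1 + 2 * N) * E.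
  have p1 := powR_ge0 eta (kap q); have p2 := powR_ge0 al alpha.
  rewrite /E; move: p1 p2 alr0 N0; move: (eta `^ kap q) (al `^ alpha) (al / rho) N => X Y Z T.
  clear; nra.
pose c := ((2 + q) * (2 `^ q * 2 `^ q) * Lam + 2 `^ q * 2 * M * (1 + 2 * N)) * ((8 / rho) `^ N * E).
have c20 : 0 <= (2 + q) * (2 `^ q * 2 `^ q) by rewrite !mulr_ge0 ?powR_ge0// addr_ge0// ltW.
have le w : `|J q (u x - u w) * far_kernel rho K (w - x) - J q (u y - u w) * far_kernel rho K (w - y)| <=
   c * wt q u w.
  have uw0 : 0 <= 1 + `|u w| `^ q by rewrite addr_ge0// powR_ge0.
  have uy1 : 1 + `|u y| `^ q <= 2.
    have := powR_mono (ltW q0) (normr_ge0 (u y)) v1; rewrite powR1; clear; lra.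
  have P8 : 0 <= (8 / rho) `^ N * wgt q w by rewrite mulr_ge0 ?powR_ge0 ?wgt_ge0.
  have Gx : `|far_kernel rho K (w - x)| <= Lam * ((8 / rho) `^ N * wgt q w).
    have K0 := kern_ge0 (w - x) l0 kK; have [_ _ /(_ (w - x))[_ kb]] := kK.
    have ch0 := chi_ge0 rho (w - x); have ch1 := chi_le1 rho (w - x).
    have cc : 0 <= 1 - chi rho (w - x) by rewrite subr_ge0.
    case: (lerP rho (enorm (w - x))) => h; last first.
      by rewrite /far_kernel (chi_in r0 (ltW h)) subrr mul0r normr0; exact: mulr_ge0.
    rewrite /far_kernel ger0_norm; last exact: mulr_ge0.
    have g1 : (1 - chi rho (w - x)) * K (w - x) <= K (w - x).
      by apply: ler_piMl => //; rewrite gerBl.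
    apply: (le_trans g1); apply: (le_trans kb); apply: ler_wpM2l => //.
    have := rad_wgt q0 x2 r0 r1 h; rewrite [x + _]addrC subrK => hr.
    apply: (le_trans hr); apply: ler_wpM2r; first exact: wgt_ge0.
    apply: powR_mono => //; first by rewrite divr_ge0// ltW.
    by rewrite ler_pM2r ?invr_gt0// ler_nat.
  have T1 := J_increment_growth (u w) q0 u1 v1 he.
  have T2 := J_growth (u y) (u w) q0.
  have T3 := far_kernel_holder n1 q0 M0 Kk kM kH r0 r1 x2 y2 ar w.
  rewrite -/al -/N in T3.
  have -> : J q (u x - u w) * far_kernel rho K (w - x) - J q (u y - u w) * far_kernel rho K (w - y) =
    (J q (u x - u w) - J q (u y - u w)) * far_kernel rho K (w - x) +
    J q (u y - u w) * (far_kernel rho K (w - x) - far_kernel rho K (w - y)) by ring.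
  apply: (le_trans (ler_normD _ _)).
  rewrite (normrM (J q (u x - u w) - J q (u y - u w))) (normrM (J q (u y - u w))).
  have B1 := ler_pM (normr_ge0 _) (normr_ge0 _) T1 Gx.
  have B2 := ler_pM (normr_ge0 _) (normr_ge0 _) T2 T3.
  apply: (le_trans (lerD B1 B2)).
  have C1 : (2 + q) * (2 `^ q * 2 `^ q) * eta `^ kap q * (1 + `|u w| `^ q) *
     (Lam * ((8 / rho) `^ N * wgt q w)) <=
     (2 + q) * (2 `^ q * 2 `^ q) * Lam * ((8 / rho) `^ N * E) * wt q u w.
    have -> : (2 + q) * (2 `^ q * 2 `^ q) * eta `^ kap q * (1 + `|u w| `^ q) *
     (Lam * ((8 / rho) `^ N * wgt q w)) =
      ((2 + q) * (2 `^ q * 2 `^ q) * Lam * (8 / rho) `^ N * wt q u w) * eta `^ kap q.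
      by rewrite /wt; ring.
    have -> : (2 + q) * (2 `^ q * 2 `^ q) * Lam * ((8 / rho) `^ N * E) * wt q u w =
      ((2 + q) * (2 `^ q * 2 `^ q) * Lam * (8 / rho) `^ N * wt q u w) * E by ring.
    apply: ler_wpM2l => //; apply: mulr_ge0; last exact: wt_ge0.
    by apply: mulr_ge0; [exact: mulr_ge0|exact: powR_ge0].
  have C2 : 2 `^ q * (1 + `|u y| `^ q) * (1 + `|u w| `^ q) *
      ((8 / rho) `^ N * (M * (al `^ alpha + (1 + 2 * N) * (al / rho))) * wgt q w) <=
      2 `^ q * 2 * M * (1 + 2 * N) * ((8 / rho) `^ N * E) * wt q u w.
    have -> : 2 `^ q * (1 + `|u y| `^ q) * (1 + `|u w| `^ q) *
      ((8 / rho) `^ N * (M * (al `^ alpha + (1 + 2 * N) * (al / rho))) * wgt q w) =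
      (2 `^ q * M * (8 / rho) `^ N * wt q u w) *
      ((1 + `|u y| `^ q) * (al `^ alpha + (1 + 2 * N) * (al / rho))) by rewrite /wt; ring.
    have -> : 2 `^ q * 2 * M * (1 + 2 * N) * ((8 / rho) `^ N * E) * wt q u w =
      (2 `^ q * M * (8 / rho) `^ N * wt q u w) * (2 * ((1 + 2 * N) * E)) by ring.
    apply: ler_wpM2l.
      apply: mulr_ge0; last exact: wt_ge0.
      by apply: mulr_ge0; [apply: mulr_ge0 => //|]; exact: powR_ge0.
    have p2 : 0 <= 1 + `|u y| `^ q := addr_ge0 ler01 (powR_ge0 _ _).
    have p3 : 0 <= 1 + 2 * N by rewrite addr_ge0// mulr_ge0.
    have p4 : 0 <= al `^ alpha + (1 + 2 * N) * (al / rho).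
      exact: (addr_ge0 (powR_ge0 _ _) (mulr_ge0 p3 alr0)).
    exact: (ler_pM p2 p4 uy1 E2).
  apply: (le_trans (lerD C1 C2)).
  rewrite le_eqVlt; apply/orP; left; apply/eqP; rewrite /c; ring.
have c0 : 0 <= c.
  have p1 : 0 <= (8 / rho) `^ N := powR_ge0 _ _.
  have p2 : 0 <= 2 `^ q :> R := powR_ge0 _ _.
  have p3 : 0 <= 1 + 2 * N by rewrite addr_ge0// mulr_ge0.
  apply: mulr_ge0; last exact: mulr_ge0.
  apply: addr_ge0; first exact: mulr_ge0.
  apply: mulr_ge0 => //; apply: mulr_ge0 => //; exact: mulr_ge0.
have ij := intgB j1 j2.
have := le_trans (Ig_norm ij) (Ig_le (intg_norm ij) (intgZ c iw) le).
rewrite (IgZ c iw) ler_norml => /andP[h _]; apply: le_trans h; rewrite lerN2.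
apply: (le_trans (ler_wpM2l c0 bw)).
rewrite le_eqVlt; apply/orP; left; apply/eqP; rewrite /c /far_holder_cst /E /N; ring.
Qed.

End far_difference_holder.

(** * Lipschitz estimate for normalized solutions *)

Section lipschitz_main.
Context {R : realType} {n : nat}.
Implicit Types (lam Lam q r rho tau mu P d Lc m nu Rb F M alpha eta : R) (u K f k : 'rV[R]_n -> R) (a b x y z w : 'rV[R]_n).

Lemma parab_ineq_mono Lam q K f g u : (forall x, enorm x < 2 -> f x <= g x) ->
  @parab_ineq R n Lam q K f u -> parab_ineq Lam q K g u.
Proof.
move=> fg h x0 r b M r0 r1 sub M0 touch.
apply: (le_trans (h x0 r b M r0 r1 sub M0 touch)); rewrite lerD2r; apply: fg.
have : eball 0 2 x0 by apply: sub; rewrite /eball /= subrr enorm0.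
by rewrite /eball /= subr0.
Qed.

Lemma powR_exp (al b : R) : 0 < al -> al `^ b = expR (- (b * - ln al)).
Proof. by move=> al0; rewrite /powR gt_eqF// mulrN opprK. Qed.

Lemma powR_le1_anti (al b c : R) : 0 < al -> al <= 1 -> b <= c -> al `^ c <= al `^ b.
Proof. by move=> a0 a1 bc; apply: ger_powR; rewrite ?a0. Qed.

(** A radius rho = |a|^sigma with sigma small makes the far integral grow
    slower than the Hoelder errors decay. *)
Lemma far_exponents q alpha : 0 < q -> 0 < alpha -> exists sigma beta : R,
  [/\ 0 < sigma, sigma <= 4^-1, 0 < beta &
  forall al Ch, 0 < al -> al <= 1 -> 0 <= Ch ->
    (8 / al `^ sigma) `^ (q + n%:R) *
      ((Ch * al `^ 2^-1) `^ kap q + (al `^ alpha + al / al `^ sigma)) <=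
    8 `^ (q + n%:R) * (Ch `^ kap q + 2) * al `^ beta].
Proof.
move=> q0 a0; have k0 := kap_gt0 q0.
pose N := q + n%:R; have N0 : 0 < N by rewrite ltr_wpDr.
(* g is the smallest of the exponents of al before dividing by powers of rho. *)
pose g := Num.min (kap q / 2) (Num.min alpha 1).
have g0 : 0 < g by rewrite !lt_min a0 ltr01 divr_gt0.
have g1 : g <= 1 by rewrite !ge_min lexx !orbT.
have ga : g <= alpha by rewrite !ge_min lexx !orbT.
have gk : g <= kap q / 2 by rewrite !ge_min lexx.
pose beta := g / 2; have b0 : 0 < beta by rewrite divr_gt0.
pose sigma := Num.min 4^-1 (beta / (N + 1)).
have s0 : 0 < sigma by rewrite lt_min invr_gt0 divr_gt0// addr_gt0.
have s4 : sigma <= 4^-1 by rewrite ge_min lexx.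
have sN : sigma * (N + 1) <= beta.
  have N1 : 0 < N + 1 by rewrite addr_gt0.
  have : sigma <= beta / (N + 1) by rewrite /sigma ge_min lexx orbT.
  by rewrite (ler_pdivlMr _ _ N1).
exists sigma, beta; split=> // al Ch al0 al1 Ch0.
have as0 : 0 < al `^ sigma by rewrite powR_gt0.
have e1 : (8 / al `^ sigma) `^ N = 8 `^ N * al `^ (- (sigma * N)).
  by rewrite powR_div// -powRrM powRN.
have e2 : (Ch * al `^ 2^-1) `^ kap q = Ch `^ kap q * al `^ (kap q / 2).
  by rewrite (powRM _ Ch0 (powR_ge0 _ _)) -powRrM [2^-1 * _]mulrC.
have e3 : al / al `^ sigma = al `^ (1 - sigma).
  by rewrite powRB ?powRr1 ?(ltW al0)//; apply/implyP => _; rewrite gt_eqF.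
rewrite -/N e1 e2 e3.
have bound (c : R) : beta + sigma * N <= c -> al `^ (- (sigma * N)) * al `^ c <= al `^ beta.
  move=> hc; rewrite -powRD_pos//; apply: powR_le1_anti => //.
  by move: hc; clear; lra.
have B1 : al `^ (- (sigma * N)) * al `^ (kap q / 2) <= al `^ beta.
  by apply: bound; move: sN gk s0; rewrite /beta; clear; lra.
have B2 : al `^ (- (sigma * N)) * al `^ alpha <= al `^ beta.
  by apply: bound; move: sN ga s0; rewrite /beta; clear; lra.
have B3 : al `^ (- (sigma * N)) * al `^ (1 - sigma) <= al `^ beta.
  by apply: bound; move: sN g1 s0; rewrite /beta; clear; lra.
have p8 : 0 <= 8 `^ N :> R := powR_ge0 _ _.
have pC : 0 <= Ch `^ kap q := powR_ge0 _ _.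
rewrite -!mulrA; apply: ler_wpM2l => //.
have := ler_wpM2l pC B1; move: B2 B3.
move: (al `^ (- (sigma * N))) (al `^ (kap q / 2)) (al `^ alpha) (al `^ (1 - sigma)) (al `^ beta) (Ch `^ kap q).
by move=> X Y Z T V U; clear; nra.
Qed.

(** With G = 1 - 1/l the slope P is comparable to L, so nothing is gained
    from it, and every error other than f(x) - f(y) must be a power of |a|.
    The logarithmic estimate provides this: u is Hoelder of exponent 1/2,
    hence |x - x0| is at most a multiple of |a|^(1/4), and with rho =
    |a|^sigma the shift error mu is at most a multiple of |a|^sigma. *)
Lemma lipschitz_norm q : (1 <= n)%N -> 0 < q ->
  forall lam Lam M alpha W cf : R, 0 < lam -> lam <= Lam -> 0 <= M -> 0 < alpha ->
    0 <= W -> 0 <= cf ->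
  exists2 C : R, 0 <= C & forall K k f u, norm_sol lam Lam q W K f (fun x => - f x) u ->
    (forall x, enorm x < 2 -> `|f x| <= cf) ->
    (forall x y, enorm x < 2 -> enorm y < 2 -> 0 < enorm (x - y) -> enorm (x - y) <= 1 ->
       `|f x - f y| * `|ln (enorm (x - y))| ^+ n.+3 <= 1) ->
    (forall z, K z = k z * rad (- q - n%:R) z) ->
    (forall z, `|k z| <= M) -> (forall z z', `|k z - k z'| <= M * enorm (z - z') `^ alpha) ->
    forall x y, enorm x <= 1 -> enorm y <= 3 / 2 -> u x - u y <= C * enorm (x - y).
Proof.
move=> n1 q0 lam Lam M alpha W cf l0 lL M0 alpha0 W0 cf0.
have k0 := kap_gt0 q0; have kq := kap_le q; have k1 := kap_le1 q.
have [N hN] := log_lipschitz_norm n1 q0.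
have [Cl Cl0 hlog] := hN lam Lam W cf l0 lL W0 cf0.
have l0' := ltW l0; have L0 : 0 <= Lam := le_trans l0' lL.
have half0 : 0 < 2^-1 :> R by rewrite invr_gt0.
have [DN DN0 decayN] := pow_exp_decay N half0.
(* The logarithm raised to the power N is absorbed by |a|^(-1/2). *)
pose Ch := Cl * (1 + DN).
have Ch0 : 0 <= Ch by rewrite mulr_ge0// addr_ge0// ltW.
have [sigma [beta [s0 s4 b0 farE]]] := far_exponents q0 alpha0.
have [D1 D10 decay1] := @pow_exp_decay R (kap q) n.+3 k0.
have [D2 D20 decay2] := @pow_exp_decay R beta n.+3 b0.
have sk0 : 0 < sigma * kap q by rewrite mulr_gt0.
have [D3 D30 decay3] := @pow_exp_decay R (sigma * kap q) n.+4 sk0.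
have [D4 D40 decay4] := @pow_exp_decay R sigma 3 s0.
have pen0 : 0 < pen :> R by rewrite /pen mulr_gt0// exprn_gt0.
pose Cnu := Ch / pen + 1.
have Cnu0 : 0 <= Cnu by rewrite addr_ge0// divr_ge0// ltW.
pose Cmu := 2 * pen * (Cnu + 1).
have Cmu0 : 0 <= Cmu by rewrite mulr_ge0 ?mulr_ge0 ?(ltW pen0)// addr_ge0.
pose c0 := @gain_cst R n lam q.
have c00 : 0 < c0 := gain_cst_gt0 n1 l0 q0.
pose FH := @far_holder_cst R n Lam q M W.
have FH0 : 0 <= FH.
  have p2 : 0 <= 2 `^ q :> R := powR_ge0 _ _.
  have p3 : 0 <= 2 + q by rewrite addr_ge0// ltW.
  have p4 : 0 <= 1 + 2 * (q + n%:R) by rewrite addr_ge0// mulr_ge0// addr_ge0// ltW.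
  rewrite /FH /far_holder_cst; apply: mulr_ge0 => //; apply: addr_ge0.
    by apply: mulr_ge0 => //; apply: mulr_ge0 => //; exact: mulr_ge0.
  by apply: mulr_ge0 => //; apply: mulr_ge0 => //; exact: mulr_ge0.
pose CF := FH * (8 `^ (q + n%:R) * (Ch `^ kap q + 2)).
have CF0 : 0 <= CF.
  apply: mulr_ge0 => //; apply: mulr_ge0; first exact: powR_ge0.
  by apply: addr_ge0; first exact: powR_ge0.
pose nc := 2 * @near_cst R n q Lam * 5 `^ (q - kap q).
have nc0 : 0 <= nc.
  by apply: mulr_ge0; [apply: mulr_ge0; [by []|exact: near_cst_ge0]|exact: powR_ge0].
pose ec := err_cst Lam q * Cmu `^ kap q * 4 ^+ n.
have ec0 : 0 <= ec.
  by rewrite /ec mulr_ge0 ?exprn_ge0// mulr_ge0 ?powR_ge0// err_cst_ge0.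
pose Ct := 1 + CF * D2 + nc * D1 + ec * (5 * D3).
have [lr [lr64 lrs lrmu lrC]] : exists lr : R, [/\ 64 <= lr, 32 <= sigma * lr,
    Cmu * D4 * 40 ^+ 2 <= lr & Ct * 40 ^+ n.+2 / c0 < lr].
  have A1 : 0 <= 32 / sigma by rewrite divr_ge0// ltW.
  have A2 : 0 <= Cmu * D4 * 40 ^+ 2.
    apply: mulr_ge0; [apply: mulr_ge0; [exact: Cmu0|exact: ltW]|exact: exprn_ge0].
  have A3 := ler_norm (Ct * 40 ^+ n.+2 / c0).
  have A4 := normr_ge0 (Ct * 40 ^+ n.+2 / c0).
  have e : sigma * (32 / sigma) = 32 by rewrite mulrC divfK// gt_eqF.
  exists (64 + 32 / sigma + Cmu * D4 * 40 ^+ 2 + `|Ct * 40 ^+ n.+2 / c0|).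
  move: A1 A2 A3 A4 e s0; move: (32 / sigma) (Cmu * D4 * 40 ^+ 2) (Ct * 40 ^+ n.+2 / c0) => X Y Z.
  by clear; split; nra.
have lr32 : 32 <= lr by move: lr64; clear; lra.
have lr4 : 4 <= lr by move: lr64; clear; lra.
have lr1 : 1 <= lr by move: lr64; clear; lra.
have lp := @lip_G_profile R lr lr4.
pose rr := expR (- lr).
have rr0 : 0 < rr by exact: expR_gt0.
have rr1 : rr <= 1 by rewrite /rr -[leRHS]expR0 ler_expR oppr_le0; exact: le_trans lr1.
pose Lc := 4 / rr.
have Lc0 : 0 < Lc by rewrite divr_gt0.
have Lc4 : 4 <= Lc by rewrite /Lc ler_pdivlMr// ler_piMr.
exists Lc; first exact: ltW.
move=> K k f u [kK mu_ iw bw cu bu v1 v2] fb fmod Kk kM kH x y hx hy.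
have ns' : norm_sol lam Lam q W K (fun=> cf) (fun=> cf) u.
  split => //.
    by apply: parab_ineq_mono v1 => z /fb h; apply: le_trans h; exact: ler_norm.
  apply: parab_ineq_mono v2 => z /fb h; apply: le_trans h; rewrite -normrN; exact: ler_norm.
have key : u x - u y <= Lc * phi_of (@lip_G R) lr (enorm (x - y)).
  apply: (doubling_argument (Rb := 3 / 2) lp lr32 ler01 _ _ _ cu bu _ _ hy Lc0).
  - by move=> l hl; apply: lip_G_continuous; exact: le_trans hl.
  - by move=> l hl; apply: lip_G_exp; exact: le_trans hl.
  - move=> l hl; have [h1 _] := lip_G_le1 (le_trans lr4 hl).
    by apply: le_trans h1; exact: ltW.
  - by clear; lra.
  - by move: hx; clear; lra.
  - have [h1 _] := lip_G_le1 lr4.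
    rewrite mulrA /Lc divfK ?gt_eqF//; move: h1; clear; lra.
  move=> xb yb al al0 alr xbnu xbR ybR cmax pos.
  pose l := - ln al.
  have lrl : lr <= l by apply: ln_expR_le => //; exact: ltW.
  have l1 : 1 <= l := le_trans lr1 lrl.
  have lp0 : 0 < l := lt_le_trans ltr01 l1.
  have l4 : 4 <= l := le_trans lr4 lrl.
  have al1 : al <= 1 := le_trans (ltW alr) rr1.
  pose d := @lip_G R l - lip_G' l.
  have [d1 d2] := lip_G_bounds l4.
  pose P := Lc * d.
  have P1 : 1 <= P.
    apply: (@le_trans _ _ (4 * 2^-1)); first by clear; lra.
    by apply: ler_pM => //; rewrite ?invr_ge0.
  have P0 : 0 < P := lt_le_trans ltr01 P1.
  have d0 : 0 < d by move: P0; rewrite /P pmulr_rgt0.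
  have al32 : al <= 32^-1 := le_trans (ltW alr) (expRN_small lr32).
  have small (b : R) : 32 <= b * lr -> 0 <= b -> al `^ b <= 32^-1.
    move=> hb b_0; rewrite powR_exp// -/l; apply: expRN_small.
    by apply: (le_trans hb); rewrite ler_wpM2l.
  pose tau := (40 * l)^-1.
  have tau0 : 0 < tau by rewrite invr_gt0 mulr_gt0.
  have tau8 : tau <= 8^-1.
    rewrite lef_pV2 ?posrE ?mulr_gt0//; by move: l1; clear; lra.
  have xb2 : enorm xb < 2 by move: xbR; clear; lra.
  have yb2 : enorm yb < 2 by move: ybR; clear; lra.
  have ux1 := bu _ xb2; have uy1 := bu _ yb2.
  have hold z z' : enorm z <= 3 / 2 -> enorm z' <= 7 / 4 -> enorm (z - z') = al ->
      u z - u z' <= Ch * al `^ 2^-1.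
    move=> h1 h2 e; have := hlog K u ns' z z' h1 h2; rewrite e => h.
    apply: (le_trans h); rewrite /Ch -mulrA ler_wpM2l//.
    have -> : `|ln al| = l by rewrite ler0_norm// ln_le0.
    have e2 : al = al `^ 2^-1 * al `^ 2^-1.
      rewrite -powRD_pos// (_ : 2^-1 + 2^-1 = 1 :> R) ?powRr1 ?ltW//; clear; lra.
    have dN := decayN l (ltW lp0); rewrite -(powR_exp _ al0) in dN.
    have a12 : al `^ 2^-1 <= 1.
      by have := powR_le1_anti al0 al1 (ltW half0); rewrite powRr0.
    have h12 : 0 < al `^ 2^-1 by rewrite powR_gt0.
    rewrite {1}e2 -mulrA [leRHS]mulrC ler_pM2l// mulrDr mulr1; exact: lerD.
  have hxy : u xb - u yb <= Ch * al `^ 2^-1.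
    by apply: hold => //; [move: xbR|move: ybR]; clear; lra.
  have hyx : u yb - u xb <= Ch * al `^ 2^-1.
    by apply: hold; [move: ybR; clear; lra|move: xbR; clear; lra|rewrite enormBC].
  have hxy' : `|u xb - u yb| <= Ch * al `^ 2^-1.
    by rewrite ler_norml; apply/andP; split; [move: hyx; clear; lra|exact: hxy].
  have phi0 : 0 <= phi_of (@lip_G R) lr al.
    rewrite phi_of_small ?(ltW alr)// mulr_ge0 ?(ltW al0)//.
    have [h1 _] := lip_G_le1 l4; apply: le_trans h1; exact: ltW.
  have a14 : al `^ 4^-1 ^+ 2 = al `^ 2^-1.
    by rewrite -(powR_mulrn 2 (powR_ge0 _ _)) -powRrM; congr (_ `^ _); field.
  have p14 : 0 <= al `^ 4^-1 := powR_ge0 _ _.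
  have xnu : enorm (xb - x) <= Cnu * al `^ 4^-1.
    have h1 : pen * enorm (xb - x) ^+ 2 <= Ch * al `^ 2^-1.
      have h2 : 0 <= Lc * phi_of (@lip_G R) lr al by rewrite mulr_ge0// ltW.
      by move: pos hxy h2; rewrite /Phi -/al; clear; lra.
    have h3 : enorm (xb - x) ^+ 2 <= (Cnu * al `^ 4^-1) ^+ 2.
      rewrite exprMn a14; apply: (@le_trans _ _ (Ch / pen * al `^ 2^-1)).
        have e : Ch * al `^ 2^-1 = pen * (Ch / pen * al `^ 2^-1).
          by field; rewrite gt_eqF.
        by move: h1; rewrite e ler_pM2l.
      rewrite ler_wpM2r ?powR_ge0// /Cnu.
      have : 0 <= Ch / pen by rewrite divr_ge0// ltW.
      by move: (Ch / pen) => X; clear; nra.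
    rewrite leNgt; apply/negP => h4; move: h3; rewrite leNgt => /negP; apply.
    by rewrite ltr_pXn2r ?nnegrE ?enorm_ge0 ?mulr_ge0.
  pose rho := al `^ sigma.
  have rho0 : 0 < rho by rewrite powR_gt0.
  have rho32 : rho <= 32^-1 by apply: small; [exact: lrs|exact: ltW].
  have rho1 : rho <= 1 by move: rho32; clear; lra.
  have alrho2 : al <= rho / 2.
    have e : al = rho * al `^ (1 - sigma).
      by rewrite /rho -powRD_pos// (_ : sigma + (1 - sigma) = 1) ?powRr1 ?ltW//; ring.
    rewrite {1}e ler_pM2l//.
    have : al `^ (1 - sigma) <= 32^-1.
      by apply: small; move: s4 lr64; clear; nra.
    by clear; lra.
  have alrho : al <= rho by move: alrho2 rho0; clear; lra.
  pose nu := Cnu * al `^ 4^-1.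
  have nu0 : 0 <= nu by rewrite mulr_ge0.
  pose mu := 2 * pen * (nu + rho).
  have mu0 : 0 <= mu by rewrite mulr_ge0 ?addr_ge0 ?mulr_ge0 ?(ltW pen0) ?(ltW rho0).
  have muC : mu <= Cmu * rho.
    rewrite /mu /Cmu -(mulrA (2 * pen)); apply: ler_wpM2l; first by rewrite mulr_ge0// ltW.
    rewrite mulrDl mul1r lerD2r /nu ler_wpM2l// /rho; exact: powR_le1_anti.
  have muP : mu <= P * tau ^+ 2.
    rewrite /tau exprVn ler_pdivlMr ?exprn_gt0 ?mulr_gt0// exprMn.
    apply: le_trans P1.
    have d4 := decay4 l (ltW lp0); rewrite -(powR_exp _ al0) -/rho in d4.
    rewrite -(ler_pM2r lp0) mul1r; apply: le_trans (le_trans lrmu lrl).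
    have -> : mu * (40 ^+ 2 * l ^+ 2) * l = mu * l ^+ 3 * 40 ^+ 2 by ring.
    rewrite ler_wpM2r ?sqr_ge0//; apply: (@le_trans _ _ (Cmu * rho * l ^+ 3)).
      by rewrite ler_wpM2r// exprn_ge0// ltW.
    by rewrite -mulrA ler_wpM2l.
  have hF := far_difference_holder n1 l0' L0 q0 kK mu_ iw bw M0 alpha0 Kk kM kH (ltW xb2) ux1 (ltW yb2) uy1
    rho0 rho1 alrho2 hxy'.
  have conc := phi_concave_at lp al0 alr.
  have R32 : 3 / 2 < 2 :> R by clear; lra.
  have xbR' : enorm xb + 2 * rho <= 3 / 2 by move: xbR rho32; clear; lra.
  have ybR' : enorm yb + 2 * rho <= 3 / 2 by move: ybR rho32; clear; lra.
  have al16 : al <= 16^-1 by move: al32; clear; lra.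
  have rho2 : rho <= 2^-1 by move: rho32; clear; lra.
  have main := contact_inequality n1 l0' L0 q0 kK mu_ iw v1 v2 R32 (phi_of0 (@lip_G R) lr) Lc0 d0 pen0
    cmax pos xbR' ybR' xnu tau0 tau8 al16 alrho rho2 (erefl mu) muP conc hF.
  have Pq1 : 1 <= P `^ q.
    by rewrite -[leLHS](powRr0 P); apply: ler_powR => //; exact: ltW.
  have Pq0 : 0 < P `^ q := lt_le_trans ltr01 Pq1.
  have ln3 : 0 < l ^+ n.+3 by rewrite exprn_gt0.
  apply: (@gain_beats_errors R n c0 Ct (P `^ q) l c00 Pq0 l1).
    exact: lt_le_trans lrC lrl.
  have := ler_wpM2r (ltW ln3) main; move/le_trans; apply.
  rewrite -/l -/P -/nc /Ct.
  have T0 : (f xb - f yb) * l ^+ n.+3 <= P `^ q.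
    apply: le_trans Pq1; apply: le_trans (fmod xb yb xb2 yb2 al0 al1).
    have -> : `|ln (enorm (xb - yb))| = l by rewrite -/al ler0_norm// ln_le0.
    by rewrite ler_wpM2r ?(ltW ln3)// ler_norm.
  have T1 : FH * ((8 / rho) `^ (q + n%:R) * ((Ch * al `^ 2^-1) `^ kap q +
      (al `^ alpha + al / rho))) * l ^+ n.+3 <= CF * D2 * P `^ q.
    have d2' := decay2 l (ltW lp0); rewrite -(powR_exp _ al0) in d2'.
    have h1 := ler_wpM2l FH0 (farE al Ch al0 al1 Ch0).
    apply: (le_trans (ler_wpM2r (ltW ln3) h1)).
    have -> : FH * (8 `^ (q + n%:R) * (Ch `^ kap q + 2) * al `^ beta) * l ^+ n.+3 =
       CF * (al `^ beta * l ^+ n.+3) by rewrite /CF; ring.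
    apply: (@le_trans _ _ (CF * D2)); first by rewrite ler_wpM2l.
    by rewrite ler_peMr// mulr_ge0// ltW.
  have T2 : nc * (P `^ q * al `^ kap q) * l ^+ n.+3 <= nc * D1 * P `^ q.
    have d1' := decay1 l (ltW lp0); rewrite -(powR_exp _ al0) in d1'.
    have -> : nc * (P `^ q * al `^ kap q) * l ^+ n.+3 =
      nc * P `^ q * (al `^ kap q * l ^+ n.+3) by ring.
    have -> : nc * D1 * P `^ q = nc * P `^ q * D1 by ring.
    by rewrite ler_wpM2l// mulr_ge0// ltW.
  have T3 : err_cst Lam q * (P `^ (q - kap q) * mu `^ kap q) * (4 ^+ n * (1 + 4 * l)) * l ^+ n.+3
      <= ec * (5 * D3) * P `^ q.
    have d3' := decay3 l (ltW lp0); rewrite -(powR_exp _ al0) in d3'.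
    have ee0 : 0 <= err_cst Lam q * 4 ^+ n by rewrite mulr_ge0 ?exprn_ge0// err_cst_ge0.
    have m1 : mu `^ kap q <= Cmu `^ kap q * al `^ (sigma * kap q).
      rewrite powRrM -powRM ?powR_ge0//; apply: powR_mono => //; exact: ltW.
    have p1 : P `^ (q - kap q) <= P `^ q by apply: ler_powR => //; rewrite gerBl ltW.
    have m2 : P `^ (q - kap q) * mu `^ kap q <= P `^ q * (Cmu `^ kap q * al `^ (sigma * kap q)).
      by apply: ler_pM => //; exact: powR_ge0.
    have l5 : (1 + 4 * l) * l ^+ n.+3 <= 5 * l ^+ n.+4.
      by rewrite (exprS l n.+3) mulrA ler_pM2r//; move: l1; clear; lra.
    have l50 : 0 <= (1 + 4 * l) * l ^+ n.+3.
      by rewrite mulr_ge0 ?(ltW ln3)// addr_ge0// mulr_ge0// ltW.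
    have -> : err_cst Lam q * (P `^ (q - kap q) * mu `^ kap q) * (4 ^+ n * (1 + 4 * l)) * l ^+ n.+3
      = err_cst Lam q * 4 ^+ n * ((P `^ (q - kap q) * mu `^ kap q) * ((1 + 4 * l) * l ^+ n.+3)) by ring.
    have m3 : (P `^ (q - kap q) * mu `^ kap q) * ((1 + 4 * l) * l ^+ n.+3) <=
       P `^ q * (Cmu `^ kap q * al `^ (sigma * kap q)) * (5 * l ^+ n.+4).
      apply: ler_pM => //; apply: mulr_ge0; exact: powR_ge0.
    apply: (le_trans (ler_wpM2l ee0 m3)).
    have -> : err_cst Lam q * 4 ^+ n * (P `^ q * (Cmu `^ kap q * al `^ (sigma * kap q)) * (5 * l ^+ n.+4)) =
      ec * 5 * P `^ q * (al `^ (sigma * kap q) * l ^+ n.+4) by rewrite /ec; ring.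
    have -> : ec * (5 * D3) * P `^ q = ec * 5 * P `^ q * D3 by ring.
    apply: ler_wpM2l => //; apply: mulr_ge0; last exact: ltW.
    exact: mulr_ge0.
  move: T0 T1 T2 T3; rewrite -/FH -/al -/rho; clear; lra.
apply: (le_trans key); rewrite ler_pM2l//.
set t := enorm (x - y); have t0 : 0 <= t := enorm_ge0 _.
case: (lerP t rr) => h.
  rewrite phi_of_small//.
  have [->|tN0] := eqVneq t 0; first by rewrite mul0r.
  have tp : 0 < t by rewrite lt_neqAle eq_sym tN0.
  have [_ g1] := lip_G_le1 (le_trans lr4 (ln_expR_le tp h)).
  by rewrite ler_piMr.
rewrite phi_of_large ?(ltW h)// phi_of_small// expRK opprK.
have [_ g1] := lip_G_le1 lr4.
by apply: le_trans (ltW h); rewrite ler_piMr// ltW.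
Qed.

End lipschitz_main.

(** * Normalization and bounds on the right-hand side *)

Section normalization.
Context {R : realType} {n : nat}.
Local Notation L := (lebesgue_rV R n).
Local Notation msb := (@measurableR _ L R).
Local Notation intg := (@integrableR _ L R (leb n)).
Local Notation Ig := (@integralR _ L R (leb n)).
Implicit Types (lam Lam q r c m W F o : R) (u K f g : 'rV[R]_n -> R) (x y z : 'rV[R]_n).

Lemma intg_wgt q : 0 < q -> intg (wgt q).
Proof.
move=> q0; have qN : - q < 0 by rewrite oppr_lt0.
have [i1 _] := Ig_cube (0 : 'rV[R]_n) (@ler01 R).
have [i2 _] := @rad_far R n (- q) 1 qN ltr01.
have e0 : - q - n%:R <= 0 by rewrite -opprD oppr_le0 addr_ge0// ltW.
suff pw z : `|wgt q z| <= \1_(cube (0 : 'rV[R]_n) 1) z + (1 <= enorm z)%R%:R * rad (- q - n%:R) z.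
  exact (intg_le (msb_wgt q) pw (intgD i1 i2)).
rewrite ger0_norm ?wgt_ge0//; case: (lerP 1 (enorm z)) => h.
  rewrite mul1r; apply: (@le_trans _ _ (rad (- q - n%:R) z)); last by rewrite lerDr indicE.
  by apply: powR_anti => //; [exact: lt_le_trans h|rewrite lerDr].
rewrite mul0r addr0 indicE mem_set /=; last first.
  by move=> i; rewrite mxE subr0; apply: le_trans (ltW h); exact: coord_le.
have h1 : 1 <= 1 + enorm z by rewrite lerDl enorm_ge0.
by have := powR_anti e0 (@ltr01 R) h1; rewrite powR1.
Qed.

Definition tail_density q u z : R := (2 <= enorm z)%R%:R * (`|u z| `^ q * rad (- q - n%:R) z).

Definition wt_bound q : R := 2 * Ig (wgt q) + 1.

Lemma wt_bound_ge0 q : 0 <= wt_bound q.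
Proof.
by rewrite /wt_bound addr_ge0// mulr_ge0//; apply: Ig_ge0 => z; exact: wgt_ge0.
Qed.

(** Inside B_2 use |u| <= 1, outside it 1 + |y| >= |y|. *)
Lemma wt_normalized q u : 0 < q -> msb u -> intg (tail_density q u) ->
  Ig (tail_density q u) <= 1 -> (forall x, enorm x < 2 -> `|u x| <= 1) ->
  intg (wt q u) /\ Ig (wt q u) <= wt_bound q.
Proof.
move=> q0 mu it t1 u1.
have e0 : - q - n%:R <= 0 by rewrite -opprD oppr_le0 addr_ge0// ltW.
have i2 := intgZ 2 (intg_wgt q0).
have pw z : wt q u z <= 2 * wgt q z + tail_density q u z.
  rewrite /wt /tail_density mulrDl mul1r mulr_natl mulr2n -addrA lerD2l.
  case: (lerP 2 (enorm z)) => h.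
    rewrite mul1r ler_wpDl ?wgt_ge0// ler_wpM2l ?powR_ge0//.
    apply: powR_anti => //; last by rewrite lerDr.
    exact: lt_le_trans h.
  rewrite mul0r addr0 ler_piMl ?wgt_ge0//.
  apply: (@le_trans _ _ (1 `^ q)); last by rewrite powR1.
  apply: powR_mono => //; [exact: ltW|exact: u1].
have iw : intg (wt q u).
  apply: intg_le (intgD i2 it); first exact: msb_wt.
  move=> z.
  by rewrite ger0_norm ?wt_ge0.
split=> //; apply: (le_trans (Ig_le iw (intgD i2 it) pw)).
by rewrite (IgD i2 it) (IgZ 2 (intg_wgt q0)) lerD2l.
Qed.

Lemma tail_densityZ q u c : 0 < q -> 0 <= c ->
  tail_density q (fun x => c * u x) = fun z => c `^ q * tail_density q u z.
Proof.
move=> q0 c0; apply/funext => z; rewrite /tail_density normrM (ger0_norm c0) powRM//.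
by ring.
Qed.

(** Both sides are homogeneous of degree q under scaling of u. *)
Lemma parab_ineqZ lam Lam q K f u c : 0 <= lam -> 0 <= Lam -> 0 < q -> 0 < c ->
  kern lam Lam q K -> msb u -> intg (wt q u) ->
  @parab_ineq R n Lam q K f u ->
  parab_ineq Lam q K (fun x => c `^ q * f x) (fun x => c * u x).
Proof.
move=> l0 L0 q0 c0 kK mu iw h x0 r b M r0 r1 sub M0 touch.
have c_neq0 : c != 0 by rewrite gt_eqF.
have ci0 : 0 < c^-1 by rewrite invr_gt0.
have x2 : enorm x0 <= 2.
  have : eball 0 2 x0 by apply: sub; rewrite /eball /= subrr enorm0.
  by rewrite /eball /= subr0 => /ltW.
have M0' : 0 <= c^-1 * M by rewrite mulr_ge0// ltW.
have := h x0 r (c^-1 *: b) (c^-1 * M) r0 r1 sub M0'.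
have touch' z : enorm z < r ->
    u (x0 + z) <= u x0 + dot (c^-1 *: b) z + c^-1 * M * enorm z ^+ 2.
  move=> hz; rewrite -(ler_pM2l c0) !mulrDr dotZl -(mulrA c^-1) !(mulVKf c_neq0).
  exact: touch.
move=> /(_ touch') hh.
have it := intg_tail_J l0 L0 q0 kK mu iw x2 r0 r1.
have cq0 : 0 < c `^ q by rewrite powR_gt0.
have e1 : (fun z => (r <= enorm z)%R%:R * (J q (c * u x0 - c * u (x0 + z)) * K z)) =
    fun z => c `^ q * ((r <= enorm z)%R%:R * (J q (u x0 - u (x0 + z)) * K z)).
  by apply/funext => z; rewrite -mulrBr J_hom// ?(ltW c0)//; ring.
rewrite e1 (IgZ _ it).
have e2 : (2 * enorm b + M * r) `^ (q - kap q) * (M * r) `^ kap q =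
  c `^ q * ((2 * enorm (c^-1 *: b) + c^-1 * M * r) `^ (q - kap q) * (c^-1 * M * r) `^ kap q).
  have Mr : 0 <= M * r by rewrite mulr_ge0// ltW.
  have bM : 0 <= 2 * enorm b + M * r by rewrite addr_ge0// mulr_ge0// enorm_ge0.
  rewrite enormZ (gtr0_norm ci0).
  have -> : 2 * (c^-1 * enorm b) + c^-1 * M * r = c^-1 * (2 * enorm b + M * r) by ring.
  have -> : c^-1 * M * r = c^-1 * (M * r) by ring.
  have key (X Y : R) : X * Y = c `^ q * ((c^-1 `^ (q - kap q) * X) * (c^-1 `^ kap q * Y)).
    have -> : c `^ q * ((c^-1 `^ (q - kap q) * X) * (c^-1 `^ kap q * Y)) =
      c `^ q * (c^-1 `^ (q - kap q) * c^-1 `^ kap q) * (X * Y) by ring.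
    rewrite -(powRD_pos _ _ ci0) subrK -(powRM _ (ltW c0) (ltW ci0)).
    by rewrite (divff c_neq0) powR1 mul1r.
  by rewrite (powRM _ (ltW ci0) bM) (powRM _ (ltW ci0) Mr); exact: key.
rewrite e2 mulrCA -mulrDr ler_pM2l//.
Qed.

(** The touching paraboloid has opening 4 and gradient 8 x with |x| <= 1, in a
    ball of radius 1/2: hence 2 * 8 + 4 / 2 = 18 and 4 / 2 = 2. *)
Definition touch_cst (Lam q W : R) : R :=
  @far_cst R n Lam q 2^-1 W + @near_cst R n q Lam * (18 `^ (q - kap q) * 2 `^ kap q).

(** The maximum of u - 4|x|^2 over the ball of radius 3/2 lies in the unit
    ball, since |u| <= 1; the paraboloid touching there has bounded
    coefficients. *)
Lemma touching_lower_bound lam Lam q K f u W : 0 <= lam -> 0 <= Lam -> 0 < q ->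
  kern lam Lam q K -> msb u -> intg (wt q u) -> Ig (wt q u) <= W ->
  (forall x, enorm x < 2 -> {for x, continuous u}) ->
  (forall x, enorm x < 2 -> `|u x| <= 1) -> parab_ineq Lam q K f u ->
  exists2 x, enorm x < 2 & - touch_cst Lam q W <= f x.
Proof.
move=> l0 L0 q0 kK mu iw bw cu u1 vf.
pose g x := u x - 4 * enorm x ^+ 2.
have cg x : enorm x < 2 -> {for x, continuous g}.
  move=> x2; have ce : {for x, continuous (@enorm R 1 n)} := @enorm_continuous R n x.
  have c4 := @cts_cst R n 4 x.
  exact: (cvgB (cu x x2) (cvgM c4 (cvgM ce ce))).
have [xb xbR xbmax] : exists2 xb, enorm xb <= 3 / 2 &
    forall x, enorm x <= 3 / 2 -> g x <= g xb.
  have cD := @compact_closed_eball R n (3 / 2).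
  have D0 : [set x : 'rV[R]_n | enorm x <= 3 / 2] !=set0.
    by exists 0; rewrite /= enorm0 divr_ge0.
  have cP : {within [set x : 'rV[R]_n | enorm x <= 3 / 2], continuous g}.
    apply: continuous_in_subspaceT => x; rewrite inE /= => hx.
    by apply: cg; apply: (le_lt_trans hx); lra.
  have [xb] := compact_EVT_max D0 cD cP.
  by rewrite inE /= => h1 h2; exists xb => // x hx; apply: h2; rewrite inE.
have z0 : enorm (0 : 'rV[R]_n) <= 3 / 2 by rewrite enorm0; lra.
have xb2 : enorm xb < 2 by move: xbR; clear; lra.
have xb1 : enorm xb <= 1.
  have := xbmax 0 z0; rewrite /g enorm0 expr0n /= mulr0 subr0.
  have z2 : enorm (0 : 'rV[R]_n) < 2 by rewrite enorm0.
  have := u1 _ xb2; have := u1 0 z2; rewrite !ler_norml => /andP[h1 _] /andP[_ h2] h3.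
  have := enorm_ge0 xb; move: h1 h2 h3; move: (enorm xb) (u xb) (u 0) => e a b; clear; nra.
have half0 : 0 < 2^-1 :> R by rewrite invr_gt0.
have half1 : 2^-1 <= 1 :> R by clear; lra.
exists xb; first exact: xb2.
have sub : eball xb 2^-1 `<=` eball 0 2.
  move=> y; rewrite /eball /= subr0 => h; have := enormD xb (y - xb); rewrite addrC subrK.
  by move: h xb1; clear; lra.
have touch z : enorm z < 2^-1 -> u (xb + z) <= u xb + dot (8 *: xb) z + 4 * enorm z ^+ 2.
  move=> hz; have hs : enorm (xb + z) <= 3 / 2.
    by have := enormD xb z; move: hz xb1; clear; lra.
  have := xbmax _ hs; rewrite /g enormD_sqr dotZl; clear; lra.
have := vf xb 2^-1 (8 *: xb) 4 half0 half1 sub (ler0n _ _) touch.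
have u1q : `|u xb| `^ q <= 1.
  apply: (@le_trans _ _ (1 `^ q)); last by rewrite powR1.
  by apply: powR_mono => //; [exact: ltW|exact: u1].
have it := intg_tail_J l0 L0 q0 kK mu iw (ltW xb2) half0 half1.
have [iw' ew] := Ig_shift xb iw.
have far : - @far_cst R n Lam q 2^-1 W <=
   Ig (fun z => (2^-1 <= enorm z)%R%:R * (J q (u xb - u (xb + z)) * K z)).
  suff : `|Ig (fun z => (2^-1 <= enorm z)%R%:R * (J q (u xb - u (xb + z)) * K z))| <=
      @far_cst R n Lam q 2^-1 W by rewrite ler_norml => /andP[].
  pose cc := Lam * (4 / 2^-1) `^ (q + n%:R) * 2 `^ q * 2.
  have p1 : 0 <= Lam * (4 / 2^-1) `^ (q + n%:R) * 2 `^ q.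
    by apply: mulr_ge0; [apply: mulr_ge0|]; rewrite ?powR_ge0.
  apply: (le_trans (Ig_norm it)).
  apply: (@le_trans _ _ (Ig (fun z => cc * wt q u (xb + z)))).
    apply: (Ig_le (intg_norm it) (intgZ cc iw')) => z.
    apply: (le_trans (tail_integrand_le u z l0 L0 q0 kK (ltW xb2) half0 half1)).
    apply: ler_wpM2r; first exact: wt_ge0.
    apply: ler_wpM2l; first exact: p1.
    by move: u1q; clear; lra.
  rewrite (IgZ cc iw') ew; apply: ler_wpM2l; last exact: bw.
  by apply: mulr_ge0; [exact: p1|exact: ler0n].
have near : (2 * enorm (8 *: xb) + 4 * 2^-1) `^ (q - kap q) * (4 * 2^-1) `^ kap q <=
    18 `^ (q - kap q) * 2 `^ kap q.
  have e2 : 4 * 2^-1 = 2 :> R by clear; lra.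
  rewrite e2; apply: ler_wpM2r; first exact: powR_ge0.
  apply: powR_mono.
  - have := kap_le q; clear; lra.
  - have := enorm_ge0 (8 *: xb); clear; lra.
  have e8 : `|8 : R| = 8 by exact: ger0_norm.
  rewrite enormZ e8; move: xb1; clear; lra.
have nc0 := @near_cst_ge0 R n q Lam q0 L0.
have := ler_wpM2l nc0 near; rewrite /touch_cst; move: far; clear; lra.
Qed.

(** The exponent is n + 1 + 2p(1-s) = n + 3 when s p = p - 1. *)
Definition log_mod_le (W : R) (f : 'rV[R]_n -> R) : Prop :=
  forall x y, enorm x < 2 -> enorm y < 2 -> 0 < enorm (x - y) -> enorm (x - y) <= 1 ->
    `|f x - f y| * `|ln (enorm (x - y))| ^+ n.+3 <= W.

Lemma ln2_pos : 0 < ln 2 :> R. Proof. by apply: ln_gt0; lra. Qed.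

Definition osc_cst : R := 4 * (ln 2 ^- n.+3).

(** Four steps of length at most 1/2 join x to 0 inside B_2. *)
Lemma osc_le f : log_mod_le 1 f -> forall x, enorm x < 2 -> `|f x - f 0| <= osc_cst.
Proof.
move=> hf x x2; have l2 : 0 < ln 2 ^+ n.+3 :> R by rewrite exprn_gt0// ln2_pos.
pose o : R := ln 2 ^- n.+3; have o0 : 0 <= o by rewrite invr_ge0 ltW.
have nx := enorm_ge0 x.
have step (a b : R) : 0 <= a -> a <= 1 -> 0 <= b -> b <= 1 -> `|a - b| <= 4^-1 ->
    `|f (a *: x) - f (b *: x)| <= o.
  move=> a0 a1 b0 b1 ab.
  have ea : enorm (a *: x - b *: x) = `|a - b| * enorm x by rewrite -scalerBl enormZ.
  have h0 : 0 <= `|a - b| := normr_ge0 _.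
  case: (lerP (enorm (a *: x - b *: x)) 0) => h.
    have : a *: x - b *: x == 0 by rewrite -enorm_eq0 eq_le h enorm_ge0.
    by rewrite subr_eq0 => /eqP ->; rewrite subrr normr0.
  have t2 : enorm (a *: x - b *: x) <= 2^-1.
    by rewrite ea; move: ab x2 nx h0; move: `|a - b| (enorm x) => s t; clear; nra.
  have t1 : enorm (a *: x - b *: x) <= 1 by move: t2; clear; lra.
  have ha : enorm (a *: x) < 2.
    by rewrite enormZ ger0_norm//; move: a0 a1 x2 nx; move: (enorm x) => t; clear; nra.
  have hb : enorm (b *: x) < 2.
    by rewrite enormZ ger0_norm//; move: b0 b1 x2 nx; move: (enorm x) => t; clear; nra.
  have := hf _ _ ha hb h t1 => hh.
  rewrite /o -[_ ^- _]mul1r ler_pdivlMr//; apply: le_trans hh; rewrite ler_wpM2l//.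
  have h3 : ln (enorm (a *: x - b *: x)) <= - ln 2.
    rewrite -lnV ?posrE// ler_ln ?posrE// invr_gt0//.
  have h4 := ln2_pos; apply: lerXn2r; rewrite ?nnegrE// ?(ltW h4)//.
  by rewrite ler0_norm; move: h3 h4; clear; lra.
have s1 := step 1 (3 / 4); have s2 := step (3 / 4) (1 / 2).
have s3 := step (1 / 2) (1 / 4); have s4 := step (1 / 4) 0.
rewrite scale1r in s1; rewrite scale0r in s4.
have q4 (a : R) : a = 4^-1 -> `|a| <= 4^-1 by move=> ->; rewrite ger0_norm// invr_ge0.
have {}s1 : `|f x - f ((3 / 4) *: x)| <= o by apply: s1; try apply: q4; clear; lra.
have {}s2 : `|f ((3 / 4) *: x) - f ((1 / 2) *: x)| <= o by apply: s2; try apply: q4; clear; lra.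
have {}s3 : `|f ((1 / 2) *: x) - f ((1 / 4) *: x)| <= o by apply: s3; try apply: q4; clear; lra.
have {}s4 : `|f ((1 / 4) *: x) - f 0| <= o by apply: s4; try apply: q4; clear; lra.
move: s1 s2 s3 s4; rewrite !ler_norml /osc_cst -/o => /andP[a1 a2] /andP[b1 b2] /andP[c1 c2] /andP[d1 d2].
by apply/andP; split; move: a1 a2 b1 b2 c1 c2 d1 d2; clear; lra.
Qed.

(** Touching u from above bounds f from below at one point, touching it from
    below bounds f from above at another, and f oscillates by a constant. *)
Lemma rhs_bound lam Lam q K f u W : 0 <= lam -> 0 <= Lam -> 0 < q ->
  norm_sol lam Lam q W K f (fun x => - f x) u -> log_mod_le 1 f ->
  forall x, enorm x < 2 -> `|f x| <= touch_cst Lam q W + 2 * osc_cst.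
Proof.
move=> l0 L0 q0 [kK mu iw bw cu u1 v1 v2] hf x x2.
have [y y2 fy] := touching_lower_bound l0 L0 q0 kK mu iw bw cu u1 v1.
have wN : wt q (fun x => - u x) = wt q u by apply/funext => z; rewrite /wt normrN.
have [||||||z z2 fz] := @touching_lower_bound lam Lam q K (fun x => - f x) (fun x => - u x) W l0 L0 q0 kK.
- have := msbM (msb_cst (-1)) mu; by under eq_fun do rewrite mulN1r.
- by rewrite wN.
- by rewrite wN.
- move=> t ht; exact: (cvgN (cu t ht)).
- by move=> t ht; rewrite normrN; exact: u1.
- exact: v2.
have := osc_le hf x2; have := osc_le hf y2; have := osc_le hf z2.
rewrite !ler_norml => /andP[a1 a2] /andP[b1 b2] /andP[c1 c2].
by apply/andP; split; move: fy fz a1 a2 b1 b2 c1 c2; clear; lra.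
Qed.

End normalization.

(** * Norms, tails and moduli as real numbers *)

Section function_space_data.
Context {R : realType} {n : nat}.
Local Notation L := (lebesgue_rV R n).
Local Notation msb := (@measurableR _ L R).
Local Notation intg := (@integrableR _ L R (leb n)).
Local Notation Ig := (@integralR _ L R (leb n)).
Implicit Types (p s lam Lam q r c m W F o S alpha : R) (u K k f g : 'rV[R]_n -> R) (x y z : 'rV[R]_n) (D : set 'rV[R]_n).

Lemma eball0E r x : eball 0 r x <-> enorm x < r.
Proof. by rewrite /eball /= subr0. Qed.

Lemma interior_continuous u : {within closure (eball 0 2), continuous u} ->
  forall x, enorm x < 2 -> {for x, continuous u}.
Proof.
move=> cu x x2; have := continuous_subspaceW (@subset_closure _ _) cu.
rewrite continuous_open_subspace; last exact: open_eball.
by apply; rewrite inE; apply/eball0E.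
Qed.

Lemma sup_norm_ge D u x : D x -> (`|u x|%:E <= sup_norm D u)%E.
Proof. by move=> Dx; apply: ereal_sup_ubound; exists x. Qed.

Lemma sup_norm_fin u : {within closure (eball 0 2), continuous u} ->
  exists S, [/\ 0 <= S, sup_norm (eball 0 2) u = S%:E &
    forall x, enorm x < 2 -> `|u x| <= S].
Proof.
move=> cu.
have sub : closure (eball 0 2) `<=` [set x : 'rV[R]_n | enorm x <= 2].
  have cl : closed [set x : 'rV[R]_n | enorm x <= 2].
    by apply: compact_closed; [exact: norm_hausdorff|exact: compact_closed_eball].
  rewrite [X in _ `<=` X](closure_id _).1//; apply: closure_subset => x /eball0E; exact: ltW.
have cD : compact (closure (eball (0 : 'rV[R]_n) 2)).
  apply: subclosed_compact sub; [exact: closed_closure|exact: compact_closed_eball].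
have [M [_ hM]] := compact_bounded (continuous_compact cu cD).
have uM x : eball 0 2 x -> `|u x| <= M + 1.
  move=> hx; apply: (hM (M + 1)); first by rewrite ltrDl.
  by exists x => //; exact: subset_closure.
have b0 : eball (0 : 'rV[R]_n) 2 0 by apply/eball0E; rewrite enorm0.
have s0 : (0 <= sup_norm (eball 0 2) u)%E.
  by apply: le_trans (sup_norm_ge u b0); rewrite lee_fin.
have sM : (sup_norm (eball 0 2) u <= (M + 1)%:E)%E.
  by apply: ge_ereal_sup => _ [x /uM hx <-]; rewrite lee_fin.
have fs : sup_norm (eball 0 2) u \is a fin_num.
  by rewrite ge0_fin_numE//; apply: le_lt_trans sM _; exact: ltry.
have e := fineK fs; exists (fine (sup_norm (eball 0 2) u)); split=> [||x x2].
- by rewrite fine_ge0.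
- by rewrite e.
- by rewrite -lee_fin e; apply: sup_norm_ge; apply/eball0E.
Qed.

Lemma Lsp_intg p s u : 1 < p -> s * p = p - 1 -> Lsp s p u ->
  [/\ msb u, intg (wt (p - 1) u) & intg (tail_density (p - 1) u)].
Proof.
move=> p1 sp [[mu _]]; rewrite sp; set q := p - 1; have q0 : 0 < q by rewrite subr_gt0.
have -> : (fun z : lebesgue_rV R n => (`|u z| `^ q / (1 + enorm z) `^ (n%:R + q))%:E) =
    EFin \o (fun z => `|u z| `^ q * wgt q z).
  apply/funext => z; rewrite /= /wgt -powRN; congr (_ * _ `^ _)%:E; ring.
move=> fin; have mh : msb (fun z => `|u z| `^ q * wgt q z).
  by apply: msbM; [apply: msb_powR; exact: msb_norm|exact: msb_wgt].
have ih : intg (fun z => `|u z| `^ q * wgt q z).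
  apply/integrableP; split; first exact/measurable_EFinP.
  move: fin; under [in X in _ -> X]eq_integral => z _.
    rewrite /= ger0_norm; last exact: mulr_ge0 (powR_ge0 _ _) (wgt_ge0 _ _).
    over.
  by [].
split=> //.
  have := intgD (intg_wgt q0) ih.
  by rewrite (_ : (fun z => _) = wt q u)//; apply/funext => z; rewrite /wt mulrDl mul1r.
apply: intg_le (intgZ (4 `^ (q + n%:R)) ih).
  apply: msbM; first exact: (msb_le (msb_cst _) msb_enorm).
  by apply: msbM; [apply: msb_powR; exact: msb_norm|exact: msb_rad].
move=> z; rewrite /tail_density; case: (lerP 2 (enorm z)) => h; last first.
  by rewrite mul0r normr0 !mulr_ge0 ?powR_ge0.
rewrite mul1r ger0_norm; last by rewrite mulr_ge0 ?powR_ge0.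
have h1 : 1 <= enorm z by move: h; clear; lra.
have z2 : enorm (0 : 'rV[R]_n) <= 2 by rewrite enorm0.
have := rad_wgt q0 z2 (@ltr01 R) (lexx _) h1; rewrite add0r divr1 => h2.
by rewrite mulrCA ler_wpM2l ?powR_ge0.
Qed.

Lemma tailE p s u : 1 < p -> s * p = p - 1 -> intg (tail_density (p - 1) u) ->
  tail s p u 0 2 = ((2 `^ (p - 1) * Ig (tail_density (p - 1) u)) `^ (p - 1)^-1)%:E.
Proof.
move=> p1 sp it; rewrite /tail sp.
have -> : [set z : 'rV[R]_n | 2 <= enorm (z - 0)] = [set z | 2 <= enorm z].
  by apply/funext => z /=; rewrite subr0.
rewrite (@integral_indicator_bool _ L R (leb n) (fun z => 2 <= enorm z)
  (fun z => `|u z| `^ (p - 1) / enorm (z - 0) `^ (n%:R + (p - 1)))).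
have -> : (fun y : 'rV[R]_n => ((2 <= enorm y)%R%:R *
    (`|u y| `^ (p - 1) / enorm (y - 0) `^ (n%:R + (p - 1))))%:E) =
  fun y => (tail_density (p - 1) u y)%:E.
  apply/funext => z; rewrite /tail_density /rad subr0 -powRN.
  by congr (_ * (_ * _ `^ _))%:E; ring.
by rewrite (intgE it) -EFinM poweR_EFin.
Qed.

Lemma log_modulus_fin p s f : s * p = p - 1 -> (log_modulus p s f < +oo)%E ->
  exists W, [/\ 0 <= W, log_modulus p s f = W%:E & log_mod_le W f].
Proof.
move=> sp fin.
have e : n%:R + 1 + 2 * p * (1 - s) = n.+3%:R :> R.
  have -> : 2 * p * (1 - s) = 2 * (p - s * p) by ring.
  by rewrite sp -!natr1; ring.
have b0 : eball (0 : 'rV[R]_n) 2 0 by apply/eball0E; rewrite enorm0.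
have mod0 t : 0 <= t -> (0 <= modulus (eball 0 2) f t)%E.
  move=> t0; apply: ereal_sup_ge; exists 0%E => //; exists (0, 0) => /=.
    by split=> //; rewrite subrr enorm0.
  by rewrite subrr normr0.
have h t : 0 < t -> t <= 1 ->
    (modulus (eball 0 2) f t * (`|ln t| ^+ n.+3)%:E <= log_modulus p s f)%E.
  move=> t0 t1; apply: ereal_sup_ubound; exists t; first by rewrite /= t0.
  by rewrite e powR_mulrn.
have l0 : (0 <= log_modulus p s f)%E.
  apply: le_trans (h 1 ltr01 (lexx _)); apply: mule_ge0; first exact: mod0.
  by rewrite lee_fin exprn_ge0.
have fl : log_modulus p s f \is a fin_num by rewrite ge0_fin_numE.
have el := fineK fl; exists (fine (log_modulus p s f)); split.
- by rewrite fine_ge0.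
- by rewrite el.
move=> x y x2 y2 t0 t1; rewrite -lee_fin el EFinM; apply: le_trans (h _ t0 t1).
apply: lee_wpmul2r; first by rewrite lee_fin exprn_ge0.
apply: ereal_sup_ubound; exists (x, y) => //=.
by split => //; apply/eball0E.
Qed.

(** If the set defining the seminorm were empty its supremum would be -oo;
    in positive dimension it contains the pair of a nonzero constant vector
    and 0. *)
Lemma holder_norm_real k alpha M : (1 <= n)%N -> holder_norm setT alpha k = M%:E ->
  [/\ 0 <= M, forall z, `|k z| <= M &
    forall z z', `|k z - k z'| <= M * enorm (z - z') `^ alpha].
Proof.
move=> n1 hM.
have s0 : (0 <= sup_norm setT k)%E.
  by apply: le_trans (@sup_norm_ge setT k 0 I); rewrite lee_fin.
have semi z z' : z != z' ->
    ((`|k z - k z'| / enorm (z - z') `^ alpha)%:E <= holder_seminorm setT alpha k)%E.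
  by move=> zz'; apply: ereal_sup_ubound; exists (z, z').
have h0 : (0 <= holder_seminorm setT alpha k)%E.
  have ne : (const_mx 1 : 'rV[R]_n) != 0.
    apply/eqP => /rowP /(_ (Ordinal n1)); rewrite !mxE; apply/eqP; exact: oner_neq0.
  by apply: le_trans (semi _ _ ne); rewrite lee_fin divr_ge0 ?powR_ge0.
have kM z : `|k z| <= M.
  rewrite -lee_fin -hM; apply: (le_trans (@sup_norm_ge setT k z I)).
  by rewrite /holder_norm leeDl.
have M0 : 0 <= M := le_trans (normr_ge0 _) (kM 0).
split=> // z z'; have [->|zz'] := eqVneq z z'.
  by rewrite !subrr normr0 mulr_ge0 ?powR_ge0.
have d0 : 0 < enorm (z - z') `^ alpha by rewrite powR_gt0// enorm_gt0 subr_eq0.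
rewrite -ler_pdivrMr// -lee_fin -hM; apply: (le_trans (semi _ _ zz')).
by rewrite /holder_norm leeDr.
Qed.

Lemma punctured_normalized p s q K k : 0 < q -> p * s = q -> normalized_kernel p s K k ->
  forall z, punctured K z = k z * rad (- q - n%:R) z.
Proof.
move=> q0 ps [hk _] z; rewrite /punctured /rad; case: (eqVneq z 0) => [->|z0].
  rewrite mul0r enorm0 powR0 ?mulr0//; apply/ltr0_neq0.
  by have := ler0n R n; move: q0; clear; lra.
have zp : 0 < enorm z by rewrite enorm_gt0.
rewrite mul1r hk// ps -mulrA -powRD_pos// (_ : n%:R + q + (- q - n%:R) = 0); last by ring.
by rewrite powRr0 mulr1.
Qed.

Lemma holder_norm_le D u A B : D !=set0 -> 0 <= B -> (forall x, D x -> `|u x| <= A) ->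
  (forall x y, D x -> D y -> `|u x - u y| <= B * enorm (x - y)) ->
  (holder_norm D 1 u <= (A + B)%:E)%E.
Proof.
move=> [x0 Dx0] B0 hA hB; rewrite /holder_norm EFinD; apply: leeD.
  by apply: ge_ereal_sup => _ [x /hA h <-]; rewrite lee_fin.
apply: ge_ereal_sup => _ [[x y] /= [Dx Dy xy] <-].
rewrite lee_fin powRr1 ?enorm_ge0// ler_pdivrMr ?enorm_gt0 ?subr_eq0//.
exact: hB.
Qed.

End function_space_data.

(** * Estimates for viscosity solutions *)

Section assembly.
Context {R : realType} {n : nat}.
Local Notation L := (lebesgue_rV R n).
Local Notation msb := (@measurableR _ L R).
Local Notation intg := (@integrableR _ L R (leb n)).
Local Notation Ig := (@integralR _ L R (leb n)).
Implicit Types (p s lam Lam q r c m W F o S alpha : R) (u K k f g : 'rV[R]_n -> R) (x y z : 'rV[R]_n) (D : set 'rV[R]_n).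

Lemma norm_sol_of_visc p s lam Lam K u f g m : (1 <= n)%N -> 1 < p -> 0 < s < 1 ->
  s * p = p - 1 -> 0 < lam -> lam <= Lam -> kernel_bounds p s lam Lam K ->
  {within closure (eball 0 2), continuous u} -> Lsp s p u ->
  visc_subsol p s K f (eball 0 2) u -> visc_supersol p s K g (eball 0 2) u ->
  0 < m -> (sup_norm (eball 0 2) u <= m%:E)%E -> (tail s p u 0 2 <= m%:E)%E ->
  norm_sol lam Lam (p - 1) (@wt_bound R n (p - 1)) (punctured K)
    (fun x => m^-1 `^ (p - 1) * f x) (fun x => m^-1 `^ (p - 1) * - g x) (fun x => m^-1 * u x).
Proof.
move=> n1 p1 s01 sp l0 lL kb cu lsp vsub vsup m0 Sm tm.
set q := p - 1; have q0 : 0 < q by rewrite subr_gt0.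
have l0' := ltW l0; have L0 := le_trans l0' lL.
have c0 : 0 < m^-1 by rewrite invr_gt0.
have kK := kern_punctured q0 (etrans (mulrC p s) sp) kb.
have [mu iw it] := Lsp_intg p1 sp lsp; rewrite -/q in iw it.
have wN : wt q (fun x => - u x) = wt q u by apply/funext => z; rewrite /wt normrN.
have mNu : msb (fun x => - u x).
  have := msbM (msb_cst (-1)) mu; by under eq_fun do rewrite mulN1r.
have iwN : intg (wt q (fun x => - u x)) by rewrite wN.
have mc : msb (fun x => m^-1 * u x) := msbM (msb_cst m^-1) mu.
have uc x : enorm x < 2 -> `|m^-1 * u x| <= 1.
  move=> x2; rewrite normrM (gtr0_norm c0) mulrC ler_pdivrMr// mul1r -lee_fin.
  by apply: le_trans Sm; apply: sup_norm_ge; apply/eball0E.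
have T0 : 0 <= Ig (tail_density q u).
  by apply: Ig_ge0 => z; rewrite mulr_ge0// mulr_ge0 ?powR_ge0.
have Tm : Ig (tail_density q u) <= m `^ q.
  have p2 : 1 <= 2 `^ q :> R.
    by rewrite -[leLHS](powRr0 2); apply: ler_powR; [rewrite ler1n|exact: ltW].
  apply: (@le_trans _ _ (2 `^ q * Ig (tail_density q u))); first by rewrite ler_peMl.
  have X0 : 0 <= 2 `^ q * Ig (tail_density q u) by rewrite mulr_ge0 ?powR_ge0.
  have := tm; rewrite (tailE p1 sp it) lee_fin -/q => h.
  have := powR_mono (ltW q0) (powR_ge0 _ _) h.
  by rewrite -powRrM mulVf ?gt_eqF// powRr1.
have itc : intg (tail_density q (fun x => m^-1 * u x)).
  by rewrite (tail_densityZ _ q0 (ltW c0)); exact: intgZ.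
have Tc : Ig (tail_density q (fun x => m^-1 * u x)) <= 1.
  rewrite (tail_densityZ _ q0 (ltW c0)) (IgZ _ it).
  have := ler_wpM2l (powR_ge0 m^-1 q) Tm.
  by rewrite -powRM ?(ltW m0) ?(ltW c0)// mulVf ?gt_eqF// powR1.
have [iwc wc] := wt_normalized q0 mc itc Tc uc.
split=> //.
- move=> x x2; apply: cts_mul; [exact: cts_cst|exact: interior_continuous].
- exact: parab_ineqZ l0' L0 q0 c0 kK mu iw (visc_subsol_parab n1 p1 s01 sp l0' L0 kb mu iw vsub).
have -> : (fun x => - (m^-1 * u x)) = fun x => m^-1 * - u x.
  by apply/funext => x; rewrite mulrN.
exact: parab_ineqZ l0' L0 q0 c0 kK mNu iwN (visc_subsol_parab n1 p1 s01 sp l0' L0 kb mNu iwN vsup).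
Qed.

Lemma tail_fin p s u : 1 < p -> s * p = p - 1 -> Lsp s p u ->
  exists2 t : R, 0 <= t & tail s p u 0 2 = t%:E.
Proof.
move=> p1 sp lsp; have [_ _ it] := Lsp_intg p1 sp lsp.
by rewrite (tailE p1 sp it); eexists; last reflexivity; exact: powR_ge0.
Qed.

Lemma root_le (C m r : R) : 0 < r -> 0 <= C -> 0 < m -> C `^ r^-1 <= m -> m^-1 `^ r * C <= 1.
Proof.
move=> r0 C0 m0 h; have c0 : 0 < m^-1 by rewrite invr_gt0.
have e : C = C `^ r^-1 `^ r by rewrite -powRrM mulVf ?gt_eqF// powRr1.
rewrite e -powRM ?(ltW c0) ?powR_ge0//.
apply: (@le_trans _ _ (1 `^ r)); last by rewrite powR1.
apply: powR_mono; [exact: ltW| |].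
  by rewrite mulr_ge0 ?powR_ge0// ltW.
by rewrite mulrC ler_pdivrMr// mul1r.
Qed.

Lemma scaled_diff (u : 'rV[R]_n -> R) m B x y : 0 < m -> m^-1 * u x - m^-1 * u y <= B ->
  u x - u y <= m * B.
Proof. by move=> m0; rewrite -mulrBr mulrC ler_pdivrMr// mulrC. Qed.

(** If the bracket m vanishes, then u = 0 on B_2; otherwise divide u by m. *)
Lemma lipschitz_visc p s : (1 <= n)%N -> 1 < p -> 0 < s < 1 -> s * p = p - 1 ->
  forall lam Lam alpha M, 0 < lam -> lam <= Lam -> 0 < alpha ->
  exists2 C : R, 0 <= C & forall K k,
    kernel_bounds p s lam Lam K -> normalized_kernel p s K k ->
    holder_norm setT alpha k = M%:E ->
  forall u f, {within closure (eball 0 2), continuous u} -> Lsp s p u ->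
    visc_sol p s K f (eball 0 2) u -> (log_modulus p s f < +oo)%E ->
  exists m : R, [/\ 0 <= m,
    (sup_norm (eball 0 2) u + tail s p u 0 2 + log_modulus p s f `^ (p - 1)^-1 = m%:E)%E,
    forall x, enorm x < 2 -> `|u x| <= m &
    forall x y, enorm x <= 1 -> enorm y <= 1 -> `|u x - u y| <= C * m * enorm (x - y)].
Proof.
move=> n1 p1 s01 sp lam Lam alpha M l0 lL a0.
have [M0|M0] := lerP 0 M; last first.
  exists 0 => // K k _ _ hM; have [h _ _] := holder_norm_real n1 hM.
  by move: h; rewrite leNgt M0.
set q := p - 1; have q0 : 0 < q by rewrite subr_gt0.
have l0' := ltW l0; have L0 := le_trans l0' lL.
have W0 := @wt_bound_ge0 R n q.
pose cf := @touch_cst R n Lam q (@wt_bound R n q) + 2 * @osc_cst R n.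
have cf0 : 0 <= cf.
  have h1 : 0 <= @touch_cst R n Lam q (@wt_bound R n q).
    apply: addr_ge0; first exact: far_cst_ge0.
    apply: mulr_ge0; first exact: near_cst_ge0.
    by apply: mulr_ge0; exact: powR_ge0.
  have h2 : 0 <= @osc_cst R n.
    by rewrite /osc_cst mulr_ge0// invr_ge0 exprn_ge0// ltW// ln2_pos.
  by rewrite /cf addr_ge0// mulr_ge0.
have [C C0 hC] := lipschitz_norm n1 q0 l0 lL M0 a0 W0 cf0.
exists C => // K k kb nk hM u f cu lsp [vsub vsup] fl.
have [_ kM kH] := holder_norm_real n1 hM.
have [S [S0 eS uS]] := sup_norm_fin cu.
have [t t0 et] := tail_fin p1 sp lsp.
have [W [Wf0 eW fW]] := log_modulus_fin sp fl.
pose w := W `^ q^-1; have w0 : 0 <= w := powR_ge0 _ _.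
pose m := S + t + w; have m_ge0 : 0 <= m by rewrite !addr_ge0.
exists m; split=> //.
- by rewrite eS et eW poweR_EFin.
- by move=> x /uS h; apply: (le_trans h); rewrite /m; move: t0 w0; clear; lra.
move=> x y x1 y1.
have [mp|mp] := ltrP 0 m; last first.
  have Sz : S <= 0 by move: mp t0 w0; rewrite /m; clear; lra.
  have ux0 z : enorm z <= 1 -> u z = 0.
    move=> z1; apply/eqP; rewrite -normr_le0; apply: le_trans Sz; apply: uS.
    by move: z1; clear; lra.
  by rewrite !ux0// subrr normr0 mulr_ge0 ?enorm_ge0// mulr_ge0.
have Sm : (sup_norm (eball 0 2) u <= m%:E)%E.
  by rewrite eS lee_fin /m; move: t0 w0; clear; lra.
have tm : (tail s p u 0 2 <= m%:E)%E.
  by rewrite et lee_fin /m; move: S0 w0; clear; lra.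
have wm : w <= m by rewrite /m; move: S0 t0; clear; lra.
have := norm_sol_of_visc n1 p1 s01 sp l0 lL kb cu lsp vsub vsup mp Sm tm; rewrite -/q.
set f' := fun x => m^-1 `^ q * f x.
have -> : (fun x => m^-1 `^ q * - f x) = fun x => - f' x.
  by apply/funext => z; rewrite /f' mulrN.
move=> ns; have fW' : log_mod_le 1 f'.
  move=> z z' h1 h2 h3 h4; rewrite /f' -mulrBr normrM (ger0_norm (powR_ge0 _ _)) -mulrA.
  apply: le_trans (root_le q0 Wf0 mp wm); rewrite ler_wpM2l ?powR_ge0//; exact: fW.
have fb := rhs_bound l0' L0 q0 ns fW'.
have pk := punctured_normalized q0 (etrans (mulrC p s) sp) nk.
have est := hC _ k f' _ ns fb fW' pk kM kH.
have y32 : enorm y <= 3 / 2 by move: y1; clear; lra.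
have x32 : enorm x <= 3 / 2 by move: x1; clear; lra.
have e1 := scaled_diff mp (est x y x1 y32).
have e2 := scaled_diff mp (est y x y1 x32); rewrite enormBC in e2.
have -> : C * m * enorm (x - y) = m * (C * enorm (x - y)) by ring.
by rewrite ler_norml; apply/andP; split; [move: e2; clear; lra|exact: e1].
Qed.

Lemma log_lipschitz_visc p s : (1 <= n)%N -> 1 < p -> 0 < s < 1 -> s * p = p - 1 ->
  exists N : nat, forall lam Lam, 0 < lam -> lam <= Lam ->
  exists2 C : R, 0 <= C & forall K, kernel_bounds p s lam Lam K ->
  forall u c, 0 <= c -> {within closure (eball 0 2), continuous u} -> Lsp s p u ->
    visc_subsol p s K (fun=> c) (eball 0 2) u -> visc_supersol p s K (fun=> - c) (eball 0 2) u ->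
  exists m : R, [/\ 0 <= m,
    (sup_norm (eball 0 2) u + tail s p u 0 2 + (c `^ (p - 1)^-1)%:E = m%:E)%E &
    forall x y, enorm x <= 1 -> enorm y <= 1 ->
      `|u x - u y| <= C * m * (enorm (x - y) * (1 + `|ln (enorm (x - y))| ^+ N))].
Proof.
move=> n1 p1 s01 sp.
set q := p - 1; have q0 : 0 < q by rewrite subr_gt0.
have [N hN] := log_lipschitz_norm n1 q0; exists N => lam Lam l0 lL.
have W0 := @wt_bound_ge0 R n q.
have [C C0 hC] := hN lam Lam (@wt_bound R n q) 1 l0 lL W0 ler01.
exists C => // K kb u c c0 cu lsp vsub vsup.
have [S [S0 eS uS]] := sup_norm_fin cu.
have [t t0 et] := tail_fin p1 sp lsp.
pose w := c `^ q^-1; have w0 : 0 <= w := powR_ge0 _ _.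
pose m := S + t + w; have m_ge0 : 0 <= m by rewrite !addr_ge0.
exists m; split=> //; first by rewrite eS et.
move=> x y x1 y1.
have [mp|mp] := ltrP 0 m; last first.
  have Sz : S <= 0 by move: mp t0 w0; rewrite /m; clear; lra.
  have ux0 z : enorm z <= 1 -> u z = 0.
    move=> z1; apply/eqP; rewrite -normr_le0; apply: le_trans Sz; apply: uS.
    by move: z1; clear; lra.
  rewrite !ux0// subrr normr0; apply: mulr_ge0; first exact: mulr_ge0.
  by apply: mulr_ge0; [exact: enorm_ge0|apply: addr_ge0 => //; exact: exprn_ge0].
have Sm : (sup_norm (eball 0 2) u <= m%:E)%E.
  by rewrite eS lee_fin /m; move: t0 w0; clear; lra.
have tm : (tail s p u 0 2 <= m%:E)%E.
  by rewrite et lee_fin /m; move: S0 w0; clear; lra.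
have wm : w <= m by rewrite /m; move: S0 t0; clear; lra.
have [kK mu iw bw cc u1 v1 v2] := norm_sol_of_visc n1 p1 s01 sp l0 lL kb cu lsp vsub vsup mp Sm tm.
have c1 := root_le q0 c0 mp wm.
have ns : norm_sol lam Lam q (@wt_bound R n q) (punctured K) (fun=> 1) (fun=> 1) (fun x => m^-1 * u x).
  split=> //; first exact: parab_ineq_mono v1.
  by apply: parab_ineq_mono v2 => z _; rewrite opprK.
have est := hC _ _ ns.
have x32 : enorm x <= 3 / 2 by move: x1; clear; lra.
have y32 : enorm y <= 3 / 2 by move: y1; clear; lra.
have x74 : enorm x <= 7 / 4 by move: x1; clear; lra.
have y74 : enorm y <= 7 / 4 by move: y1; clear; lra.
have e1 := scaled_diff mp (est x y x32 y74).
have e2 := scaled_diff mp (est y x y32 x74); rewrite (enormBC y x) in e2.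
rewrite (mulrC C) -mulrA.
by rewrite ler_norml; apply/andP; split; [move: e2; clear; lra|exact: e1].
Qed.

End assembly.

Theorem theorem6p1 (R : realType) (n : nat) (p s : R)
    (hn : (1 <= n)%N) (hp : 1 < p) (hs : 0 < s < 1)
    (hsp : s * p / (p - 1) = 1) :
  (forall lam Lam alpha M : R, 0 < lam -> lam <= Lam -> 0 < alpha ->
    exists C1 : R, forall K k : 'rV[R]_n -> R,
      kernel_bounds p s lam Lam K ->
      normalized_kernel p s K k ->
      holder_norm setT alpha k = M%:E ->
      forall u f : 'rV[R]_n -> R,
        {within closure (eball 0 2), continuous u} ->
        Lsp s p u ->
        visc_sol p s K f (eball 0 2) u ->
        (log_modulus p s f < +oo)%E ->
        (holder_norm (eball 0 1) 1 u < +oo)%E /\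
        (holder_norm (eball 0 1) 1 u <=
           C1%:E * (sup_norm (eball 0 2) u + tail s p u 0 2
                    + log_modulus p s f `^ (p - 1)^-1))%E)
  /\
  (exists2 theta : R, 0 < theta &
    forall lam Lam alpha M : R, 0 < lam -> lam <= Lam -> 0 < alpha ->
    exists C1 : R, forall K k : 'rV[R]_n -> R,
      kernel_bounds p s lam Lam K ->
      normalized_kernel p s K k ->
      holder_norm setT alpha k = M%:E ->
      forall (u : 'rV[R]_n -> R) (C : R), 0 <= C ->
        {within closure (eball 0 2), continuous u} ->
        Lsp s p u ->
        visc_subsol p s K (fun=> C) (eball 0 2) u ->
        visc_supersol p s K (fun=> - C) (eball 0 2) u ->
        forall x y, eball 0 1 x -> eball 0 1 y ->
          (`|u x - u y|%:E <=
             C1%:E * (sup_norm (eball 0 2) u + tail s p u 0 2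
                      + (C `^ (p - 1)^-1)%:E)
             * (enorm (x - y)
                * (1 + `|ln (enorm (x - y))| `^ theta))%:E)%E).
Proof.
have p10 : 0 < p - 1 by rewrite subr_gt0.
have sp : s * p = p - 1.
  by have := congr1 ( *%R^~ (p - 1)) hsp; rewrite /= divfK ?gt_eqF// mul1r.
have b1 x : @eball R n 0 1 x -> enorm x <= 1 by move/eball0E; exact: ltW.
split.
  move=> lam Lam alpha M l0 lL a0.
  have [C C0 hC] := @lipschitz_visc R n p s hn hp hs sp lam Lam alpha M l0 lL a0.
  exists (1 + C) => K k kb nk hM u f cu lsp vs fl.
  have [m [m0 em um lip]] := hC K k kb nk hM u f cu lsp vs fl.
  have h : (holder_norm (eball 0 1) 1 u <= ((1 + C) * m)%:E)%E.
    rewrite mulrDl mul1r; apply: holder_norm_le.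
    - by exists 0; apply/eball0E; rewrite enorm0.
    - exact: mulr_ge0.
    - by move=> x /b1 x1; apply: um; move: x1; clear; lra.
    - by move=> x y /b1 x1 /b1 y1; exact: lip.
  by split; [apply: le_lt_trans h _; exact: ltry|rewrite em -EFinM].
have [N hN] := @log_lipschitz_visc R n p s hn hp hs sp.
(* The successor keeps the exponent positive at the cost of a factor 2. *)
exists N.+1%:R => // lam Lam alpha M l0 lL a0.
have [C C0 hC] := hN lam Lam l0 lL; exists (2 * C) => K k kb _ _ u c c0 cu lsp v1 v2 x y x1 y1.
have [m [m0 em lip]] := hC K kb u c c0 cu lsp v1 v2.
rewrite em -!EFinM lee_fin powR_mulrn//; apply: (le_trans (lip x y (b1 x x1) (b1 y y1))).
have pw (a : R) : 0 <= a -> 1 + a ^+ N <= 2 * (1 + a ^+ N.+1).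
  move=> ha; have hN1 : 0 <= a ^+ N.+1 := exprn_ge0 _ ha.
  have [a1|a1] := lerP a 1.
    by have := exprn_ile1 N ha a1; move: hN1; clear; lra.
  have := exprn_ge0 N ha; rewrite exprS; move: a1; clear; nra.
have h := ler_wpM2l (mulr_ge0 (mulr_ge0 C0 m0) (enorm_ge0 (x - y)))
  (pw _ (normr_ge0 (ln (enorm (x - y))))).
rewrite mulrA; apply: (le_trans h); rewrite le_eqVlt; apply/orP; left; apply/eqP; ring.
Qed.
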